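(* Let $\beta\in\mathbb{R}$ with $\beta\neq 2l$ for all $l\in\mathbb{Z}$, let $\psi\in\mathfrak{M}_0'=\mathfrak{M}_0'(\beta)$, and let $\omega$ be a convex upwards (i.e. concave) modulus of continuity. Assume that $$\lim_{n\to\infty}\frac{|\psi'(n)|\,n}{\psi(n)}=0\qquad\text{and}\qquad\lim_{n\to\infty}\frac{\omega'(1/n)}{\omega(1/n)\,n}=0,$$ where $\psi'(n):=\psi'(n+)$ and $\omega'(1/n):=\omega'(1/n+)$ denote right derivatives. Then the following asymptotic formula holds as $n\to\infty$ ($n\in\mathbb{N}$): $$E_n(C^{\psi}_{\beta}H_\omega)=\frac1\pi\Big|\sin\frac{\beta\pi}{2}\Big|\int_0^{1/n}\psi\Big(\frac1t\Big)\frac{\omega(t)}{t}\,dt+O(1)\,\psi(n)\,\omega(1/n),$$ where $O(1)$ is a quantity uniformly bounded in $n$ and $\beta$. (Here ''asymptotic formula'' means that the second summand on the right is $o$ of the first one as $n\to\infty$.)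
   Context: $L$ is the space of $2\pi$-periodic functions summable over the period; $C$ is the space of continuous $2\pi$-periodic functions with norm $\|f\|_C=\max_t|f(t)|$. A modulus of continuity is a continuous nondecreasing function $\omega$ on $[0,\infty)$ with $\omega(0)=0$ and $\omega(s+t)\le\omega(s)+\omega(t)$. $(\psi,\beta)$-derivative: for $f\in L$ with Fourier series $\frac{a_0}{2}+\sum_{k\ge1}(a_k\cos kx+b_k\sin kx)$, a sequence $\psi(k)$ and $\beta\in\mathbb{R}$, if the series $$\sum_{k=1}^\infty\frac1{\psi(k)}\Big(a_k\cos\big(kx+\tfrac{\beta\pi}{2}\big)+b_k\sin\big(kx+\tfrac{\beta\pi}{2}\big)\Big)$$ is the Fourier series of some $\varphi\in L$, then $\varphi$ is called the $(\psi,\beta)$-derivative of $f$, denoted $f^\psi_\beta$. $H_\omega=\{\varphi\in C:\ |\varphi(t')-\varphi(t'')|\le\omega(|t'-t''|)\ \forall t',t''\in\mathbb{R}\}$, and $C^\psi_\beta H_\omega$ is the set of continuous ($2\pi$-periodic) functions $f$ having a $(\psi,\beta)$-derivative with $f^\psi_\beta\in H_\omega$. $E_n(C^\psi_\beta H_\omega)=\sup_{f\in C^\psi_\beta H_\omega}\inf_{t_{n-1}}\|f-t_{n-1}\|_C$, the infimum being over trigonometric polynomials $t_{n-1}$ of order at most $n-1$. $\mathfrak{M}$ is the set of all continuous (positive) functions $\psi(t)$, $t\ge1$, that are convex downwards (convex in the usual sense) and satisfy $\lim_{t\to\infty}\psi(t)=0$. For $\psi\in\mathfrak{M}$ put $\eta(t)=\psi^{-1}(\psi(t)/2)$,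 with $\psi^{-1}$ the inverse function of $\psi$, and $\mu(t)=\mu(\psi;t)=\frac{t}{\eta(t)-t}$. Then $\mathfrak{M}_0=\{\psi\in\mathfrak{M}:\ 0<\mu(t)\le K<\infty\ \forall t\ge1\}$, where $K$ is a constant possibly depending on $\psi$. $\mathfrak{M}'=\mathfrak{M}'(\beta)$ is the set of $\psi\in\mathfrak{M}$ if $\sin\frac{\beta\pi}{2}=0$, and the set of $\psi\in\mathfrak{M}$ with $\int_1^\infty\frac{\psi(t)}{t}\,dt<\infty$ if $\sin\frac{\beta\pi}{2}\ne0$. Finally $\mathfrak{M}_0'=\mathfrak{M}'\cap\mathfrak{M}_0$. *)

(* Defs.v *)
From HB Require Import structures.
From mathcomp Require Import all_boot all_order all_algebra.
From mathcomp Require Import all_classical all_reals all_analysis.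

Set Implicit Arguments.
Unset Strict Implicit.
Unset Printing Implicit Defensive.

Import Order.TTheory GRing.Theory Num.Theory.
Import numFieldNormedType.Exports.

Local Open Scope classical_set_scope.
Local Open Scope ring_scope.

Section PeriodicFunctions.
Variable R : realType.
Implicit Types (f phi : R -> R) (psi omega : R -> R) (beta : R).

Local Notation mu := (@lebesgue_measure R).

Definition periodic_integrable : set (R -> R) :=
  [set f : R -> R | periodic f (2 * pi)
           /\ mu.-integrable `[- pi, pi] (EFin \o f)].

Definition periodic_continuous : set (R -> R) :=
  [set f : R -> R | periodic f (2 * pi) /\ continuous f].

(* Extended-real valued, so that no boundedness side condition is needed; on
   [periodic_continuous] the supremum is a maximum. *)
Definition uniform_norm f : \bar R := ereal_sup (range (fun t => `|f t|%:E)).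

Definition fourier_cos f (k : nat) : R :=
  pi^-1 * \int[mu]_(t in `[- pi, pi]) (f t * cos (k%:R * t)).

Definition fourier_sin f (k : nat) : R :=
  pi^-1 * \int[mu]_(t in `[- pi, pi]) (f t * sin (k%:R * t)).

(* The general term (at x) of the Fourier series of f; for k = 0 it is a_0/2. *)
Definition fourier_term f (k : nat) (x : R) : R :=
  if k is 0 then fourier_cos f 0 / 2
  else fourier_cos f k * cos (k%:R * x) + fourier_sin f k * sin (k%:R * x).

(* "The series is the Fourier series of phi" is an equality of formal
   trigonometric series, i.e. of their general terms as functions of x: no
   convergence is involved.  The series starts at k = 1, so the constant term
   of phi vanishes.  Such a phi is determined almost everywhere only, whence a
   relation rather than a function. *)
Definition psi_beta_derivative psi beta f phi : Prop :=
  [/\ periodic_integrable f, periodic_integrable phi,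
      forall x, fourier_term phi 0 x = 0
    & forall (k : nat) (x : R), (0 < k)%N ->
        fourier_term phi k x =
          (psi k%:R)^-1 *
            (fourier_cos f k * cos (k%:R * x + beta * pi / 2)
             + fourier_sin f k * sin (k%:R * x + beta * pi / 2))].

(* Only the values of omega on [0, +oo[ matter. *)
Definition modulus_of_continuity omega : Prop :=
  [/\ {within `[0, +oo[, continuous omega},
      {in `[0, +oo[ &, {homo omega : s t / s <= t}},
      omega 0 = 0
    & {in `[0, +oo[ &, forall s t, omega (s + t) <= omega s + omega t}].

Definition convex_upwards omega : Prop :=
  convex_function (`[0, +oo[ : set R) (fun t => - omega t).

Definition Hclass omega : set (R -> R) :=
  [set phi : R -> R | periodic_continuous phi
             /\ forall t' t'', `|phi t' - phi t''| <= omega `|t' - t''|].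

Definition Cclass psi beta omega : set (R -> R) :=
  [set f : R -> R | periodic_continuous f
           /\ exists2 phi, psi_beta_derivative psi beta f phi
                         & Hclass omega phi].

Definition trig_poly (m : nat) : set (R -> R) :=
  [set t : R -> R | exists a b : nat -> R, forall x,
     t x = a 0 / 2
           + \sum_(1 <= k < m.+1)
               (a k * cos (k%:R * x) + b k * sin (k%:R * x))].

(* Meant for n >= 1: trigonometric polynomials of order at most n - 1. *)
Definition best_approx (n : nat) f : \bar R :=
  ereal_inf [set uniform_norm (fun x => f x - t x) | t in trig_poly n.-1].

Definition class_approx (n : nat) (A : set (R -> R)) : \bar R :=
  ereal_sup [set best_approx n f | f in A].

(* psi is a function on [1, +oo[; its values elsewhere are irrelevant. *)
Definition Mset : set (R -> R) :=
  [set psi : R -> R | [/\ forall t, 1 <= t -> 0 < psi t,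
                 {within `[1, +oo[, continuous psi},
                 convex_function (`[1, +oo[ : set R) psi
               & psi t @[t --> +oo] --> 0]].

(* The inverse is that of psi restricted to [1, +oo[; for psi in Mset this
   restriction is injective and psi t / 2 lies in its range, so the default
   value 1 is never used. *)
Definition eta_of psi (t : R) : R := 'pinv_(fun=> 1) `[1, +oo[ psi (psi t / 2).

Definition mu_of psi (t : R) : R := t / (eta_of psi t - t).

Definition Mset0 : set (R -> R) :=
  [set psi : R -> R | Mset psi
             /\ exists K : R, forall t, 1 <= t -> 0 < mu_of psi t <= K].

Definition Mset' beta : set (R -> R) :=
  [set psi : R -> R | Mset psi
             /\ (sin (beta * pi / 2) != 0 ->
                 (\int[mu]_(t in `[1%R, +oo[) (psi t / t)%:E < +oo)%E)].

Definition Mset0' beta : set (R -> R) := Mset' beta `&` Mset0.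

(* For convex or concave f the limit exists at every interior point of the
   domain. *)
Definition right_derivative f (x : R) : R :=
  lim ((f (x + h) - f x) / h @[h --> 0^'+]).

Definition leading_term psi omega beta (n : nat) : R :=
  pi^-1 * `|sin (beta * pi / 2)|
  * \int[mu]_(t in `]0, n%:R^-1]) (psi t^-1 * (omega t / t)).

End PeriodicFunctions.

(* Main.v *)
Require Import Defs.
From HB Require Import structures.
From mathcomp Require Import all_boot all_order all_algebra.
From mathcomp Require Import all_classical all_reals all_analysis.
From mathcomp Require Import measurable_realfun.
From mathcomp Require Import ring lra zify.

Set Implicit Arguments.
Unset Strict Implicit.
Unset Printing Implicit Defensive.

Import Order.TTheory GRing.Theory Num.Theory.
Import numFieldNormedType.Exports.

Local Open Scope classical_set_scope.
Local Open Scope ring_scope.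

(** Write g = beta pi / 2 and d n = psi(n) omega(1/n). Both asymptotic bounds are
obtained with constants that depend on psi and omega only, by comparing
everything with the series of psi(j) omega(1/j) / j over j >= n, which equals the
integral over ]0, 1/n] up to O(d n) ([lead_integral_upper],
[lead_integral_lower]).

Upper bound. Let phi be the (psi, beta)-derivative of f. The harmonics of f are
psi(k) times those of phi with the phase shifted by g, so the N-th Fejer mean of
f has the coefficients th k = (1 - k/(N+1)) psi(k), a nonnegative decreasing
convex sequence. Summing by parts twice ([abel_twice]) writes it, modulo
trigonometric polynomials of order n - 1, as a combination with nonnegative
weights of differences s_m - s_(n-1), m >= n, of phase-shifted Fejer means of
phi. Such a difference is the integral of phi against cos g times a difference
of Fejer kernels minus sin g times a difference of conjugate Fejer kernels. The
former decays like 1 / t^2; the latter behaves like 1 / t on [1/m, 1/n], which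
gives ([mean_difference])
  |s_m - s_(n-1)| <= |sin g| / pi * sum_(n <= j <= m) omega(2/j) / j
                     + O(omega(1/n)).
Exchanging the sums, the weights add up to th j + j (th j - th (j+1)) from j on,
and pairing the indices 2i and 2i + 1 replaces omega(2/j) by omega(1/j). Fejer's
theorem lets N tend to infinity ([class_approx_upper]).

The limit hypotheses, together with concavity of omega and convexity of psi, say
that omega(1/n) and psi(n) vary slowly ([om_slow], [psi_slow]). Hence the sum of
omega(1/k), k <= n, is O(n omega(1/n)), which bounds the contribution of t far
from 0, and n (psi(n) - psi(n+1)) is O(psi(n)), which bounds the total weight.

Lower bound. Let H be the odd function equal to omega(2u)/2 for u >= 0 and take
phi(x) = H(sin(n x) / n), which by concavity belongs to H_omega; its Fejer means
belong to it as well, and are (psi, beta)-derivatives of polynomials f in the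
class. All frequencies of f are odd multiples of n, so f changes sign under
translation by pi / n, and the alternating mean over the points pi l / n, which
annihilates polynomials of order n - 1, shows that the best approximation of f is
at least |f 0| ([best_approx_alternating]). Now |f 0| is |sin g| times a sum of
sine coefficients of H(sin s / n), which the same double summation by parts and
the behaviour 1 / t of the conjugate kernels bound from below by the same series
([cesaro_sin_coef_lower], [class_approx_lower]).

Finally slow variation keeps psi(j) omega(1/j) comparable to d n for j up to any
fixed multiple of n, so the series contains arbitrarily long pieces of the
harmonic series times d n, and d n is negligible with respect to the leading term
([lead_integral_dominates]). *)

(** * Continuous functions of a real variable *)

Section ContinuousCombinators.
Variable R : realType.
Implicit Types f g : R -> R.

Lemma ct_cst (c : R) : continuous (fun _ : R => c).
Proof. by move=> x; exact: cvg_cst. Qed.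

Lemma ct_id : continuous (fun x : R => x).
Proof. by move=> x; exact: cvg_id. Qed.

Lemma ctD f g : continuous f -> continuous g -> continuous (fun x => f x + g x).
Proof. by move=> cf cg x; apply: cvgD; [exact: cf|exact: cg]. Qed.

Lemma ctN f : continuous f -> continuous (fun x => - f x).
Proof. by move=> cf x; apply: cvgN; exact: cf. Qed.

Lemma ctM f g : continuous f -> continuous g -> continuous (fun x => f x * g x).
Proof. by move=> cf cg x; apply: cvgM; [exact: cf|exact: cg]. Qed.

Lemma ct_comp f g : continuous f -> continuous g -> continuous (fun x => f (g x)).
Proof. by move=> cf cg x; apply: continuous_comp; [exact: cg|exact: cf]. Qed.

Lemma ct_cos f : continuous f -> continuous (fun x => cos (f x)).
Proof. by apply: ct_comp; exact: continuous_cos. Qed.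

Lemma ct_sin f : continuous f -> continuous (fun x => sin (f x)).
Proof. by apply: ct_comp; exact: continuous_sin. Qed.

Lemma ct_norm f : continuous f -> continuous (fun x => `|f x|).
Proof. by move=> cf x; apply: cvg_norm; exact: cf. Qed.

Lemma ct_sum (I : Type) (s : seq I) (P : pred I) (F : I -> R -> R) :
  (forall i, continuous (F i)) -> continuous (fun x => \sum_(i <- s | P i) F i x).
Proof.
move=> cF; elim: s => [|i s IH].
  by under eq_fun do rewrite big_nil; exact: ct_cst.
by case Pi: (P i); under eq_fun do rewrite big_cons Pi; [exact: ctD|].
Qed.

End ContinuousCombinators.

(** Closes continuity goals by following the syntax of the function. *)
Ltac cts_step := lazymatch goal with
 | |- continuous (fun x => @?a x + @?b x) => apply: (@ctD _ a b)
 | |- continuous (fun x => @?a x * @?b x) => apply: (@ctM _ a b)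
 | |- continuous (fun x => - @?a x) => apply: (@ctN _ a)
 | |- continuous (fun x => cos (@?a x)) => apply: (@ct_cos _ a)
 | |- continuous (fun x => sin (@?a x)) => apply: (@ct_sin _ a)
 | |- continuous (fun x => `| @?a x |) => apply: (@ct_norm _ a)
 | |- continuous (fun x => \sum_(i <- _ | _) _) => apply: ct_sum => ?
 | |- continuous (fun x => x) => exact: ct_id
 | |- continuous (fun _ => ?c) => exact: ct_cst
 | |- continuous (fun x => ?f (@?a x)) => apply: (@ct_comp _ f a); [done|]
 | |- continuous ?f => done
 end.
Ltac cts := repeat cts_step.

(** * Integrals of continuous functions over compact intervals *)

Section ContinuousIntegrals.
Variable R : realType.
Local Notation mu := (@lebesgue_measure R).
Implicit Types (f g : R -> R) (a b c : R).

(** Every integrand below, except the one of the leading term, is continuous on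
the whole line; under that assumption the rules of integration over a compact
interval carry no integrability conditions. *)
Definition intg a b f : R := \int[mu]_(t in `[a, b]) f t.

Lemma ct_integrable a b f : continuous f -> mu.-integrable `[a, b] (EFin \o f).
Proof.
move=> cf; apply: continuous_compact_integrable; first exact: segment_compact.
exact: continuous_subspaceT.
Qed.

Lemma eq_intg a b f g : (forall t, a <= t <= b -> f t = g t) ->
  intg a b f = intg a b g.
Proof. by move=> fg; apply: eq_Rintegral => t; rewrite inE /= in_itv /= => /fg. Qed.

Lemma intgD a b f g : continuous f -> continuous g ->
  intg a b (fun t => f t + g t) = intg a b f + intg a b g.
Proof. by move=> cf cg; apply: RintegralD => //; exact: ct_integrable. Qed.

Lemma intgZ a b c f : continuous f ->
  intg a b (fun t => c * f t) = c * intg a b f.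
Proof. by move=> cf; apply: RintegralZl => //; exact: ct_integrable. Qed.

Lemma intgN a b f : continuous f -> intg a b (fun t => - f t) = - intg a b f.
Proof.
move=> cf; rewrite -mulN1r -intgZ//; apply: eq_intg => t _; by rewrite mulN1r.
Qed.

Lemma intgB a b f g : continuous f -> continuous g ->
  intg a b (fun t => f t - g t) = intg a b f - intg a b g.
Proof. by move=> cf cg; rewrite intgD ?intgN//; exact: ctN. Qed.

Lemma intg_cst a b c : a <= b -> intg a b (fun=> c) = c * (b - a).
Proof.
move=> ab; rewrite /intg Rintegral_cst//= lebesgue_measure_itv/= lte_fin.
by move: ab; rewrite le_eqVlt => /predU1P[->|->//]; rewrite ltxx subrr.
Qed.

Lemma intg_sum a b (I : Type) (s : seq I) (P : pred I) (F : I -> R -> R) :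
  (forall i, continuous (F i)) ->
  intg a b (fun t => \sum_(i <- s | P i) F i t) = \sum_(i <- s | P i) intg a b (F i).
Proof.
move=> cF; elim: s => [|i s IH].
  rewrite big_nil; under eq_intg do rewrite big_nil.
  by rewrite /intg Rintegral_cst// mul0r.
rewrite big_cons; case Pi: (P i); last first.
  by under eq_intg do rewrite big_cons Pi.
under eq_intg do rewrite big_cons Pi.
by rewrite intgD ?IH//; apply: ct_sum.
Qed.

Lemma le_intg a b f g : continuous f -> continuous g ->
  (forall t, a <= t <= b -> f t <= g t) -> intg a b f <= intg a b g.
Proof.
move=> cf cg fg; apply: le_Rintegral; [by []|exact: ct_integrable..|].
by move=> t; rewrite /= in_itv /= => /fg.
Qed.

Lemma intg_le_cst a b f c : a <= b -> continuous f ->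
  (forall t, a <= t <= b -> f t <= c) -> intg a b f <= c * (b - a).
Proof.
by move=> ab cf fc; rewrite -intg_cst//; apply: le_intg => //; exact: ct_cst.
Qed.

Lemma intg_ge_cst a b f c : a <= b -> continuous f ->
  (forall t, a <= t <= b -> c <= f t) -> c * (b - a) <= intg a b f.
Proof.
by move=> ab cf fc; rewrite -intg_cst//; apply: le_intg => //; exact: ct_cst.
Qed.

Lemma ler_norm_intg a b f : continuous f ->
  `|intg a b f| <= intg a b (fun t => `|f t|).
Proof. by move=> cf; apply: le_normr_Rintegral => //; exact: ct_integrable. Qed.

Lemma norm_intg_le_cst a b f c : a <= b -> continuous f ->
  (forall t, a <= t <= b -> `|f t| <= c) -> `|intg a b f| <= c * (b - a).
Proof.
move=> ab cf fc; apply: le_trans (ler_norm_intg _ _ cf) _.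
by apply: intg_le_cst => //; exact: ct_norm.
Qed.

Lemma intg_split a b c f : a <= b -> b <= c -> continuous f ->
  intg a c f = intg a b f + intg b c f.
Proof.
move=> ab bc cf; have := @Rintegral_itvB R f (BLeft a) (BRight c) b.
move=> /(_ (ct_integrable _ _ cf)); rewrite !bnd_simp => /(_ ab bc).
rewrite Rintegral_itv_obnd_cbnd; last first.
  apply: (@integrableS _ _ _ mu `[b, c]) => //; last exact: ct_integrable.
  exact: subset_itv_oc_cc.
by rewrite /intg => <-; rewrite addrC subrK.
Qed.

Lemma intg_FTC a b f F : a <= b -> continuous f ->
  (forall x : R, is_derive x (1 : R) (F : R -> R) (f x)) -> intg a b f = F b - F a.
Proof.
rewrite le_eqVlt => /predU1P[->|ab] cf dF.
  by rewrite /intg set_itv1 Rintegral_set1 subrr.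
have cF : continuous F.
  move=> x; apply: differentiable_continuous; apply/derivable1_diffP.
  exact: (@ex_derive _ _ _ _ _ _ _ (dF x)).
rewrite /intg /Rintegral (@continuous_FTC2 R f F a b)//.
- exact: continuous_subspaceT.
- split.
  + by move=> x _; exact: (@ex_derive _ _ _ _ _ _ _ (dF x)).
  + by apply: cvg_at_right_filter; exact: cF.
  + by apply: cvg_at_left_filter; exact: cF.
- by move=> x _; rewrite derive1E; exact: (@derive_val _ _ _ _ _ _ _ (dF x)).
Qed.

Lemma intg_opp a b f : a <= b -> continuous f ->
  intg a b (fun t => f (- t)) = intg (- b) (- a) f.
Proof.
move=> ab cf; rewrite /intg /Rintegral integration_by_substitution_oppr//.
exact: continuous_subspaceT.
Qed.

Lemma intg_shift a b c f : a <= b -> continuous f ->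
  intg a b (fun t => f (t + c)) = intg (a + c) (b + c) f.
Proof.
move=> ab cf; rewrite /intg /Rintegral.
have dF : derive1 (fun t : R => t + c) = cst 1.
  by apply/funext => z; rewrite derive1E derive_val addr0.
rewrite (@integration_by_substitution_increasing R (fun t => t + c) f a b)//.
- by congr fine; apply: eq_integral => x _; rewrite dF !fctE mulr1.
- by move=> x y _ _; rewrite ltrD2r.
- by rewrite dF => x _; exact: cvg_cst.
- by rewrite dF; apply: is_cvg_cst.
- by rewrite dF; apply: is_cvg_cst.
- split => //=.
  + by apply: cvg_at_right_filter; apply: (ctD (@ct_id R) (@ct_cst R c)).
  + by apply: cvg_at_left_filter; apply: (ctD (@ct_id R) (@ct_cst R c)).
- exact: continuous_subspaceT.
Qed.

(** The two end pieces cut off by a translation are themselves translates of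
each other by a full period. *)
Lemma intg_period_shift c f : continuous f -> periodic f (2 * pi) ->
  intg (- pi) pi (fun t => f (t + c)) = intg (- pi) pi f.
Proof.
have pp : - pi <= pi :> R by have := pi_gt0 R; lra.
have H d g : 0 <= d -> continuous g -> periodic g (2 * pi) ->
    intg (- pi) pi (fun t => g (t + d)) = intg (- pi) pi g.
  move=> d0 cg pg; rewrite intg_shift//.
  have pi0 := pi_gt0 R.
  have a1 : - pi <= - pi + d by rewrite lerDl.
  have a2 : - pi + d <= pi + d by rewrite lerD2r.
  have a3 : pi <= pi + d by rewrite lerDl.
  have := intg_split a1 a2 cg; rewrite (intg_split pp a3 cg).
  have -> : intg pi (pi + d) g = intg (- pi) (- pi + d) g.
    have -> : intg (- pi) (- pi + d) g =
        intg (- pi) (- pi + d) (fun t => g (t + 2 * pi)).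
      by apply: eq_intg => t _; rewrite pg.
    rewrite intg_shift//.
    have [-> ->] // : - pi + 2 * pi = pi :> R /\ - pi + d + 2 * pi = pi + d.
    by split; ring.
  by rewrite addrC => /addrI ->.
move=> cf pf; case: (leP 0 c) => c0; first exact: H.
rewrite -(H (- c) (fun t => f (t + c))); last 3 first.
- lra.
- by cts.
- by move=> t; rewrite addrAC pf.
by apply: eq_intg => t _; rewrite subrK.
Qed.

Lemma intg_sym f : continuous f ->
  intg (- pi) pi f = intg 0 pi (fun t => f t + f (- t)).
Proof.
move=> cf; have pi0 := pi_gt0 R.
rewrite (@intg_split (- pi) 0 pi)//; [|lra|lra].
rewrite intgD//; last by cts.
by rewrite intg_opp ?oppr0 1?addrC//; lra.
Qed.

End ContinuousIntegrals.

(** * Elementary trigonometric inequalities *)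

Section TrigInequalities.
Variable R : realType.
Implicit Types (f g : R -> R) (s t u x : R).

Lemma is_derive_continuous f (df : R -> R) :
  (forall x, is_derive x (1 : R) f (df x)) -> continuous f.
Proof.
move=> dF x; apply: differentiable_continuous; apply/derivable1_diffP.
exact: (@ex_derive _ _ _ _ _ _ _ (dF x)).
Qed.

(** The inequalities below come from one another by integration from 0: each
asserts the sign of a function whose derivative has the sign given before it. *)
Lemma le_of_deriv_ge0 f (df : R -> R) x : 0 <= x ->
  (forall y, is_derive y (1 : R) f (df y)) ->
  (forall y, 0 <= y <= x -> 0 <= df y) -> f 0 <= f x.
Proof.
move=> x0 dF df0.
have [|c] := MVT_segment x0 (fun y _ => dF y).
  by apply: continuous_subspaceT; exact: is_derive_continuous dF.
rewrite in_itv/= => cx h; rewrite -subr_ge0 h subr0 mulr_ge0//; exact: df0.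
Qed.

Lemma sin_le u : 0 <= u -> sin u <= u.
Proof.
move=> u0.
have := @le_of_deriv_ge0 (fun y => y - sin y) (fun y => 1 - cos y) u u0.
rewrite sin0 subr0 subr_ge0; apply=> y _.
by rewrite subr_ge0 cos_le1.
Qed.

Lemma cos_ge_quadratic u : 0 <= u -> 1 - u ^+ 2 / 2 <= cos u.
Proof.
move=> u0.
have := @le_of_deriv_ge0 (fun y => cos y + y * y / 2) (fun y => y - sin y) u u0.
rewrite cos0 => H; suff : 1 + 0 * 0 / 2 <= cos u + u * u / 2 by rewrite expr2; lra.
apply: H.
- by move=> y; apply: is_derive_eq; rewrite /GRing.scale /=; field.
- by move=> y /andP[y0 _]; rewrite subr_ge0 sin_le.
Qed.

Lemma sin_ge_cubic u : 0 <= u -> u - u ^+ 3 / 6 <= sin u.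
Proof.
move=> u0.
have := @le_of_deriv_ge0 (fun y => sin y - y + y * (y * y) / 6)
  (fun y => cos y - 1 + y ^+ 2 / 2) u u0.
rewrite sin0 => H.
suff : 0 - 0 + 0 * (0 * 0) / 6 <= sin u - u + u * (u * u) / 6.
  by rewrite !exprS expr0 mulr1; lra.
apply: H.
- by move=> y; apply: is_derive_eq; rewrite /GRing.scale /=; field.
- by move=> y /andP[y0 _]; have := cos_ge_quadratic y0; lra.
Qed.

Lemma sin_ge_third u : 0 <= u <= 2 -> u / 3 <= sin u.
Proof.
move=> /andP[u0 u2]; have := sin_ge_cubic u0.
have : 0 <= u * ((2 - u) * (2 + u)) by rewrite !mulr_ge0//; lra.
by rewrite !exprS expr0; nra.
Qed.

Lemma sin_ge_half u : 0 <= u <= 1 -> u / 2 <= sin u.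
Proof.
move=> /andP[u0 u2]; have := sin_ge_cubic u0.
have : 0 <= u * ((1 - u) * (1 + u)) by rewrite !mulr_ge0//; lra.
by rewrite !exprS expr0; nra.
Qed.

Lemma onem_cos t : 1 - cos t = 2 * sin (t / 2) ^+ 2.
Proof.
have {1}-> : t = (t / 2) *+ 2 by rewrite mulr2n; field.
by rewrite cos_mulr2n cos2sin2 mulr2n; ring.
Qed.

(** Since 1 - cos t is the denominator of the kernels in closed form, this is
the reason for their decay like 1 / t^2. *)
Lemma onem_cos_ge t : 0 <= t <= pi -> t ^+ 2 / 18 <= 1 - cos t.
Proof.
move=> /andP[t0 tpi]; rewrite onem_cos.
have t2 : 0 <= t / 2 <= 2 by have := pihalf_lt2 R; lra.
have := sin_ge_third t2; set s := sin _ => hs.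
by rewrite !expr2; nra.
Qed.

Lemma onem_cos_gt0 t : 0 < t <= pi -> 0 < 1 - cos t.
Proof.
move=> /andP[t0 tpi]; apply: lt_le_trans (onem_cos_ge _).
  by rewrite divr_gt0// exprn_gt0.
by rewrite (ltW t0).
Qed.

Lemma mul_cos_le_sin s : 0 <= s <= pi -> s * cos s <= sin s.
Proof.
move=> /andP[s0 spi].
have := @le_of_deriv_ge0 (fun y => sin y - y * cos y) (fun y => y * sin y) s s0.
rewrite sin0 mul0r subrr subr_ge0; apply.
- by move=> y; apply: is_derive_eq; rewrite /GRing.scale /=; field.
- move=> y /andP[y0 ys]; rewrite mulr_ge0//; apply: sin_ge0_pi.
  by rewrite y0 (le_trans ys).
Qed.

Lemma sin_half t : sin t = 2 * sin (t / 2) * cos (t / 2).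
Proof.
have {1}-> : t = (t / 2) *+ 2 by rewrite mulr2n; field.
by rewrite sin_mulr2n mulr2n; ring.
Qed.

(** With [mul_sin_ge]: sin t / (2 (1 - cos t)) differs from 1 / t by a bounded
quantity near 0. *)
Lemma mul_sin_le t : 0 <= t <= pi -> t * sin t <= 2 * (1 - cos t).
Proof.
move=> /andP[t0 tpi]; rewrite onem_cos sin_half.
have h : 0 <= t / 2 <= pi by lra.
have := mul_cos_le_sin h; have := sin_ge0_pi h.
set s := sin _; set c := cos _ => s0 hsc.
by rewrite expr2; nra.
Qed.

Lemma mul_sin_ge t : 0 <= t <= pi -> 2 * (1 - cos t) - t * sin t <= t ^+ 4 / 8.
Proof.
move=> /andP[t0 tpi]; rewrite onem_cos (sin_half t).
have h : 0 <= t / 2 <= pi by lra.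
have h0 : 0 <= t / 2 by lra.
have := sin_le h0; have := cos_ge_quadratic h0; have := sin_ge0_pi h.
have -> : t ^+ 4 / 8 = 2 * (t / 2) ^+ 4 by field.
have et : t * (2 * sin (t / 2) * cos (t / 2)) =
  2 * (t / 2) * (2 * sin (t / 2) * cos (t / 2)) by field.
rewrite et; move: (t / 2) h0 => u u0 {et h}.
set s := sin _; set c := cos _ => s0 hc hs.
have e : 2 * (2 * s ^+ 2) - 2 * u * (2 * s * c) = 4 * s * (s - u * c) by ring.
rewrite e.
have h1 : s - u * c <= u ^+ 3 / 2.
  have : u * (1 - u ^+ 2 / 2) <= u * c by rewrite ler_wpM2l.
  by rewrite !exprS expr0; lra.
have u3 : 0 <= u ^+ 3 / 2 by rewrite divr_ge0// exprn_ge0.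
apply: (@le_trans _ _ (4 * s * (u ^+ 3 / 2))).
  by rewrite ler_wpM2l// mulr_ge0.
have -> : 2 * u ^+ 4 = 4 * u * (u ^+ 3 / 2) by field.
by rewrite ler_wpM2r// ler_wpM2l.
Qed.

Lemma sin_lipschitz x y : `|sin x - sin y| <= `|x - y|.
Proof.
wlog xy : x y / x <= y.
  by move=> H; case: (leP x y) => [/H//|/ltW/H]; rewrite distrC (distrC y).
have [|c _] := MVT_segment xy (fun z _ => (@is_derive_sin R) z).
  by apply: continuous_subspaceT; exact: is_derive_continuous (@is_derive_sin R).
rewrite (distrC (sin x)) (distrC x) => ->; rewrite normrM ler_piMl//.
exact: cos_max.
Qed.

End TrigInequalities.

(** * The Fejer kernel and its conjugate *)

Section FejerKernels.
Variable R : realType.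
Implicit Types (t u x : R) (m n k : nat).

(** The factor by which the m-th Fejer mean damps the k-th harmonic. *)
Definition fejer_weight m k : R := 1 - k%:R / m.+1%:R.

Definition fejer m t : R :=
  1 / 2 + \sum_(1 <= k < m.+1) fejer_weight m k * cos (k%:R * t).

Definition conj_fejer m t : R :=
  \sum_(1 <= k < m.+1) fejer_weight m k * sin (k%:R * t).

Lemma fejer_weight_itv m k : (k <= m)%N -> 0 <= fejer_weight m k <= 1.
Proof.
move=> km; rewrite /fejer_weight subr_ge0 ler_pdivrMr// mul1r ler_nat leqW//=
  gerBl divr_ge0.
Qed.

Lemma fejer_weightE m k : m.+1%:R * fejer_weight m k = m.+1%:R - k%:R.
Proof. by rewrite /fejer_weight mulrBr mulr1 mulrCA mulfV ?mulr1// pnatr_eq0. Qed.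

Lemma fejer_ct m : continuous (fejer m).
Proof. by rewrite /fejer; cts. Qed.

Lemma conj_fejer_ct m : continuous (conj_fejer m).
Proof. by rewrite /conj_fejer; cts. Qed.

Lemma fejerN m t : fejer m (- t) = fejer m t.
Proof. by congr (_ + _); apply: eq_bigr => k _; rewrite mulrN cosN. Qed.

Lemma conj_fejerN m t : conj_fejer m (- t) = - conj_fejer m t.
Proof.
by rewrite /conj_fejer -sumrN; apply: eq_bigr => k _; rewrite mulrN sinN mulrN.
Qed.

(** Multiplication by 2 (1 - cos t) is the opposite of a second difference in
the frequency, so it makes trigonometric sums telescope, and the sums of these
telescope again: hence the closed forms [fejerE] and [conj_fejerE]. *)
Lemma onem_cos_mul_cos (a : R) t :
  2 * (1 - cos t) * cos (a * t) =
  2 * cos (a * t) - cos ((a - 1) * t) - cos ((a + 1) * t).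
Proof.
have [-> ->] : (a - 1) * t = a * t - t /\ (a + 1) * t = a * t + t by split; ring.
by rewrite cosB cosD; ring.
Qed.

Lemma onem_cos_mul_sin (a : R) t :
  2 * (1 - cos t) * sin (a * t) =
  2 * sin (a * t) - sin ((a - 1) * t) - sin ((a + 1) * t).
Proof.
have [-> ->] : (a - 1) * t = a * t - t /\ (a + 1) * t = a * t + t by split; ring.
by rewrite sinB sinD; ring.
Qed.

Lemma dirichletE m t :
  2 * (1 - cos t) * (1 / 2 + \sum_(1 <= k < m.+1) cos (k%:R * t)) =
  cos (m%:R * t) - cos (m.+1%:R * t).
Proof.
elim: m => [|m IH].
  by rewrite big_geq// mul0r cos0 !mul1r addr0; field.
rewrite big_nat_recr//= addrA mulrDr IH onem_cos_mul_cos natr1.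
by rewrite -(natr1 m) addrK; ring.
Qed.

Lemma conj_dirichletE m t :
  2 * (1 - cos t) * \sum_(1 <= k < m.+1) sin (k%:R * t) =
  sin t + sin (m%:R * t) - sin (m.+1%:R * t).
Proof.
elim: m => [|m IH].
  by rewrite big_geq// mul0r sin0 mul1r mulr0; ring.
rewrite big_nat_recr//= mulrDr IH onem_cos_mul_sin natr1.
by rewrite -(natr1 m) addrK; ring.
Qed.

(** The weighted sums of order m + 1 exceed those of order m by a plain partial
sum: a Fejer kernel is a mean of Dirichlet kernels. *)
Lemma sum_weights_rec (F : nat -> R) m :
  \sum_(1 <= k < m.+2) (m.+2%:R - k%:R) * F k =
  \sum_(1 <= k < m.+1) (m.+1%:R - k%:R) * F k + \sum_(1 <= k < m.+2) F k.
Proof.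
rewrite (big_nat_recr m.+1)//= [in RHS](big_nat_recr m.+1)//= addrA -big_split /=.
congr (_ + _); last by rewrite -natrB// subSn// subnn mul1r.
by apply: eq_bigr => k _; rewrite -(natr1 m.+1); ring.
Qed.

Lemma mul_fejer m t : m.+1%:R * fejer m t =
  m.+1%:R / 2 + \sum_(1 <= k < m.+1) (m.+1%:R - k%:R) * cos (k%:R * t).
Proof.
rewrite /fejer mulrDr mulrA mulr1; congr (_ + _).
by rewrite mulr_sumr; apply: eq_bigr => k _; rewrite mulrA fejer_weightE.
Qed.

Lemma mul_conj_fejer m t : m.+1%:R * conj_fejer m t =
  \sum_(1 <= k < m.+1) (m.+1%:R - k%:R) * sin (k%:R * t).
Proof. by rewrite mulr_sumr; apply: eq_bigr => k _; rewrite mulrA fejer_weightE. Qed.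

Lemma fejerE m t :
  2 * (1 - cos t) * (m.+1%:R * fejer m t) = 1 - cos (m.+1%:R * t).
Proof.
rewrite mul_fejer; elim: m => [|m IH].
  by rewrite big_geq// !mul1r addr0; field.
rewrite sum_weights_rec.
have -> : m.+2%:R / 2 + (\sum_(1 <= k < m.+1) (m.+1%:R - k%:R) * cos (k%:R * t) +
    \sum_(1 <= k < m.+2) cos (k%:R * t)) =
  (m.+1%:R / 2 + \sum_(1 <= k < m.+1) (m.+1%:R - k%:R) * cos (k%:R * t)) +
  (1 / 2 + \sum_(1 <= k < m.+2) cos (k%:R * t)).
  by rewrite -(natr1 m.+1); ring.
by rewrite mulrDr IH dirichletE; ring.
Qed.

Lemma conj_fejerE m t :
  2 * (1 - cos t) * (m.+1%:R * conj_fejer m t) =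
  m.+1%:R * sin t - sin (m.+1%:R * t).
Proof.
rewrite mul_conj_fejer; elim: m => [|m IH].
  by rewrite big_geq// !mul1r mulr0 subrr.
rewrite sum_weights_rec mulrDr IH conj_dirichletE -(natr1 m.+1); ring.
Qed.

Lemma fejer_ge0 m t : - pi <= t <= pi -> 0 <= fejer m t.
Proof.
wlog t0 : t / 0 <= t => [H|/andP[_ tpi]].
  case: (leP 0 t) => [/H//|/ltW t0 /andP[h1 h2]].
  by rewrite -fejerN; apply: H; [rewrite oppr_ge0|rewrite lerN2 h2 lerNl].
case: (eqVneq t 0) => [->|tn0].
  rewrite /fejer addr_ge0// big_nat sumr_ge0// => k /andP[_ km].
  by rewrite mulr0 cos0 mulr1; case/andP: (@fejer_weight_itv m k km).
have c0 : 0 < 1 - cos t by apply: onem_cos_gt0; rewrite lt_neqAle eq_sym tn0 t0.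
have p : 0 < 2 * (1 - cos t) * m.+1%:R by rewrite !mulr_gt0.
have : 0 <= 2 * (1 - cos t) * m.+1%:R * fejer m t.
  by rewrite -[leRHS]mulrA fejerE subr_ge0 cos_le1.
by rewrite (pmulr_rge0 _ p).
Qed.

Lemma sum_weights_le m (F : nat -> R) : (forall k, `|F k| <= 1) ->
  `|\sum_(1 <= k < m.+1) fejer_weight m k * F k| <= m%:R.
Proof.
move=> F1; apply: le_trans (ler_norm_sum _ _ _) _.
have -> : m%:R = \sum_(1 <= k < m.+1) (1 : R) by rewrite sumr_const_nat subn1.
apply: ler_sum_nat => k /andP[_ km]; have /andP[w0 w1] := @fejer_weight_itv m k km.
by rewrite normrM ger0_norm// mulr_ile1.
Qed.

Lemma fejer_le m t : `|fejer m t| <= m.+1%:R.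
Proof.
apply: le_trans (ler_normD _ _) _; rewrite ger0_norm//.
have := @sum_weights_le m (fun k => cos (k%:R * t)) (fun k => cos_max _).
by rewrite -(natr1 m); lra.
Qed.

Lemma conj_fejer_le m t : `|conj_fejer m t| <= m.+1%:R.
Proof.
have := @sum_weights_le m (fun k => sin (k%:R * t)) (fun k => sin_max _).
by rewrite -(natr1 m) /conj_fejer; lra.
Qed.

Lemma fejer_decay m t : 0 < t <= pi -> `|fejer m t| <= 18 / (m.+1%:R * t ^+ 2).
Proof.
move=> /andP[t0 tpi].
have c0 : 0 < 1 - cos t by apply: onem_cos_gt0; rewrite t0.
have tp : 0 <= t <= pi by rewrite (ltW t0).
have hc := onem_cos_ge tp.
rewrite ger0_norm; last by apply: fejer_ge0; rewrite tpi andbT; have := pi_gt0 R; lra.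
have m0 : 0 < m.+1%:R :> R by [].
have t2 : 0 < t ^+ 2 by rewrite exprn_gt0.
rewrite ler_pdivlMr ?mulr_gt0//.
rewrite [leLHS](_ : _ = (m.+1%:R * fejer m t) * t ^+ 2); last by ring.
have f0 : 0 <= m.+1%:R * fejer m t.
  by rewrite mulr_ge0// fejer_ge0// tpi andbT; have := pi_gt0 R; lra.
have := fejerE m t; have := cos_geN1 (m.+1%:R * t).
set y := _ * fejer m t in f0 *; set z := cos (_ * t); set c := 1 - cos t in c0 hc *.
by nra.
Qed.

(** Half the cotangent of t / 2: the limit of the conjugate Fejer kernels. *)
Definition hcot t : R := sin t / (2 * (1 - cos t)).

(** In contrast with the Fejer kernels, the conjugate ones do not decay away from
0 but converge; the behaviour 1 / t of their limit is the source of the leading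
term, and this remainder, of the same size as a Fejer kernel, is not. *)
Lemma conj_fejer_hcot m t : 0 < t <= pi ->
  `|conj_fejer m t - hcot t| <= 9 / (m.+1%:R * t ^+ 2).
Proof.
move=> /andP[t0 tpi].
have c0 : 0 < 1 - cos t by apply: onem_cos_gt0; rewrite t0.
have tp : 0 <= t <= pi by rewrite (ltW t0).
have hc := onem_cos_ge tp.
have m0 : 0 < m.+1%:R :> R by [].
have t2 : 0 < t ^+ 2 by rewrite exprn_gt0.
have -> : conj_fejer m t - hcot t =
    - (sin (m.+1%:R * t) / (2 * (1 - cos t) * m.+1%:R)).
  apply: (@mulfI _ (2 * (1 - cos t) * m.+1%:R)).
    by rewrite !mulf_neq0// gt_eqF.
  rewrite mulrBr -[X in X - _]mulrA conj_fejerE /hcot; field.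
  by rewrite nat1r pnatr_eq0 (gt_eqF c0).
rewrite normrN normrM normfV (gtr0_norm (_ : 0 < 2 * (1 - cos t) * m.+1%:R)); last first.
  by rewrite !mulr_gt0.
rewrite ler_pdivrMr ?mulr_gt0// mulrAC ler_pdivlMr ?mulr_gt0//.
apply: (@le_trans _ _ (1 * (m.+1%:R * t ^+ 2))).
  by rewrite ler_wpM2r ?sin_max// mulr_ge0// ltW.
rewrite mul1r; have : m.+1%:R * (t ^+ 2 / 18) <= m.+1%:R * (1 - cos t).
  by rewrite ler_wpM2l.
lra.
Qed.

Lemma hcot_le t : 0 < t <= pi -> 0 <= hcot t <= t^-1.
Proof.
move=> /andP[t0 tpi].
have c0 : 0 < 1 - cos t by apply: onem_cos_gt0; rewrite t0.
have tp : 0 <= t <= pi by rewrite (ltW t0).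
have d0 : 0 < 2 * (1 - cos t) by rewrite mulr_gt0.
rewrite /hcot divr_ge0 ?(ltW d0) ?sin_ge0_pi//=.
rewrite ler_pdivrMr// [leRHS]mulrC ler_pdivlMr// [leLHS]mulrC.
exact: mul_sin_le.
Qed.

Lemma hcot_ge t : 0 < t <= 1 -> t^-1 - 2 <= hcot t.
Proof.
move=> /andP[t0 t1].
have t1pi : t <= pi by have := pi_ge2 R; lra.
have c0 : 0 < 1 - cos t by apply: onem_cos_gt0; rewrite t0.
have tp : 0 <= t <= pi by rewrite (ltW t0).
rewrite /hcot ler_pdivlMr ?mulr_gt0//.
have -> : (t^-1 - 2) * (2 * (1 - cos t)) =
   t^-1 * (2 * (1 - cos t) - 4 * t * (1 - cos t)) by field; rewrite gt_eqF.
rewrite mulrC ler_pdivrMr//.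
have := mul_sin_ge tp; have := onem_cos_ge tp.
have e3 : t ^+ 4 = t * t * t ^+ 2 by ring.
have t2 : 0 < t ^+ 2 by rewrite exprn_gt0.
have h4 : t ^+ 4 <= t * t ^+ 2.
  by rewrite e3 ler_wpM2r ?(ltW t2)// ler_piMl// ltW.
move=> h1 h2.
have h5 : 4 * t * (t ^+ 2 / 18) <= 4 * t * (1 - cos t).
  by rewrite ler_wpM2l// mulr_ge0// ltW.
have h6 : 4 * t * (t ^+ 2 / 18) = 2 / 9 * (t * t ^+ 2) by field.
have h7 := mulr_ge0 (ltW t0) (ltW t2).
by rewrite [leRHS]mulrC; lra.
Qed.

Lemma intg_cos_mul k : (0 < k)%N ->
  intg (- pi) pi (fun t => cos (k%:R * t)) = 0 :> R.
Proof.
move=> k0; have pi0 := pi_gt0 R.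
have kn0 : k%:R != 0 :> R by rewrite pnatr_eq0 -lt0n.
have dF (x : R) : is_derive x (1 : R) (fun t => sin (k%:R * t) / k%:R)
    (cos (k%:R * x)).
  by apply: is_derive_eq; rewrite /GRing.scale /=; field.
rewrite (intg_FTC _ _ dF).
- have sk j : sin (j%:R * pi) = 0 :> R.
    elim: j => [|j IH]; first by rewrite mul0r sin0.
    by rewrite -natr1 mulrDl mul1r sinDpi IH oppr0.
  by rewrite mulrN sinN sk oppr0 mul0r subrr.
- lra.
- by cts.
Qed.

Lemma intg_fejer m : intg (- pi) pi (fejer m) = pi.
Proof.
rewrite /fejer intgD; [|by cts..].
rewrite intg_cst; last by have := pi_gt0 R; lra.
rewrite intg_sum; last by move=> k; cts.
rewrite big_nat big1 ?addr0; first by field.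
move=> k /andP[k0 _]; rewrite intgZ; last by cts.
by rewrite intg_cos_mul// mulr0.
Qed.

End FejerKernels.

#[export] Hint Resolve fejer_ct conj_fejer_ct : core.

(** * Fejer means of periodic functions *)

Section FejerMeans.
Variable R : realType.
Local Notation mu := (@lebesgue_measure R).
Implicit Types (f phi : R -> R) (g t x : R) (m n k : nat).

Lemma periodic_int f (p : R) : periodic f p -> forall (z : int) x, f (x + z%:~R * p) = f x.
Proof.
move=> pf [n|n] x; first by rewrite -pmulrn mulr_natl periodicn.
by rewrite NegzE mulrNz mulNr -pmulrn mulr_natl -[LHS](periodicn pf n.+1) subrK.
Qed.

Lemma cos_period_nat k x : cos (x + k%:R * (2 * pi)) = cos x.
Proof. by rewrite mulr_natl mulr_natl (periodicn (@cosD2pi R)). Qed.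

Lemma periodic_reduce f : periodic f (2 * pi) -> forall x, exists z : int,
  0 <= x + z%:~R * (2 * pi) <= 2 * pi.
Proof.
move=> pf x; have p0 : 0 < 2 * pi :> R by have := pi_gt0 R; lra.
exists (- Num.floor (x / (2 * pi))).
have /andP[h1 h2] := Num.Theory.floor_itv (x / (2 * pi)).
rewrite mulrNz mulNr subr_ge0 lerBlDr.
move: h1; rewrite ler_pdivlMr// => ->/=.
move: h2; rewrite ltr_pdivrMr// intrD mulrDl mul1r => /ltW; lra.
Qed.

Lemma periodic_bounded f : continuous f -> periodic f (2 * pi) ->
  exists M, forall x, `|f x| <= M.
Proof.
move=> cf pf; have p0 : 0 <= 2 * pi :> R by have := pi_gt0 R; lra.
have [|c cab cmax] := @EVT_max R (fun x => `|f x|) 0 (2 * pi) p0.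
  by apply: continuous_subspaceT; exact: ct_norm.
exists (`|f c|) => x; have [z hz] := periodic_reduce pf x.
by rewrite -(periodic_int pf z); apply: cmax; rewrite in_itv.
Qed.

Lemma periodic_uniform_continuity f : continuous f -> periodic f (2 * pi) ->
  forall e, 0 < e -> exists2 d, 0 < d &
    forall x t, `|t| <= d -> `|f (x + t) - f x| <= e.
Proof.
move=> cf pf e e0.
have := @segment_compact R 0 (2 * pi).
move=> /compact_near_coveringP/(_ _ (0 : R)^'+
  (fun d x => forall t, `|t| <= d -> `|f (x + t) - f x| <= e)) H.
have Hd : \forall d \near (0 : R)^'+, `[0, 2 * pi] `<=`
    (fun x => forall t, `|t| <= d -> `|f (x + t) - f x| <= e).
  apply: H => x _.
  have e2 : 0 < e / 2 by rewrite divr_gt0.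
  have /cvgrPdist_le/(_ _ e2) := cf x.
  move=> /nbhs_ballP[r /= r0 hr].
  have r2 : 0 < r / 2 by rewrite divr_gt0.
  exists (ball x (r / 2), [set d | d < r / 2]) => /=.
    split; first exact: nbhsx_ballx.
    exact: nbhs_right_lt.
  move=> [y d] /= [xy dr] t td.
  have h1 : `|f x - f (y + t)| <= e / 2.
    apply: hr; rewrite /ball /= opprD addrA.
    apply: le_lt_trans (ler_normB _ _) _; rewrite (splitr r).
    by apply: ltrD => //; exact: le_lt_trans td dr.
  have h2 : `|f x - f y| <= e / 2.
    by apply: hr; rewrite /ball /=; apply: lt_trans xy _; rewrite ltr_pdivrMr//; lra.
  have -> : f (y + t) - f y = (f x - f y) - (f x - f (y + t)) by ring.
  apply: le_trans (ler_normB _ _) _; lra.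
have [d [d0 {}Hd]] := filter_ex (filterI (nbhs_right_gt (0 : R)) Hd).
exists d => // x t td; have [z hz] := periodic_reduce pf x.
rewrite -(periodic_int pf z x) -(periodic_int pf z (x + t)) addrAC.
by apply: Hd td; rewrite /= in_itv.
Qed.

(** The k-th harmonic of the Fourier series of phi, with its phase retarded by g.
An (psi, beta)-derivative acts on harmonics by such a shift, with
g = beta pi / 2, and a multiplication. *)
Definition shifted_harmonic g phi k x : R :=
  fourier_cos phi k * cos (k%:R * x - g) + fourier_sin phi k * sin (k%:R * x - g).

Definition fejer_sum g phi m x : R :=
  \sum_(1 <= k < m.+1) fejer_weight R m k * shifted_harmonic g phi k x.

Definition fejer_mean phi m x : R := fourier_cos phi 0 / 2 + fejer_sum 0 phi m x.

Lemma harmonicE g phi k x : continuous phi -> periodic phi (2 * pi) ->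
  shifted_harmonic g phi k x =
  pi^-1 * intg (- pi) pi (fun t => phi (x + t) * cos (k%:R * t + g)).
Proof.
move=> cphi pphi; pose h t := phi t * cos (k%:R * (t - x) + g).
have ch : continuous h by rewrite /h; cts.
have ph : periodic h (2 * pi).
  move=> t; rewrite /h pphi; congr (_ * _).
  have -> : k%:R * (t + 2 * pi - x) + g = k%:R * (t - x) + g + k%:R * (2 * pi) by ring.
  by rewrite cos_period_nat.
have -> : intg (- pi) pi (fun t => phi (x + t) * cos (k%:R * t + g)) =
    intg (- pi) pi (fun t => h (t + x)).
  by apply: eq_intg => t _; rewrite /h addrK addrC.
rewrite intg_period_shift// /shifted_harmonic /fourier_cos /fourier_sin -/(intg _ _ _) -!mulrA.
rewrite -mulrDr; congr (_ * _).
rewrite ![intg _ _ _ * _]mulrC -!intgZ -?intgD; [|by cts..].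
apply: eq_intg => t _; rewrite /h.
have -> : k%:R * (t - x) + g = k%:R * t - (k%:R * x - g) by ring.
by move: (_ * x - g) => a; rewrite cosB; ring.
Qed.

(** The phase splits the kernel into cos g times a Fejer kernel and sin g times
a conjugate one. Only the latter contributes to the leading term, which explains
the factor |sin (beta pi / 2)|. *)
Lemma fejer_sumE g phi m x : continuous phi -> periodic phi (2 * pi) ->
  fejer_sum g phi m x = pi^-1 * intg (- pi) pi (fun t => phi (x + t) *
    (cos g * (fejer m t - 1 / 2) - sin g * conj_fejer m t)).
Proof.
move=> cphi pphi.
have cx : continuous (fun t => phi (x + t)) by cts.
rewrite /fejer_sum.
have E k : fejer_weight R m k * shifted_harmonic g phi k x =
    pi^-1 * intg (- pi) pi
      (fun t => fejer_weight R m k * (phi (x + t) * cos (k%:R * t + g))).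
  by rewrite harmonicE// mulrCA intgZ//; cts.
under eq_bigr do rewrite E.
rewrite -mulr_sumr -intg_sum; last by move=> k; cts.
congr (_ * _); apply: eq_intg => t _.
rewrite /fejer addrAC subrr add0r mulr_sumr mulr_sumr -sumrB mulr_sumr.
by apply: eq_bigr => k _; rewrite cosD; ring.
Qed.

Lemma fejer_meanE phi m x : continuous phi -> periodic phi (2 * pi) ->
  fejer_mean phi m x = pi^-1 * intg (- pi) pi (fun t => phi (x + t) * fejer m t).
Proof.
move=> cphi pphi.
have cx : continuous (fun t => phi (x + t)) by cts.
have cF := @fejer_ct R m.
rewrite /fejer_mean fejer_sumE//.
have -> : fourier_cos phi 0 = pi^-1 * intg (- pi) pi (fun t => phi (x + t)).
  rewrite /fourier_cos -/(intg _ _ _); congr (_ * _).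
  under [RHS]eq_intg do rewrite addrC.
  rewrite intg_period_shift//.
  by apply: eq_intg => t _; rewrite mul0r cos0 mulr1.
rewrite -mulrA -mulrDr; congr (_ * _).
rewrite mulrC -intgZ// -intgD; [|by cts..].
by apply: eq_intg => t _; rewrite cos0 sin0; field.
Qed.

(** Convolution with a probability density does not increase oscillation. *)
Lemma fejer_mean_contract phi m x y d : continuous phi -> periodic phi (2 * pi) ->
  (forall t, `|phi (x + t) - phi (y + t)| <= d) ->
  `|fejer_mean phi m x - fejer_mean phi m y| <= d.
Proof.
move=> cphi pphi hd; have pi0 := pi_gt0 R.
have cF := @fejer_ct R m.
have cx z : continuous (fun t => phi (z + t)) by cts.
rewrite !fejer_meanE// -mulrBr -intgB; [|by have := (cx x, cx y) => -[? ?]; cts..].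
rewrite normrM gtr0_norm ?invr_gt0// mulrC ler_pdivrMr//.
apply: le_trans (ler_norm_intg _ _ _) _.
  by have := (cx x, cx y) => -[? ?]; cts.
rewrite -[in leRHS](intg_fejer R m) -intgZ//.
apply: le_intg; [by have := (cx x, cx y) => -[? ?]; cts..|].
move=> t ht; rewrite -mulrBl normrM (ger0_norm (fejer_ge0 m ht)).
by rewrite ler_wpM2r// fejer_ge0.
Qed.

Lemma intg_fejer_half m : intg 0 pi (@fejer R m) = pi / 2.
Proof.
have := intg_fejer R m; rewrite (intg_sym (@fejer_ct R m)).
under eq_intg do rewrite fejerN.
rewrite intgD; [|exact: fejer_ct..].
by lra.
Qed.

(** The Fejer kernel has total mass pi and is even, hence a second difference of
phi. *)
Lemma fejer_mean_sub phi m x : continuous phi -> periodic phi (2 * pi) ->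
  fejer_mean phi m x - phi x =
  pi^-1 * intg 0 pi (fun t => (phi (x + t) + phi (x - t) - 2 * phi x) * fejer m t).
Proof.
move=> cphi pphi; have cF := @fejer_ct R m.
have cx : continuous (fun t => phi (x + t)) by cts.
have cx' : continuous (fun t => phi (x - t)) by cts.
rewrite fejer_meanE// intg_sym; last by cts.
have pn0 : (pi : R) != 0 by rewrite gt_eqF// pi_gt0.
have E : phi x = pi^-1 * intg 0 pi (fun t => 2 * phi x * fejer m t).
  by rewrite intgZ// intg_fejer_half; move: pi pn0 => p pn0; field.
rewrite [X in _ - X]E -mulrBr -intgB; [|by cts..].
by congr (_ * _); apply: eq_intg => t _; rewrite fejerN; ring.
Qed.

Lemma fejer_theorem f : continuous f -> periodic f (2 * pi) ->
  forall e, 0 < e -> exists N0 : nat, forall N, (N0 <= N)%N ->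
    forall x, `|fejer_mean f N x - f x| <= e.
Proof.
move=> cf pf e e0; have pi0 := pi_gt0 R.
have [M hM] := periodic_bounded cf pf.
have M0 : 0 <= M by apply: le_trans (hM 0).
have e2 : 0 < e / 2 by rewrite divr_gt0.
have [d0 d00 hd0] := periodic_uniform_continuity cf pf e2.
pose d := Num.min d0 1.
have d_gt0 : 0 < d by rewrite lt_min d00 ltr01.
have d1 : d <= 1 by rewrite ge_min lexx orbT.
have dpi : d <= pi by have := pi_ge2 R; lra.
have hd x t : `|t| <= d -> `|f (x + t) - f x| <= e / 2.
  by move=> td; apply: hd0; apply: le_trans td _; rewrite ge_min lexx.
pose C := 4 * M * (18 / d ^+ 2).
have C0 : 0 <= C by rewrite !mulr_ge0// invr_ge0 exprn_ge0// ltW.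
exists (Num.truncn (C / (e / 2))) => N hN x.
have hN' : C / N.+1%:R <= e / 2.
  rewrite ler_pdivrMr// mulrC -ler_pdivrMr//.
  apply: ltW; apply: lt_le_trans (truncnS_gt _) _.
  by rewrite ler_nat ltnS.
rewrite fejer_mean_sub// normrM gtr0_norm ?invr_gt0// mulrC ler_pdivrMr//.
have cF := @fejer_ct R N.
have cx : continuous (fun t => f (x + t)) by cts.
have cx' : continuous (fun t => f (x - t)) by cts.
rewrite (@intg_split _ 0 d pi); [|exact: ltW|exact: dpi|by cts].
apply: le_trans (ler_normD _ _) _.
have -> : e * pi = e * (pi / 2) + e / 2 * pi by field.
apply: lerD.
- apply: le_trans (ler_norm_intg _ _ _) _; first by cts.
  apply: (@le_trans _ _ (intg 0 d (fun t => e * fejer N t))).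
    apply: le_intg; [by cts..|] => t /andP[t0 td].
    have ft : 0 <= fejer N t by apply: fejer_ge0; apply/andP; split; lra.
    rewrite normrM (ger0_norm ft) ler_wpM2r//.
    have h1 : `|f (x + t) - f x| <= e / 2 by apply: hd; rewrite ger0_norm.
    have h2 : `|f (x - t) - f x| <= e / 2 by apply: hd; rewrite normrN ger0_norm.
    have -> : f (x + t) + f (x - t) - 2 * f x = (f (x + t) - f x) + (f (x - t) - f x) by ring.
    apply: le_trans (ler_normD _ _) _; lra.
  rewrite intgZ// ler_wpM2l ?(ltW e0)// -(intg_fejer_half N).
  rewrite (@intg_split _ 0 d pi (fejer N)); [|exact: ltW|exact: dpi|by []].
  rewrite lerDl; have -> : 0 = 0 * (pi - d) by rewrite mul0r.
  apply: intg_ge_cst => // t /andP[td tpi]; apply: fejer_ge0.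
  by apply/andP; split; lra.
- apply: (@le_trans _ _ (C / N.+1%:R * (pi - d))).
    apply: norm_intg_le_cst; [by []|by cts|] => t /andP[dt tpi].
    have t0 : 0 < t by apply: lt_le_trans dt.
    rewrite normrM.
    have -> : C / N.+1%:R = 4 * M * (18 / (N.+1%:R * d ^+ 2)).
      by rewrite /C; field; rewrite nat1r pnatr_eq0 gt_eqF.
    apply: ler_pM => //.
      apply: le_trans (ler_normB _ _) _; apply: le_trans (lerD (ler_normD _ _) (lexx _)) _.
      rewrite normrM (@ger0_norm _ 2)//.
      by have := hM (x + t); have := hM (x - t); have := hM x; lra.
    apply: le_trans (fejer_decay _ _) _; first by rewrite t0.
    rewrite ler_wpM2l// lef_pV2 ?posrE ?mulr_gt0 ?exprn_gt0//.
    by rewrite ler_wpM2l// lerXn2r// ?nnegrE ltW.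
  by rewrite ler_pM//; [rewrite divr_ge0|lra..].
Qed.

End FejerMeans.

(** * Convexity, moduli of continuity and slow variation *)

Section Convexity.
Variable R : realType.
Implicit Types (f : R -> R) (a x y z : R).

(** Three-point form of convexity on [a, +oo[. *)
Definition convex3 a f := forall x y z, a <= x -> x < y -> y < z ->
  (z - x) * f y <= (z - y) * f x + (y - x) * f z.

Lemma convex_function_convex3 a f :
  convex_function (`[a, +oo[ : set R) f -> convex3 a f.
Proof.
move=> cf x y z ax xy yz; have xz : x < z := lt_trans xy yz.
have p0 : 0 < z - x by rewrite subr_gt0.
have t0 : 0 <= (z - y) / (z - x) by rewrite divr_ge0 ?subr_ge0// ltW.
have t1 : (z - y) / (z - x) <= 1.
  by rewrite ler_pdivrMr// mul1r lerD2l lerN2 ltW.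
have := cf (Itv01 t0 t1) x z.
rewrite !inE /= !in_itv /= !andbT ax (le_trans ax (ltW xz)) => /(_ erefl erefl).
have e : 1 - (z - y) / (z - x) = (y - x) / (z - x).
  by field; rewrite subr_eq0 gt_eqF.
rewrite convRE /= /unstable.onem e.
rewrite [X in f X](_ : _ = (z - y) / (z - x) * x + (1 - (z - y) / (z - x)) * z)//.
have -> : (z - y) / (z - x) * x + (1 - (z - y) / (z - x)) * z = y.
  by rewrite e; field; rewrite subr_eq0 gt_eqF.
have -> : (z - y) / (z - x) * f x + (y - x) / (z - x) * f z =
    ((z - y) * f x + (y - x) * f z) / (z - x).
  by field; rewrite subr_eq0 gt_eqF.
by rewrite ler_pdivlMr// mulrC.
Qed.

(** The difference quotients to the right of x decrease with the increment and
are bounded below by any slope to the left of x. *)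
Lemma convex_right_derivative a f x : a < x -> convex3 a f ->
  ((f (x + h) - f x) / h @[h --> 0^'+] --> right_derivative f x) /\
  (forall y, x <= y -> right_derivative f x * (y - x) <= f y - f x).
Proof.
move=> ax cf; pose q h := (f (x + h) - f x) / h.
have qnd : {in `]0, +oo[ &, nondecreasing_fun q}.
  move=> h k; rewrite !in_itv/= !andbT => h0 k0.
  rewrite le_eqVlt => /predU1P[->//|hk]; rewrite /q ler_pdivrMr// mulrAC ler_pdivlMr//.
  have := cf x (x + h) (x + k) (ltW ax); rewrite ltrDl ltrD2l => /(_ h0 hk).
  have -> : x + k - x = k by ring.
  have -> : x + k - (x + h) = k - h by ring.
  have -> : x + h - x = h by ring.
  by lra.
have qlb : lbound (q @` `]0, +oo[) ((f x - f a) / (x - a)).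
  move=> _ [h /= + <-]; rewrite in_itv/= andbT => h0.
  have xa : 0 < x - a by rewrite subr_gt0.
  rewrite /q ler_pdivrMr// mulrAC ler_pdivlMr//.
  have := cf a x (x + h) (lexx _) ax; rewrite ltrDl => /(_ h0).
  have -> : x + h - x = h by ring.
  by lra.
have hl : has_lbound (q @` [set` `]0, +oo[]) by eexists; exact: qlb.
have := @nondecreasing_at_right_cvgr R q 0 +oo%O isT qnd hl.
set D := inf _ => qD.
have -> : right_derivative f x = D by apply/cvg_lim.
split=> // y; rewrite le_eqVlt => /predU1P[->|xy]; first by rewrite !subrr mulr0.
have yx : 0 < y - x by rewrite subr_gt0.
rewrite -ler_pdivlMr//.
have -> : (f y - f x) / (y - x) = q (y - x) by rewrite /q subrKC.
by apply: ge_inf => //; exists (y - x) => //=; rewrite in_itv/= yx.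
Qed.

Lemma concave_right_derivative_le a f x : a < x -> convex3 a (fun t => - f t) ->
  forall y, x <= y -> f y - f x <= right_derivative f x * (y - x).
Proof.
move=> ax cf y xy.
have [qN sN] := convex_right_derivative ax cf.
have E : right_derivative f x = - right_derivative (fun t => - f t) x.
  apply/cvg_lim => //.
  rewrite [X in X @ _](_ : _ = fun h => - ((- f (x + h) - - f x) / h)).
    exact: cvgN.
  by apply/funext => h; rewrite -mulNr opprD !opprK.
by rewrite E; have := sN y xy; lra.
Qed.

(** By convexity an increase between two points would persist up to infinity,
against the limit 0. *)
Lemma convex_cvg0_nonincreasing a f : convex3 a f ->
  (forall t, a <= t -> 0 < f t) -> f t @[t --> +oo] --> 0 ->
  forall x y, a <= x -> x <= y -> f y <= f x.
Proof.
move=> cf fpos f0 x y ax; rewrite le_eqVlt => /predU1P[->//|xy].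
rewrite leNgt; apply/negP => fxy.
have ay : a <= y by rewrite (le_trans ax)// ltW.
have [z [yz fz]] : exists z, y < z /\ f z < f y.
  have /cvgrPdist_lt/(_ _ (fpos y ay)) f0y := f0.
  have [z [yz]] := filter_ex (filterI (nbhs_pinfty_gt (num_real y)) f0y).
  rewrite sub0r normrN => fz; exists z; split => //.
  exact: le_lt_trans (ler_norm _) fz.
have := cf x y z ax xy yz.
have h1 : (z - y) * f x < (z - y) * f y by rewrite ltr_pM2l// subr_gt0.
have h2 : (y - x) * f z < (y - x) * f y by rewrite ltr_pM2l// subr_gt0.
lra.
Qed.

End Convexity.

Section ConcaveModulus.
Variables (R : realType) (om : R -> R).
Hypotheses (homega : modulus_of_continuity om) (hconv : convex_upwards om).
Implicit Types (s t u v x y : R) (n k : nat).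

Lemma om_concave3 : convex3 0 (fun t => - om t).
Proof. exact: convex_function_convex3. Qed.

Lemma om0 : om 0 = 0. Proof. by case: homega. Qed.

Lemma om_le s t : 0 <= s -> s <= t -> om s <= om t.
Proof.
move=> s0 st; case: homega => _ h _ _; apply: h => //; rewrite in_itv/= andbT//.
exact: le_trans st.
Qed.

Lemma om_ge0 t : 0 <= t -> 0 <= om t.
Proof. by move=> t0; rewrite -om0 om_le. Qed.

Lemma om_subadd s t : 0 <= s -> 0 <= t -> om (s + t) <= om s + om t.
Proof.
by move=> s0 t0; case: homega => _ _ _ h; apply: h => //; rewrite in_itv/= andbT.
Qed.

Lemma om_muln n t : 0 <= t -> om (n%:R * t) <= n%:R * om t.
Proof.
move=> t0; elim: n => [|n IH]; first by rewrite !mul0r om0.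
rewrite -natr1 !mulrDl !mul1r; apply: le_trans (om_subadd _ _) _ => //.
  by rewrite mulr_ge0.
by rewrite lerD2r.
Qed.

Lemma om_le_muln n x y : 0 <= x -> 0 <= y -> x <= n%:R * y -> om x <= n%:R * om y.
Proof. by move=> x0 y0 /(om_le x0) h; apply: le_trans h (om_muln _ _). Qed.

Lemma om_midpoint s t : 0 <= s -> 0 <= t -> om (2 * s) + om (2 * t) <= 2 * om (s + t).
Proof.
wlog st : s t / s <= t.
  move=> H s0 t0; case: (leP s t) => [st|/ltW ts]; first exact: H.
  by rewrite addrC (addrC s); apply: H.
move=> s0 t0; move: st; rewrite le_eqVlt => /predU1P[->|st].
  by rewrite -[2 * t]/(2%:R * t) mulr_natl mulr2n mulr_natl -mulr2n.
have h1 : 2 * s < s + t by lra.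
have h2 : s + t < 2 * t by lra.
have s20 : 0 <= 2 * s by lra.
have := om_concave3 s20 h1 h2.
have -> : 2 * t - 2 * s = 2 * (t - s) by ring.
have -> : 2 * t - (s + t) = t - s by ring.
have -> : s + t - 2 * s = t - s by ring.
have ts : 0 < t - s by rewrite subr_gt0.
rewrite -mulrDr [X in X <= _]mulrAC [X in X <= _]mulrC ler_pM2l//; lra.
Qed.

(** By subadditivity omega vanishes on every multiple of t. *)
Lemma om_eq0 t : 0 < t -> om t = 0 -> forall s, 0 <= s -> om s = 0.
Proof.
move=> t0 ot s s0; apply/eqP; rewrite eq_le om_ge0// andbT.
have := @om_le_muln (Num.truncn (s / t)).+1 s t s0 (ltW t0).
rewrite ot mulr0; apply; rewrite -ler_pdivrMr//.
exact/ltW/truncnS_gt.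
Qed.

Hypothesis homega_lim : right_derivative om n%:R^-1 / (om n%:R^-1 * n%:R)
  @[n --> \oo] --> (0 : R).

(** The assumption on the right derivative, integrated: a concave function lies
below its right tangent, whose slope at 1/n is at most e n omega(1/n). *)
Lemma om_slow (e : R) : 0 < e -> exists n0, forall n, (n0 < n)%N ->
  forall y, n%:R^-1 <= y ->
    om y <= om n%:R^-1 * (1 + e * (n%:R * (y - n%:R^-1))).
Proof.
move=> e0; have /cvgrPdist_le/(_ _ e0)[N _ HN] := homega_lim.
exists N => n Nn y ny.
have n0 : 0 < n%:R :> R by rewrite ltr0n (leq_ltn_trans _ Nn).
have v0 : 0 < n%:R^-1 :> R by rewrite invr_gt0.
have y0 : 0 < y := lt_le_trans v0 ny.
have [oz|on0] := eqVneq (om n%:R^-1) 0.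
  by rewrite oz mul0r (om_eq0 v0 oz)// ltW.
have op : 0 < om n%:R^-1 by rewrite lt_neqAle eq_sym on0 om_ge0// ltW.
have := concave_right_derivative_le v0 om_concave3 ny.
have := HN n (ltnW Nn); rewrite /= sub0r normrN.
set D := right_derivative _ _ => hD.
have {hD} : D <= e * (om n%:R^-1 * n%:R).
  by rewrite -ler_pdivrMr ?mulr_gt0//; exact: le_trans (ler_norm _) hD.
move=> hD hy.
have : D * (y - n%:R^-1) <= e * (om n%:R^-1 * n%:R) * (y - n%:R^-1).
  by rewrite ler_wpM2r// subr_ge0.
have -> : om n%:R^-1 * (1 + e * (n%:R * (y - n%:R^-1))) =
  om n%:R^-1 + e * (om n%:R^-1 * n%:R) * (y - n%:R^-1) by ring.
lra.
Qed.

(** For slowly varying omega the values omega(1/k), k <= n, average to at most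
a constant times the last of them: omega(1/n) grows with 1/n more slowly than
any positive power, so the induction step from n to n + 1 loses nothing. *)
Lemma om_sum_le : exists2 C : R, 0 < C & forall n, (0 < n)%N ->
  \sum_(1 <= k < n.+1) om k%:R^-1 <= C * (n%:R * om n%:R^-1).
Proof.
have h2 : 0 < 1 / 2 :> R by rewrite divr_gt0.
have [n0 Hn0] := om_slow h2.
pose C : R := n0%:R + 2.
have C2 : 2 <= C by rewrite lerDr.
exists C; first exact: lt_le_trans C2.
elim=> [//|n IH] _.
have v0 : 0 < n.+1%:R^-1 :> R by rewrite invr_gt0.
have ov0 : 0 <= om n.+1%:R^-1 by rewrite om_ge0// ltW.
case: (ltnP n0 n) => [n0n|nn0].
  have n_gt0 : (0 < n)%N by rewrite (leq_ltn_trans _ n0n).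
  have nR : 0 < n%:R :> R by rewrite ltr0n.
  rewrite big_nat_recr//=; apply: le_trans (lerD (IH n_gt0) (lexx _)) _.
  have nv : n.+1%:R^-1 <= n%:R^-1 :> R by rewrite lef_pV2 ?posrE// ler_nat.
  have := Hn0 n.+1 (ltnW n0n) _ nv.
  have -> : n.+1%:R * (n%:R^-1 - n.+1%:R^-1) = n%:R^-1 :> R.
    by rewrite -natr1; field; rewrite gt_eqF//= natr1 pnatr_eq0.
  set w := om n.+1%:R^-1 in ov0 * => h.
  have : n%:R * om n%:R^-1 <= w * (n%:R + 1 / 2).
    have -> : w * (n%:R + 1 / 2) = n%:R * (w * (1 + 1 / 2 * n%:R^-1)).
      by field; rewrite gt_eqF.
    by rewrite ler_pM2l.
  move=> h3; have h4 : C * (n%:R * om n%:R^-1) <= C * (w * (n%:R + 1 / 2)).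
    by rewrite ler_wpM2l// ltW// (lt_le_trans _ C2).
  rewrite -natr1; have : w * 2 <= w * C by rewrite ler_wpM2l.
  lra.
apply: (@le_trans _ _ (\sum_(1 <= k < n.+2) n.+1%:R * om n.+1%:R^-1)).
  apply: ler_sum_nat => k /andP[k0 kn].
  apply: om_le_muln; rewrite ?invr_ge0 ?ler0n//.
  by rewrite mulfV ?pnatr_eq0// invf_le1 ?ler1n ?ltr0n.
rewrite sumr_const_nat subn1 /= -[leLHS]mulr_natl ler_wpM2r// ?mulr_ge0//.
by rewrite /C -(natrD _ n0 2) ler_nat; lia.
Qed.

End ConcaveModulus.

Section SlowPsi.
Variables (R : realType) (psi : R -> R).
Hypothesis Mpsi : Mset psi.
Implicit Types (n k : nat) (x y : R).

Lemma psi_convex3 : convex3 1 psi.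
Proof. by case: Mpsi => _ _ h _; exact: convex_function_convex3. Qed.

Lemma psi_gt0 x : 1 <= x -> 0 < psi x.
Proof. by case: Mpsi => h _ _ _; exact: h. Qed.

Lemma psi_le x y : 1 <= x -> x <= y -> psi y <= psi x.
Proof.
case: Mpsi => h1 h2 h3 h4; apply: convex_cvg0_nonincreasing => //.
exact: psi_convex3.
Qed.

Hypothesis hpsi_lim :
  `|right_derivative psi n%:R| * n%:R / psi n%:R @[n --> \oo] --> (0 : R).

(** The same for psi, which lies above its right tangent. *)
Lemma psi_slow (e : R) : 0 < e -> exists n0, forall n, (n0 < n)%N ->
  forall y, n%:R <= y -> n%:R * (psi n%:R - psi y) <= e * psi n%:R * (y - n%:R).
Proof.
move=> e0; have /cvgrPdist_le/(_ _ e0)[N _ HN] := hpsi_lim.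
exists N.+1 => n Nn y ny.
have n1 : 1 < n%:R :> R by rewrite ltr1n (leq_ltn_trans _ Nn).
have n0 : 0 < n%:R :> R by rewrite (lt_trans _ n1).
have pn : 0 < psi n%:R by rewrite psi_gt0// ltW.
have [_ /(_ y ny)] := convex_right_derivative n1 psi_convex3.
have := HN n (ltnW (ltnW Nn)); rewrite /= sub0r normrN.
set D := right_derivative _ _ => hD hy.
have {hD} : `|D| * n%:R <= e * psi n%:R.
  by rewrite -ler_pdivrMr//; exact: le_trans (ler_norm _) hD.
move=> hD; have hD' : - `|D| <= D by rewrite lerNl -normrN ler_norm.
have yn : 0 <= y - n%:R by rewrite subr_ge0.
have h1 : psi n%:R - psi y <= `|D| * (y - n%:R).
  have : - `|D| * (y - n%:R) <= D * (y - n%:R) by rewrite ler_wpM2r.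
  lra.
apply: le_trans (ler_wpM2l (ltW n0) h1) _.
by rewrite mulrA [n%:R * _]mulrC ler_wpM2r.
Qed.

Lemma psi_diff_le : exists2 C : R, 0 < C & forall n, (0 < n)%N ->
  n%:R * (psi n%:R - psi n.+1%:R) <= C * psi n%:R.
Proof.
have [n0 H] := psi_slow (ltr01 : 0 < 1 :> R).
exists (n0%:R + 1); first by rewrite ltr_wpDl.
move=> n n_gt0.
have n1 : 1 <= n%:R :> R by rewrite ler1n.
have pn : 0 < psi n%:R by rewrite psi_gt0.
case: (ltnP n0 n) => [n0n|nn0].
  apply: le_trans (H n n0n n.+1%:R _) _; first by rewrite ler_nat.
  rewrite -natr1 addrAC subrr add0r mulr1 ler_wpM2r ?(ltW pn)//.
  by rewrite lerDr.
have pn1 : 0 < psi n.+1%:R by rewrite psi_gt0// ler1n.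
apply: (@le_trans _ _ (n%:R * psi n%:R)).
  by rewrite ler_wpM2l// gerBl ltW.
rewrite ler_wpM2r ?(ltW pn)// natr1 ler_nat; exact: leqW.
Qed.

End SlowPsi.

(** * Abel summation *)

Section AbelSummation.
Variable R : realType.
Implicit Types (th B G w p : nat -> R) (k m n N j : nat).

Definition diff2 th m : R := th m - 2 * th m.+1 + th m.+2.

Lemma sum_diff2_weighted th k M : (k <= M)%N ->
  \sum_(k <= m < M) diff2 th m * (m.+1%:R - k%:R) =
  th k - th M - (M%:R - k%:R) * (th M - th M.+1).
Proof.
elim: M => [|M IH]; first by rewrite leqn0 => /eqP->; rewrite big_geq//; ring.
rewrite leq_eqVlt => /predU1P[->|kM]; first by rewrite big_geq//; ring.
by rewrite big_nat_recr//= IH// /diff2 -!(natr1 M); ring.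
Qed.

Lemma sum_diff2 th k M : (k <= M)%N ->
  \sum_(k <= m < M) diff2 th m = th k - th k.+1 - (th M - th M.+1).
Proof.
elim: M => [|M IH]; first by rewrite leqn0 => /eqP->; rewrite big_geq//; ring.
rewrite leq_eqVlt => /predU1P[->|kM]; first by rewrite big_geq//; ring.
by rewrite big_nat_recr//= IH// /diff2; ring.
Qed.

Section FiniteSequence.
Variables (th : nat -> R) (N : nat).
Hypothesis th0 : forall k, (N < k)%N -> th k = 0.

Lemma finite_sum_diff2_weighted k : (k <= N.+1)%N ->
  \sum_(k <= m < N.+1) diff2 th m * (m.+1%:R - k%:R) = th k.
Proof. by move=> kN; rewrite sum_diff2_weighted// (@th0 N.+1)// (@th0 N.+2)//; ring. Qed.

(** The total weight that [abel_twice] puts on the Cesaro means of order at least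
j. It is th j up to a term which slow decrease of th keeps of the same order. *)
Lemma finite_sum_diff2_mulS j : (j <= N.+1)%N ->
  \sum_(j <= m < N.+1) m.+1%:R * diff2 th m = th j + j%:R * (th j - th j.+1).
Proof.
move=> jN.
have -> : th j - th j.+1 = \sum_(j <= m < N.+1) diff2 th m.
  by rewrite sum_diff2// (@th0 N.+1)// (@th0 N.+2)//; ring.
rewrite -[X in _ = X + _](finite_sum_diff2_weighted jN).
by rewrite mulr_sumr -big_split /=; apply: eq_bigr => m _; ring.
Qed.

Definition cesaro_mean B m : R := \sum_(1 <= k < m.+1) fejer_weight R m k * B k.

(** Summing by parts twice turns the coefficients th into weights on the Cesaro
means of order at least n, up to a combination of the first n - 1 terms. *)
Lemma abel_twice B n : (0 < n <= N.+1)%N ->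
  \sum_(1 <= k < N.+1) th k * B k =
  \sum_(n <= m < N.+1) m.+1%:R * diff2 th m * cesaro_mean B m +
  \sum_(1 <= k < n)
    (th k - \sum_(n <= m < N.+1) diff2 th m * (m.+1%:R - k%:R)) * B k.
Proof.
move=> /andP[n0 nN].
have -> : \sum_(n <= m < N.+1) m.+1%:R * diff2 th m * cesaro_mean B m =
  \sum_(1 <= k < N.+1)
     \sum_(n <= m < N.+1 | (k < m.+1)%N) diff2 th m * (m.+1%:R - k%:R) * B k.
  rewrite (exchange_big_dep_nat xpredT)//=.
  rewrite big_nat [RHS]big_nat; apply: eq_bigr => m /andP[nm mN].
  rewrite /cesaro_mean mulr_sumr (big_nat_widen 1 m.+1 N.+1)//=.
  by apply: eq_bigr => k _; rewrite -fejer_weightE; ring.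
rewrite (@big_cat_nat _ _ _ n)//= [X in _ = X + _](@big_cat_nat _ _ _ n)//=.
rewrite [RHS]addrAC -big_split /=; congr (_ + _).
  rewrite big_nat [RHS]big_nat; apply: eq_bigr => k /andP[k0 kn].
  have -> : \sum_(n <= m < N.+1 | (k < m.+1)%N) diff2 th m * (m.+1%:R - k%:R) * B k
      = \sum_(n <= m < N.+1) diff2 th m * (m.+1%:R - k%:R) * B k.
    rewrite big_nat_cond [RHS]big_nat_cond; apply: eq_bigl => m.
    by rewrite andbT ltnS; lia.
  by rewrite -mulr_suml; ring.
rewrite big_nat [RHS]big_nat; apply: eq_bigr => k /andP[nk kN].
rewrite -mulr_suml; congr (_ * _).
rewrite -(finite_sum_diff2_weighted (ltnW kN)).
by rewrite [LHS](big_nat_widenl _ n).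
Qed.

End FiniteSequence.

Lemma sum_triangle w G n M :
  \sum_(n <= m < M) w m * (\sum_(n <= j < m.+1) G j) =
  \sum_(n <= j < M) G j * (\sum_(j <= m < M) w m).
Proof.
under eq_bigr do rewrite mulr_sumr.
rewrite big_nat; under eq_bigr => m /andP[nm mM] do rewrite (big_nat_widen n m.+1 M)//.
rewrite -big_nat (exchange_big_dep_nat xpredT)//=.
rewrite big_nat [RHS]big_nat; apply: eq_bigr => j /andP[nj jM].
rewrite mulr_sumr (big_nat_widenl j n)//.
by apply: eq_big => m; [rewrite ltnS|move=> _; rewrite mulrC].
Qed.

Section DampedSequence.
Variables (p : nat -> R) (N : nat).
Hypothesis p_ge0 : forall k, (0 < k)%N -> 0 <= p k.
Hypothesis p_noninc : forall k, (0 < k)%N -> p k.+1 <= p k.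
Hypothesis p_convex : forall k, (0 < k)%N -> 0 <= diff2 p k.

(** The coefficients of the N-th Fejer mean of a series with coefficients p;
the natural-number subtraction makes the weights vanish from N + 1 on. *)
Definition damped k : R := (N.+1 - k)%N%:R / N.+1%:R * p k.

Lemma damped_eq0 k : (N < k)%N -> damped k = 0.
Proof. by move=> Nk; rewrite /damped (_ : (N.+1 - k = 0)%N) ?mul0r//; lia. Qed.

Lemma dampedE k : (k <= N)%N -> damped k = fejer_weight R N k * p k.
Proof.
move=> kN; rewrite /damped natrB 1?leqW// /fejer_weight mulrBl mulfV//.
Qed.

Let v k : R := (N.+1 - k)%N%:R / N.+1%:R.

Let v_ge0 k : 0 <= v k. Proof. by rewrite divr_ge0. Qed.

Let v_le1 k : v k <= 1.
Proof. by rewrite ler_pdivrMr// mul1r ler_nat leq_subr. Qed.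

Let v_noninc k : v k.+1 <= v k.
Proof. by rewrite ler_wpM2r ?invr_ge0// ler_nat; lia. Qed.

Let v_convex k : 0 <= v k - 2 * v k.+1 + v k.+2.
Proof.
rewrite /v mulrA -mulrBl -mulrDl mulr_ge0 ?invr_ge0//.
rewrite addrAC subr_ge0 -natrM -natrD ler_nat; lia.
Qed.

Lemma damped_ge0 k : (0 < k)%N -> 0 <= damped k.
Proof. by move=> k0; rewrite mulr_ge0// ?v_ge0// p_ge0. Qed.

Lemma damped_le k : (0 < k)%N -> damped k <= p k.
Proof. by move=> k0; rewrite ler_piMl ?p_ge0//; exact: v_le1. Qed.

Lemma damped_noninc k : (0 < k)%N -> damped k.+1 <= damped k.
Proof.
by move=> k0; apply: ler_pM; [exact: v_ge0|exact: p_ge0|exact: v_noninc|exact: p_noninc].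
Qed.

(** The product of two nonnegative nonincreasing convex sequences is convex; this
makes the weights of [abel_twice] nonnegative. *)
Lemma damped_convex k : (0 < k)%N -> 0 <= diff2 damped k.
Proof.
move=> k0; rewrite /diff2 /damped -!/(v _).
have := v_convex k; have := p_convex k0; rewrite /diff2.
have := v_ge0 k.+1; have := v_noninc k.+1; have := v_noninc k.
have := p_ge0 k0; have := p_noninc (isT : (0 < k.+1)%N).
have := @p_ge0 k.+1 isT; have := @p_ge0 k.+2 isT; have := p_noninc k0.
move: (v k) (v k.+1) (v k.+2) (p k) (p k.+1) (p k.+2) => a b c x y z.
move=> yx z0 y0 zy x0 ba cb b0 hp hv.
have h1 : 0 <= (a - (2 * b - c)) * x by rewrite mulr_ge0//; lra.
have h2 : 0 <= (2 * b - c) * (x - (2 * y - z)) by rewrite mulr_ge0//; lra.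
have h3 : 0 <= (b - c) * (y - z) by rewrite mulr_ge0//; lra.
by lra.
Qed.

Lemma damped_diff_le k : (0 < k <= N)%N ->
  k%:R * (damped k - damped k.+1) <= k%:R * (p k - p k.+1) + p k.
Proof.
move=> /andP[k0 kN].
have e : damped k - damped k.+1 = v k.+1 * (p k - p k.+1) + N.+1%:R^-1 * p k.
  rewrite /damped -!/(v _).
  have -> : v k = v k.+1 + N.+1%:R^-1.
    rewrite /v -[X in _ = _ + X]mul1r -mulrDl natr1; congr (_%:R / _); lia.
  by ring.
rewrite e mulrDr; apply: lerD.
  rewrite ler_wpM2l// ler_piMl ?v_le1// subr_ge0; exact: p_noninc.
rewrite mulrA ler_piMl ?p_ge0// ler_pdivrMr// mul1r ler_nat; exact: leqW.
Qed.

End DampedSequence.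

End AbelSummation.

(** * Differences of Fejer means on H_omega *)

Section BlockEstimates.
Variable R : realType.
Implicit Types (h u K : R -> R) (m n j M : nat) (b : nat -> R) (t x y : R).

Lemma natS_le_double j : (0 < j)%N -> j.+1%:R <= 2 * j%:R :> R.
Proof. by move=> j0; rewrite -natr1 (_ : 2 * j%:R = j%:R + j%:R) ?lerD2l ?ler1n//; ring. Qed.

Lemma block_length j : (0 < j)%N ->
  j%:R^-1 - j.+1%:R^-1 = (j%:R * j.+1%:R)^-1 :> R.
Proof.
move=> j0; have jR : j%:R != 0 :> R by rewrite pnatr_eq0 -lt0n.
by rewrite -natr1; field; rewrite jR /= natr1 pnatr_eq0.
Qed.

Lemma block_le j : (0 < j)%N -> j.+1%:R^-1 <= j%:R^-1 :> R.
Proof. by move=> j0; rewrite lef_pV2 ?posrE ?ltr0n// ler_nat. Qed.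

Lemma inv_nat_le n M : (0 < n <= M)%N -> M%:R^-1 <= n%:R^-1 :> R.
Proof.
by move=> /andP[n0 nM]; rewrite lef_pV2 ?posrE ?ltr0n ?(leq_trans n0)// ler_nat.
Qed.

Lemma intg_blocks h n M : continuous h -> (0 < n <= M)%N ->
  intg M%:R^-1 n%:R^-1 h = \sum_(n <= j < M) intg j.+1%:R^-1 j%:R^-1 h.
Proof.
move=> ch; elim: M => [|M IH]; first by case: n.
move=> /andP[n0]; rewrite leq_eqVlt => /predU1P[<-|nM].
  by rewrite big_geq// /intg set_itv1 Rintegral_set1.
have M0 : (0 < M)%N by rewrite (leq_trans n0).
have nM' : (0 < n <= M)%N by rewrite n0.
rewrite big_nat_recr//= -IH// addrC; apply: intg_split => //; first exact: block_le.
exact: inv_nat_le.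
Qed.

Lemma norm_intg_blocks_le h n M b : continuous h -> (0 < n <= M)%N ->
  (forall j t, (n <= j < M)%N -> j.+1%:R^-1 <= t <= j%:R^-1 -> `|h t| <= b j) ->
  `|intg M%:R^-1 n%:R^-1 h| <= \sum_(n <= j < M) b j * (j%:R * j.+1%:R)^-1.
Proof.
move=> ch nM hb; have /andP[n0 _] := nM; rewrite intg_blocks//.
apply: le_trans (ler_norm_sum _ _ _) _; apply: ler_sum_nat => j jn.
have j0 : (0 < j)%N by case/andP: jn => nj _; exact: leq_trans n0 nj.
rewrite -block_length//; apply: norm_intg_le_cst => //; first exact: block_le.
by move=> t ht; apply: hb.
Qed.

Lemma sum_block_length n M : (0 < n <= M)%N ->
  \sum_(n <= j < M) (j%:R * j.+1%:R)^-1 <= n%:R^-1 :> R.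
Proof.
move=> nM; have /andP[n0 nM'] := nM.
have -> : \sum_(n <= j < M) (j%:R * j.+1%:R)^-1 = n%:R^-1 - M%:R^-1 :> R.
  elim: M {nM} nM' => [|M IH]; first by case: n n0.
  rewrite leq_eqVlt => /predU1P[->|nM]; first by rewrite big_geq// subrr.
  by rewrite big_nat_recr//= IH// -block_length ?(leq_trans n0)//; ring.
by rewrite gerBl invr_ge0.
Qed.

End BlockEstimates.

Section MeanDifferences.
Variables (R : realType) (om : R -> R).
Hypotheses (homega : modulus_of_continuity om) (hconv : convex_upwards om).
Implicit Types (u K phi : R -> R) (g t x y A B al : R) (m n j M : nat).

Let omV_le j n : (0 < n <= j)%N -> om (2 * j%:R^-1) <= om (2 * n%:R^-1).
Proof.
move=> nj; apply: (om_le homega); first by rewrite mulr_ge0// invr_ge0.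
by rewrite ler_wpM2l// inv_nat_le.
Qed.

(** On [0, 1/M] the kernel K is bounded by its size at 0. On the rest, cut into the
blocks [1/(j+1), 1/j], the part al / t of K integrates omega(2t) to at most
al omega(2/j) / j per block; the other parts of K have integral O(1) over
[1/M, 1/n]. *)
Lemma near_estimate u K n M al B : continuous u -> continuous K ->
  (0 < n <= M)%N -> 0 <= al -> 0 <= B ->
  (forall t, 0 <= t <= n%:R^-1 -> `|u t| <= om (2 * t)) ->
  (forall t, 0 <= t <= M%:R^-1 -> `|K t| <= 2 * M%:R) ->
  (forall t, M%:R^-1 <= t <= n%:R^-1 ->
     `|K t| <= al / t + B / (M%:R * t ^+ 2) + n%:R) ->
  `|intg 0 n%:R^-1 (fun t => u t * K t)| <=
     al * (\sum_(n <= j < M) om (2 * j%:R^-1) / j%:R) +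
     (3 + 2 * B) * om (2 * n%:R^-1).
Proof.
move=> cu cK nM al0 B0 hu hK1 hK2; have /andP[n0 nM'] := nM.
have M0 : (0 < M)%N by rewrite (leq_trans n0).
have MR : 0 < M%:R :> R by rewrite ltr0n.
have nR : 0 < n%:R :> R by rewrite ltr0n.
have Mn := inv_nat_le R nM.
have Mv0 : 0 <= M%:R^-1 :> R by rewrite invr_ge0.
have on0 : 0 <= om (2 * n%:R^-1) by apply: (om_ge0 homega); rewrite mulr_ge0// invr_ge0.
have cuK : continuous (fun t => u t * K t) by cts.
rewrite (@intg_split _ 0 M%:R^-1)//.
apply: le_trans (ler_normD _ _) _.
have h1 : `|intg 0 M%:R^-1 (fun t => u t * K t)| <= 2 * om (2 * n%:R^-1).
  have -> : 2 * om (2 * n%:R^-1) = om (2 * n%:R^-1) * (2 * M%:R) * (M%:R^-1 - 0).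
    by rewrite subr0; field; rewrite gt_eqF.
  apply: norm_intg_le_cst => // t /andP[t0 tM].
  have tn : t <= n%:R^-1 := le_trans tM Mn.
  rewrite normrM; apply: ler_pM => //; last by apply: hK1; rewrite t0.
  apply: le_trans (hu t _) _; first by rewrite t0.
  by apply: (om_le homega); [rewrite mulr_ge0|rewrite ler_wpM2l].
pose b j := om (2 * j%:R^-1) * (al * j.+1%:R + B * (j.+1%:R ^+ 2 / M%:R) + n%:R).
have h2 := @norm_intg_blocks_le R _ n M b cuK nM.
have {}h2 : `|intg M%:R^-1 n%:R^-1 (fun t => u t * K t)| <=
    \sum_(n <= j < M) b j * (j%:R * j.+1%:R)^-1.
  apply: h2 => j t /andP[nj jM] /andP[jt tj].
  have jR : 0 < j.+1%:R^-1 :> R by rewrite invr_gt0.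
  have j0 : (0 < j)%N := leq_trans n0 nj.
  have t0 : 0 < t := lt_le_trans jR jt.
  have tn : t <= n%:R^-1 by apply: le_trans tj (inv_nat_le _ _); rewrite n0.
  have Mt : M%:R^-1 <= t by apply: le_trans jt; apply: inv_nat_le.
  have tV : t^-1 <= j.+1%:R by rewrite -[leRHS]invrK lef_pV2 ?posrE.
  rewrite normrM /b; apply: ler_pM => //.
    apply: le_trans (hu t _) _; first by rewrite (ltW t0).
    by apply: (om_le homega); [rewrite mulr_ge0// ltW|rewrite ler_wpM2l].
  apply: le_trans (hK2 t _) _; first by rewrite Mt.
  rewrite lerD2r; apply: lerD; first by rewrite ler_wpM2l.
  rewrite ler_wpM2l// invfM mulrC ler_wpM2r// -exprVn lerXn2r ?nnegrE ?invr_ge0//.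
  exact: ltW.
apply: le_trans (lerD h1 h2) _.
have h3 : \sum_(n <= j < M) b j * (j%:R * j.+1%:R)^-1 <=
   \sum_(n <= j < M) (al * (om (2 * j%:R^-1) / j%:R) +
     om (2 * n%:R^-1) * (2 * B / M%:R + n%:R * (j%:R * j.+1%:R)^-1)).
  apply: ler_sum_nat => j /andP[nj jM]; have j0 : (0 < j)%N := leq_trans n0 nj.
  have jR : 0 < j%:R :> R by rewrite ltr0n.
  have j1R : 0 < j.+1%:R :> R by rewrite ltr0n.
  have -> : b j * (j%:R * j.+1%:R)^-1 = al * (om (2 * j%:R^-1) / j%:R) +
     om (2 * j%:R^-1) * (B * (j.+1%:R / j%:R) / M%:R + n%:R * (j%:R * j.+1%:R)^-1).
    by rewrite /b; field; rewrite nat1r !gt_eqF.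
  rewrite lerD2l; apply: ler_pM.
  - by apply: (om_ge0 homega); rewrite mulr_ge0// invr_ge0.
  - by rewrite addr_ge0// ?mulr_ge0// ?invr_ge0 ?mulr_ge0// ltW.
  - by apply: omV_le; rewrite n0.
  - rewrite lerD2r ler_wpM2r// [2 * B]mulrC ler_wpM2l// ler_pdivrMr//.
    exact: natS_le_double.
apply: le_trans (lerD (lexx _) h3) _.
rewrite big_split /= -mulr_sumr -mulr_sumr addrCA lerD2l.
rewrite big_split /= sumr_const_nat -mulr_sumr.
have -> : (3 + 2 * B) * om (2 * n%:R^-1) =
  2 * om (2 * n%:R^-1) + om (2 * n%:R^-1) * (2 * B + 1) by ring.
rewrite lerD2l ler_wpM2l//; apply: lerD.
  have -> : 2 * B / M%:R *+ (M - n) = 2 * B * ((M - n)%N%:R / M%:R).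
    by rewrite -mulr_natr; ring.
  by rewrite ler_piMr ?mulr_ge0// ler_pdivrMr// mul1r ler_nat leq_subr.
by rewrite mulrC -ler_pdivlMr// mul1r sum_block_length.
Qed.

Variable C : R.
Hypothesis C_gt0 : 0 < C.
Hypothesis om_sum : forall n, (0 < n)%N ->
  \sum_(1 <= k < n.+1) om k%:R^-1 <= C * (n%:R * om n%:R^-1).

(** Away from 0 a kernel of size 1/(n t^2) integrates om to a multiple of the
average of the values om(1/k), k <= n. *)
Lemma far_estimate u K n A : continuous u -> continuous K ->
  (0 < n)%N -> 0 <= A ->
  (forall t, 0 <= t <= pi -> `|u t| <= om (2 * t)) ->
  (forall t, n%:R^-1 <= t <= pi -> `|K t| <= A / (n%:R * t ^+ 2)) ->
  `|intg n%:R^-1 pi (fun t => u t * K t)| <= A * (4 * C + 24) * om n%:R^-1.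
Proof.
move=> cu cK n0 A0 hu hK.
have nR : 0 < n%:R :> R by rewrite ltr0n.
have nn : (0 < 1 <= n)%N by [].
have n1 : n%:R^-1 <= 1 :> R by rewrite invf_le1 ?ler1n.
have nv0 : 0 <= n%:R^-1 :> R by rewrite invr_ge0.
have on0 : 0 <= om n%:R^-1 by apply: (om_ge0 homega).
have cuK : continuous (fun t => u t * K t) by cts.
have pi2 := pi_ge2 R; have pi4 := pihalf_lt2 R.
have pi1 : 1 <= pi :> R by lra.
rewrite (@intg_split _ n%:R^-1 1)//.
apply: le_trans (ler_normD _ _) _; rewrite mulrDr mulrDl; apply: lerD.
  pose b j := om (2 * j%:R^-1) * (A / n%:R * j.+1%:R ^+ 2).
  have := @norm_intg_blocks_le R _ 1 n b cuK nn; rewrite invr1 => h.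
  apply: le_trans (h _) _.
    move=> j t /andP[j0 jn] /andP[jt tj].
    have jR : 0 < j.+1%:R^-1 :> R by rewrite invr_gt0.
    have t0 : 0 < t := lt_le_trans jR jt.
    have t1 : t <= 1 by apply: le_trans tj _; rewrite invf_le1 ?ler1n ?ltr0n.
    have tV : t^-1 <= j.+1%:R by rewrite -[leRHS]invrK lef_pV2 ?posrE.
    have nt : n%:R^-1 <= t by apply: le_trans jt; apply: inv_nat_le.
    rewrite normrM /b; apply: ler_pM => //.
      apply: le_trans (hu t _) _; first by apply/andP; split; lra.
      by apply: (om_le homega); [rewrite mulr_ge0// ltW|rewrite ler_wpM2l].
    apply: le_trans (hK t _) _; first by apply/andP; split; lra.
    rewrite invfM mulrA ler_wpM2l ?divr_ge0//.
    by rewrite -exprVn lerXn2r ?nnegrE ?invr_ge0// ltW.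
  apply: (@le_trans _ _ (\sum_(1 <= j < n) 4 * A / n%:R * om j%:R^-1)).
    apply: ler_sum_nat => j /andP[j0 jn].
    have jR : 0 < j%:R :> R by rewrite ltr0n.
    have -> : b j * (j%:R * j.+1%:R)^-1 =
        om (2 * j%:R^-1) * (A / n%:R * (j.+1%:R / j%:R)).
      by rewrite /b; field; rewrite nat1r !gt_eqF// ltr0n.
    have -> : 4 * A / n%:R * om j%:R^-1 = (2 * om j%:R^-1) * (A / n%:R * 2) by ring.
    apply: ler_pM.
    - by apply: (om_ge0 homega); rewrite mulr_ge0// invr_ge0.
    - by rewrite mulr_ge0// divr_ge0.
    - by apply: (om_muln homega 2); rewrite invr_ge0.
    - rewrite ler_wpM2l ?divr_ge0// ler_pdivrMr//; exact: natS_le_double.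
  rewrite -mulr_sumr.
  have -> : A * (4 * C) * om n%:R^-1 = 4 * A / n%:R * (C * (n%:R * om n%:R^-1)).
    by field; rewrite gt_eqF.
  rewrite ler_wpM2l ?divr_ge0 ?mulr_ge0//.
  apply: le_trans (om_sum n0); rewrite big_nat_recr//= lerDl//.
apply: (@le_trans _ _ (8 * (n%:R * om n%:R^-1) * (A / n%:R) * (pi - 1))).
  apply: norm_intg_le_cst => // t /andP[t1 tpi].
  have t0 : 0 < t by apply: lt_le_trans t1.
  rewrite normrM; apply: ler_pM => //.
    apply: le_trans (hu t _) _; first by rewrite tpi ltW.
    rewrite mulrA -(natrM R 8 n); apply: (om_le_muln homega) => //.
      by rewrite mulr_ge0// ltW.
    by rewrite natrM mulfK ?gt_eqF//; lra.
  apply: le_trans (hK t _) _; first by rewrite tpi (le_trans n1).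
  rewrite invfM mulrA ler_piMr ?divr_ge0//.
  by rewrite invf_le1 ?exprn_gt0// exprn_ege1.
have -> : 8 * (n%:R * om n%:R^-1) * (A / n%:R) * (pi - 1) =
  A * om n%:R^-1 * (8 * (pi - 1)).
  by move: (pi - 1) => p; field; rewrite gt_eqF.
by rewrite [leRHS]mulrAC ler_wpM2l ?mulr_ge0//; lra.
Qed.

(** Folding onto [0, pi] leaves a second symmetric difference of phi against the
even kernels and a first one against the odd ones. The term 2 phi(x) costs
nothing since all Fejer kernels have the same mass. *)
Lemma fejer_sum_diffE g phi m l x : continuous phi -> periodic phi (2 * pi) ->
  fejer_sum g phi m x - fejer_sum g phi l x =
  pi^-1 * (cos g * (2 * intg 0 pi (fun t =>
      (phi (x + t) + phi (x - t) - 2 * phi x) / 2 * (fejer m t - fejer l t)))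
    - sin g * intg 0 pi (fun t =>
      (phi (x + t) - phi (x - t)) * (conj_fejer m t - conj_fejer l t))).
Proof.
move=> cphi pphi; rewrite !fejer_sumE// -mulrBr; congr (_ * _).
have cx : continuous (fun t => phi (x + t)) by cts.
have cx' : continuous (fun t => phi (x - t)) by cts.
have cF := @fejer_ct R; have cG := @conj_fejer_ct R.
rewrite -intgB; [|by cts..].
rewrite intg_sym; last by cts.
have Z : intg 0 pi (fun t => 2 * phi x * (fejer m t - fejer l t)) = 0.
  rewrite intgZ; last by cts.
  by rewrite intgB// !intg_fejer_half subrr mulr0.
rewrite -[LHS]subr0 -[X in _ - X](mulr0 (cos g)) -{2}Z.
rewrite -!intgZ; [|by cts..].
rewrite -!intgB; [|by cts..].
by apply: eq_intg => t _; rewrite !fejerN !conj_fejerN; field.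
Qed.

(** Both symmetric differences of phi are at most omega(2t). The Fejer kernels
decay like 1 / t^2 and yield only the remainder. The difference of the
conjugate kernels has size 1 / t for t between 1/(m+1) and 1/(l+1), where
the one of order m has settled and the one of order l is still bounded by
l + 1, and it yields the sum, with the exact constant; beyond 1/(l+1) the
limits of both cancel and the rest decays like 1 / t^2. *)
Lemma mean_difference : exists2 C' : R, 0 <= C' &
  forall phi g x l m, Hclass om phi -> (l <= m)%N ->
  `|fejer_sum g phi m x - fejer_sum g phi l x| <=
    pi^-1 * `|sin g| * (\sum_(l.+1 <= j < m.+1) om (2 * j%:R^-1) / j%:R) +
    C' * om l.+1%:R^-1.
Proof.
(* 18 and 9 come from [fejer_decay] and [conj_fejer_hcot]; a difference of two
   kernels doubles them in the far range. *)
pose D : R := 2 * (2 * (3 + 2 * 18) + 36 * (4 * C + 24)) +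
  (2 * (3 + 2 * 9) + 18 * (4 * C + 24)).
have D0 : 0 <= D by rewrite /D; have := C_gt0; lra.
exists D => // phi g x l m [[pphi cphi] hphi] lm.
have cx : continuous (fun t => phi (x + t)) by cts.
have cx' : continuous (fun t => phi (x - t)) by cts.
have cF := @fejer_ct R; have cG := @conj_fejer_ct R.
have pi2 := pi_ge2 R; have pi0 := pi_gt0 R.
set S := \sum_(_ <= j < _) _.
set w := om _.
have lm' : (0 < l.+1 <= m.+1)%N by [].
have lv0 : 0 <= l.+1%:R^-1 :> R by rewrite invr_ge0.
have lv1 : l.+1%:R^-1 <= 1 :> R by rewrite invf_le1 ?ler1n.
have lvpi : l.+1%:R^-1 <= pi :> R by apply: le_trans lv1 _; lra.
have ml : m.+1%:R^-1 <= l.+1%:R^-1 :> R := inv_nat_le R lm'.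
have w0 : 0 <= w by apply: (om_ge0 homega).
have w2 : om (2 * l.+1%:R^-1) <= 2 * w by apply: (om_muln homega 2).
have mv0 : 0 < m.+1%:R^-1 :> R by rewrite invr_gt0.
have lmR : l.+1%:R <= m.+1%:R :> R by rewrite ler_nat.
have S0 : 0 <= S.
  apply: sumr_ge0 => j _; rewrite divr_ge0//; apply: (om_ge0 homega).
  by rewrite mulr_ge0// invr_ge0.
pose u1 t := (phi (x + t) + phi (x - t) - 2 * phi x) / 2.
pose u2 t := phi (x + t) - phi (x - t).
have cu1 : continuous u1 by rewrite /u1; cts.
have cu2 : continuous u2 by rewrite /u2; cts.
have hu1 t : 0 <= t -> `|u1 t| <= om (2 * t).
  move=> t0; rewrite /u1 normrM (ger0_norm (_ : 0 <= 2^-1))// ler_pdivrMr//.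
  have -> : phi (x + t) + phi (x - t) - 2 * phi x =
    (phi (x + t) - phi x) + (phi (x - t) - phi x) by ring.
  apply: le_trans (ler_normD _ _) _.
  have e1 : `|phi (x + t) - phi x| <= om t.
    by have := hphi (x + t) x; rewrite [X in om `|X|]addrAC subrr add0r (ger0_norm t0).
  have e2 : `|phi (x - t) - phi x| <= om t.
    have := hphi (x - t) x.
    by rewrite [X in om `|X|]addrAC subrr add0r normrN (ger0_norm t0).
  have : om t <= om (2 * t) by apply: (om_le homega) => //; lra.
  by lra.
have hu2 t : 0 <= t -> `|u2 t| <= om (2 * t).
  move=> t0; apply: le_trans (hphi _ _) _.
  have -> : x + t - (x - t) = 2 * t by ring.
  by rewrite ger0_norm// mulr_ge0.
pose K1 t := @fejer R m t - fejer l t.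
pose K2 t := @conj_fejer R m t - conj_fejer l t.
have cK1 : continuous K1 by rewrite /K1; cts.
have cK2 : continuous K2 by rewrite /K2; cts.
have K1s t : `|K1 t| <= 2 * m.+1%:R.
  apply: le_trans (ler_normB _ _) _.
  by have := fejer_le m t; have := fejer_le l t; lra.
have K2s t : `|K2 t| <= 2 * m.+1%:R.
  apply: le_trans (ler_normB _ _) _.
  by have := conj_fejer_le m t; have := conj_fejer_le l t; lra.
have decay_le t : 0 < t -> (m.+1%:R * t ^+ 2)^-1 <= (l.+1%:R * t ^+ 2)^-1.
  move=> t0; rewrite lef_pV2 ?posrE ?mulr_gt0 ?exprn_gt0//.
  by rewrite ler_wpM2r// ltW// exprn_gt0.
have I1 : `|intg 0 pi (fun t => u1 t * K1 t)| <=
    (2 * (3 + 2 * 18) + 36 * (4 * C + 24)) * w.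
  rewrite (@intg_split _ 0 l.+1%:R^-1)//; last by cts.
  apply: le_trans (ler_normD _ _) _; rewrite mulrDl; apply: lerD.
    apply: le_trans (near_estimate (al := 0) (B := 18) cu1 cK1 lm' _ _ _ _ _) _ => //.
    - by move=> t /andP[t0 _]; exact: hu1.
    - move=> t /andP[mt tl]; have t0 : 0 < t := lt_le_trans mv0 mt.
      rewrite mul0r add0r; apply: le_trans (ler_normB _ _) _.
      by apply: lerD; [apply: fejer_decay; rewrite t0 (le_trans tl)|exact: fejer_le].
    - by rewrite mul0r add0r; lra.
  apply: far_estimate => //.
  - by move=> t /andP[t0 _]; exact: hu1.
  - move=> t /andP[lt tpi]; have t0 : 0 < t by apply: lt_le_trans (lt_le_trans mv0 ml) lt.
    apply: le_trans (ler_normB _ _) _.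
    have tp : 0 < t <= pi by rewrite t0.
    by have := fejer_decay m tp; have := fejer_decay l tp; have := decay_le t t0;
      move: (m.+1%:R * t ^+ 2)^-1 (l.+1%:R * t ^+ 2)^-1 => a b; lra.
have I2 : `|intg 0 pi (fun t => u2 t * K2 t)| <=
    S + (2 * (3 + 2 * 9) + 18 * (4 * C + 24)) * w.
  rewrite (@intg_split _ 0 l.+1%:R^-1)//; last by cts.
  apply: le_trans (ler_normD _ _) _; rewrite mulrDl addrA; apply: lerD.
    apply: le_trans (near_estimate (al := 1) (B := 9) cu2 cK2 lm' _ _ _ _ _) _ => //.
    - by move=> t /andP[t0 _]; exact: hu2.
    - move=> t /andP[mt tl]; have t0 : 0 < t := lt_le_trans mv0 mt.
      apply: le_trans (ler_normB _ _) _.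
      have tp : 0 < t <= pi by rewrite t0 (le_trans tl).
      have := conj_fejer_hcot m tp; have /andP[c1 c2] := hcot_le tp.
      have := conj_fejer_le l t.
      have := ler_normD (conj_fejer m t - hcot t) (hcot t).
      rewrite subrK (ger0_norm c1) mul1r.
      by move: (m.+1%:R * t ^+ 2)^-1 (t^-1) c2 => a b; lra.
    - by rewrite mul1r -/S; lra.
  apply: far_estimate => //.
  - by move=> t /andP[t0 _]; exact: hu2.
  - move=> t /andP[lt tpi]; have t0 : 0 < t by apply: lt_le_trans (lt_le_trans mv0 ml) lt.
    have tp : 0 < t <= pi by rewrite t0.
    have -> : K2 t = (conj_fejer m t - hcot t) - (conj_fejer l t - hcot t).
      by rewrite /K2; ring.
    apply: le_trans (ler_normB _ _) _.
    by have := conj_fejer_hcot m tp; have := conj_fejer_hcot l tp; have := decay_le t t0;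
      move: (m.+1%:R * t ^+ 2)^-1 (l.+1%:R * t ^+ 2)^-1 => a b; lra.
rewrite fejer_sum_diffE// -/(u1 _) normrM gtr0_norm ?invr_gt0//.
apply: (@le_trans _ _ (pi^-1 * (`|sin g| * S + D * w))).
  rewrite ler_wpM2l ?invr_ge0 ?(ltW pi0)//.
  apply: le_trans (ler_normB _ _) _; rewrite !normrM (@ger0_norm _ 2)//.
  have g1 : `|cos g| <= 1 := cos_max g.
  have g2 : `|sin g| <= 1 := sin_max g.
  move: I1 I2; rewrite /D -/u1 -/u2 /K1 /K2.
  set i1 := `|intg _ _ _|; set i2 := `|intg _ _ _| => I1 I2.
  have i10 : 0 <= i1 by rewrite normr_ge0.
  have h1 : `|cos g| * (2 * i1) <= 1 * (2 * i1) by rewrite ler_wpM2r// mulr_ge0.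
  have h2 := ler_wpM2l (normr_ge0 (sin g)) I2.
  set Q := (_ + 18 * _) in I2 h2 *.
  have Q0 : 0 <= Q * w by rewrite mulr_ge0// /Q; have := C_gt0; lra.
  have h3 : `|sin g| * (Q * w) <= 1 * (Q * w) by rewrite ler_wpM2r.
  by lra.
rewrite mulrDr mulrA lerD2l ler_piMl ?mulr_ge0// invf_le1//; lra.
Qed.

End MeanDifferences.

(** * The leading term as a series *)

Section IntegralsOverBlocks.
Variable R : realType.
Local Notation mu := (@lebesgue_measure R).

Lemma monotone_measurable (D : set R) (f : R -> R) : is_interval D ->
  (forall x y, D x -> D y -> x <= y -> f x <= f y) -> measurable_fun D f.
Proof.
move=> iD fnd; have mD : measurable D by exact: is_interval_measurable.
apply: (measurability (@RGenCInfty.G R)) => [|/= _ [_] [r] -> <-].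
  exact: RGenCInfty.measurableE.
apply: is_interval_measurable => s t /= [Ds fs] [Dt ft] u /andP[su ut].
have Du : D u by apply: (iD s t) => //; rewrite su.
split => //; move: fs; rewrite /= !in_itv/= !andbT => /le_trans; apply.
exact: fnd.
Qed.

Lemma antitone_measurable (D : set R) (f : R -> R) : is_interval D ->
  (forall x y, D x -> D y -> x <= y -> f y <= f x) -> measurable_fun D f.
Proof.
move=> iD fni; rewrite -(opprK f); apply: measurable_funN.
by apply: monotone_measurable => // x y Dx Dy xy; rewrite lerN2 fni.
Qed.

Local Open Scope ereal_scope.

Variables (D : set R) (f : R -> R) (F : (set R)^nat).
Hypotheses (mD : measurable D) (mf : measurable_fun D f)
  (f0 : forall x, D x -> (0 <= f x)%R).
Hypotheses (mF : forall k, measurable (F k)) (tF : trivIset setT F).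
Variables (l c : nat -> R).
Hypothesis muF : forall k, mu (F k) = (l k)%:E.

Lemma integral_ge_blocks N : (forall k, F k `<=` D) ->
  (forall k x, F k x -> (0 <= c k <= f x)%R) ->
  (\sum_(0 <= k < N) c k * l k)%:E <= \int[mu]_(x in D) (f x)%:E.
Proof.
move=> FD cf.
have mfE : measurable_fun D (EFin \o f) by exact/measurable_EFinP.
have UD : \bigcup_k F k `<=` D by move=> x [k _ /FD].
have mU : measurable (\bigcup_k F k) by apply: bigcup_measurable => k _; exact: mF.
apply: (@le_trans _ _ (\int[mu]_(x in \bigcup_k F k) (f x)%:E)); last first.
  by apply: ge0_subset_integral => // x Dx; rewrite lee_fin f0.
rewrite ge0_integral_bigcup//; last 2 first.
- exact: measurable_funS mfE.
- by move=> x Ux; rewrite lee_fin f0//; exact: UD.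
apply: le_trans (nneseries_lim_ge N _); last first.
  by move=> k _ _; apply: integral_ge0 => x Fx; rewrite lee_fin f0//; exact: FD Fx.
rewrite -sumEFin; apply: lee_sum => k _.
rewrite EFinM -muF -integral_cst; last exact: mF.
apply: (@ge0_le_integral _ _ _ mu _ (mF k) (cst (c k)%:E) (EFin \o f)) => //.
- by move=> x Fx; rewrite lee_fin; case/andP: (cf _ _ Fx).
- by apply: measurable_funS mfE => //; exact: FD.
- by move=> x Fx; rewrite lee_fin; case/andP: (cf _ _ Fx).
Qed.

Lemma integral_le_blocks B : D = \bigcup_k F k ->
  (forall k x, F k x -> (f x <= c k)%R) ->
  (forall N, \sum_(0 <= k < N) c k * l k <= B)%R ->
  \int[mu]_(x in D) (f x)%:E <= B%:E.
Proof.
move=> DF fc hB.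
have mfE : measurable_fun D (EFin \o f) by exact/measurable_EFinP.
have FD k : F k `<=` D by rewrite DF; exact: bigcup_sup.
rewrite [in leLHS]DF ge0_integral_bigcup//; last 2 first.
- by rewrite -DF.
- by move=> x Ux; rewrite lee_fin f0// DF.
apply: lime_le.
  apply: is_cvg_nneseries => k _ _.
  by apply: integral_ge0 => x Fx; rewrite lee_fin f0//; exact: FD Fx.
apply: nearW => N; apply: (@le_trans _ _ (\sum_(0 <= k < N) c k * l k)%:E); last first.
  by rewrite lee_fin.
rewrite -sumEFin; apply: lee_sum => k _.
rewrite EFinM -muF -integral_cst; last exact: mF.
apply: (@ge0_le_integral _ _ _ mu _ (mF k) (EFin \o f) (cst (c k)%:E)) => //.
- by move=> x Fx; rewrite lee_fin f0//; exact: FD Fx.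
- by apply: measurable_funS mfE => //; exact: FD.
- by move=> x Fx; rewrite lee_fin; exact: fc.
Qed.

End IntegralsOverBlocks.

Section LeadingSeries.
Variables (R : realType) (psi om : R -> R).
Local Notation mu := (@lebesgue_measure R).
Hypotheses (homega : modulus_of_continuity om) (Mpsi : Mset psi).
Implicit Types (n N j k : nat) (t x : R).

Definition lead_integral n : R :=
  \int[mu]_(t in `]0, n%:R^-1]) (psi t^-1 * (om t / t)).

(** Since psi(1/t) and omega(t) are monotone, the leading integral is this series,
up to the first term of the latter: see [lead_integral_lower] and
[lead_integral_upper]. The Fourier estimates produce the series and never the
integral. *)
Definition lead_sum n N : R := \sum_(n <= j < N) psi j%:R * om j%:R^-1 / j%:R.

Let block n k : set R := `]((k + n).+1%:R^-1), ((k + n)%:R^-1)].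

(** The blocks are the level sets of the integer part of 1/t. *)
Lemma block_truncn n k t : (0 < n)%N -> block n k t -> Num.truncn t^-1 = (k + n)%N.
Proof.
move=> n0; rewrite /block /= in_itv/= => /andP[h1 h2].
have kn0 : (0 < k + n)%N by rewrite addn_gt0 n0 orbT.
have t0 : 0 < t by apply: lt_trans h1; rewrite invr_gt0.
apply: truncn_def; apply/andP; split.
  by rewrite -[leLHS]invrK lef_pV2 ?posrE// invr_gt0 ltr0n.
by rewrite -[ltRHS]invrK ltf_pV2 ?posrE// invr_gt0.
Qed.

Lemma block_trivI n : (0 < n)%N -> trivIset setT (block n).
Proof.
move=> n0; apply/trivIsetP => i j _ _ ij; apply/seteqP; split => // t [ti tj].
have := block_truncn n0 ti; rewrite (block_truncn n0 tj) => /eqP.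
by rewrite eqn_add2r eq_sym (negbTE ij).
Qed.

Lemma block_measure n k : (0 < n)%N ->
  mu (block n k) = ((k + n)%:R^-1 - (k + n).+1%:R^-1)%:E.
Proof.
move=> n0; have kn0 : (0 < k + n)%N by rewrite addn_gt0 n0 orbT.
rewrite lebesgue_measure_itv/= lte_fin.
by rewrite ltf_pV2 ?posrE ?ltr0n// ltr_nat leqnn.
Qed.

Lemma block_cover n : (0 < n)%N -> `]0, n%:R^-1]%classic = \bigcup_k block n k.
Proof.
move=> n0; apply/seteqP; split => t /=.
  rewrite in_itv/= => /andP[t0 tn].
  have tV : n%:R <= t^-1 by rewrite -[leLHS]invrK lef_pV2 ?posrE ?invr_gt0 ?ltr0n.
  have tV0 : 0 <= t^-1 by rewrite invr_ge0 ltW.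
  have nt : (n <= Num.truncn t^-1)%N by rewrite truncn_ge_nat.
  have m0 : (0 < Num.truncn t^-1)%N by rewrite (leq_trans n0).
  exists (Num.truncn t^-1 - n)%N => //.
  rewrite /block /= in_itv/= subnK//; have /andP[h1 h2] := truncn_itv tV0.
  apply/andP; split.
    by rewrite -[ltRHS]invrK ltf_pV2 ?posrE ?invr_gt0.
  by rewrite -[leLHS]invrK lef_pV2 ?posrE ?invr_gt0// ltr0n.
move=> [k _]; rewrite /block /= !in_itv/= => /andP[h1 h2].
have kn0 : (0 < k + n)%N by rewrite addn_gt0 n0 orbT.
rewrite (lt_trans _ h1) ?invr_gt0//= (le_trans h2)//.
by rewrite lef_pV2 ?posrE ?ltr0n// ler_nat leq_addl.
Qed.

Let g t := psi t^-1 * (om t / t).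

Lemma lead_measurable n : (0 < n)%N -> measurable_fun (`]0, n%:R^-1]%classic : set R) g.
Proof.
move=> n0; have n1 : n%:R^-1 <= 1 :> R by rewrite invf_le1 ?ltr0n// ler1n.
apply: measurable_funM.
  apply: monotone_measurable; first exact: interval_is_interval.
  move=> x y /=; rewrite !in_itv/= => /andP[x0 xn] /andP[y0 yn] xy.
  apply: (psi_le Mpsi); last by rewrite lef_pV2.
  by rewrite invf_ge1// (le_trans yn).
apply: measurable_funM.
  apply: monotone_measurable; first exact: interval_is_interval.
  move=> x y /=; rewrite !in_itv/= => /andP[x0 xn] _ xy.
  by apply: (om_le homega) => //; exact: ltW.
apply: antitone_measurable; first exact: interval_is_interval.
move=> x y /=; rewrite !in_itv/= => /andP[x0 xn] /andP[y0 yn] xy.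
by rewrite lef_pV2.
Qed.

Lemma lead_ge0 n t : (0 < n)%N -> `]0, n%:R^-1]%classic t -> 0 <= g t.
Proof.
move=> n0; rewrite /= in_itv/= => /andP[t0 tn].
have n1 : n%:R^-1 <= 1 :> R by rewrite invf_le1 ?ltr0n// ler1n.
rewrite /g mulr_ge0// ?divr_ge0// ?(ltW t0)//.
  by apply/ltW/(psi_gt0 Mpsi); rewrite invf_ge1// (le_trans tn).
by apply: (om_ge0 homega); exact: ltW.
Qed.

(** Against the length 1/(j (j+1)) of the block ]1/(j+1), 1/j], the factor j in the
lower bound leaves exactly the term j + 1 of the series, and the factor j + 1 in
the upper bound leaves exactly the term j. *)
Lemma block_bounds n k t : (0 < n)%N -> block n k t ->
  0 <= psi (k + n).+1%:R * (om (k + n).+1%:R^-1 * (k + n)%:R) <= g t /\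
  g t <= psi (k + n)%:R * (om (k + n)%:R^-1 * (k + n).+1%:R).
Proof.
move=> n0; rewrite /block /= in_itv/= => /andP[h1 h2].
have kn0 : (0 < k + n)%N by rewrite addn_gt0 n0 orbT.
move: (k + n)%N kn0 h1 h2 => j j0 h1 h2.
have jR : 0 < j%:R :> R by rewrite ltr0n.
have jv : 0 < j.+1%:R^-1 :> R by rewrite invr_gt0.
have t0 : 0 < t := lt_trans jv h1.
have j1 : 1 <= j%:R :> R by rewrite ler1n.
have tV1 : j%:R <= t^-1 by rewrite -[leLHS]invrK lef_pV2 ?posrE ?invr_gt0.
have tV2 : t^-1 <= j.+1%:R by rewrite -[leRHS]invrK lef_pV2 ?posrE ?invr_gt0// ltW.
have tge1 : 1 <= t^-1 by apply: le_trans tV1.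
have p1 := ltW (psi_gt0 Mpsi (le_trans tge1 tV2)).
have o1 : 0 <= om j.+1%:R^-1 by apply: (om_ge0 homega); exact: ltW.
have ot : om j.+1%:R^-1 <= om t by apply: (om_le homega) => //; exact: ltW.
have tv0 : 0 <= t^-1 by rewrite invr_ge0 ltW.
have t1 : om t <= om j%:R^-1 by apply: (om_le homega) => //; exact: ltW.
have ot0 := le_trans o1 ot.
have q1 : 0 <= psi t^-1 by apply/ltW/(psi_gt0 Mpsi).
split; last first.
  apply: ler_pM; [exact: q1|exact: mulr_ge0|exact: (psi_le Mpsi)|exact: ler_pM].
apply/andP; split; first by rewrite !mulr_ge0.
apply: ler_pM; [exact: p1|exact: mulr_ge0|exact: (psi_le Mpsi)|exact: ler_pM].
Qed.

Lemma sum_shift (G : nat -> R) n N :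
  \sum_(0 <= k < N) G (k + n)%N = \sum_(n <= j < N + n) G j.
Proof. by have := big_addn 0%N (N + n) n xpredT G; rewrite add0n addnK => ->. Qed.

Lemma lead_block_sum_lower n N : (0 < n)%N ->
  \sum_(0 <= k < N) (psi (k + n).+1%:R * (om (k + n).+1%:R^-1 * (k + n)%:R)) *
     ((k + n)%:R^-1 - (k + n).+1%:R^-1) = lead_sum n.+1 (N + n).+1.
Proof.
move=> n0; rewrite /lead_sum big_add1 /= -sum_shift; apply: eq_bigr => k _.
have kn0 : (0 < k + n)%N by rewrite addn_gt0 n0 orbT.
rewrite block_length//; move: (k + n)%N kn0 => j j0; field.
by rewrite nat1r !pnatr_eq0 -?lt0n ?j0.
Qed.

Lemma lead_block_sum_upper n N : (0 < n)%N ->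
  \sum_(0 <= k < N) (psi (k + n)%:R * (om (k + n)%:R^-1 * (k + n).+1%:R)) *
     ((k + n)%:R^-1 - (k + n).+1%:R^-1) = lead_sum n (N + n).
Proof.
move=> n0; rewrite /lead_sum -sum_shift; apply: eq_bigr => k _.
have kn0 : (0 < k + n)%N by rewrite addn_gt0 n0 orbT.
rewrite block_length//; move: (k + n)%N kn0 => j j0; field.
by rewrite nat1r !pnatr_eq0 -?lt0n ?j0.
Qed.

Lemma lead_term_ge0 j : (0 < j)%N -> 0 <= psi j%:R * om j%:R^-1 / j%:R.
Proof.
move=> j0; rewrite divr_ge0// mulr_ge0//.
  by apply/ltW/(psi_gt0 Mpsi); rewrite ler1n.
by apply: (om_ge0 homega); rewrite invr_ge0.
Qed.

Lemma lead_integral_le n B : (0 < n)%N -> (forall N, lead_sum n N <= B) ->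
  (\int[mu]_(t in `]0%R, n%:R^-1%R]) (g t)%:E <= B%:E)%E.
Proof.
move=> n0 hB.
apply: (@integral_le_blocks R _ g (block n) _ (@lead_measurable n n0) _ _ (block_trivI n0)
  (fun k => (k + n)%:R^-1 - (k + n).+1%:R^-1)
  (fun k => psi (k + n)%:R * (om (k + n)%:R^-1 * (k + n).+1%:R))) => //.
- by move=> x /lead_ge0; exact.
- by move=> k; exact: measurable_itv.
- by move=> k; rewrite block_measure.
- exact: block_cover.
- by move=> k x /block_bounds => /(_ n0) [].
- by move=> N; rewrite lead_block_sum_upper.
Qed.

Hypothesis psi_int : (\int[mu]_(t in `[1%R, +oo[) (psi t / t)%:E < +oo)%E.

(** Integral test for the decreasing function psi(t) / t. *)
Lemma psi_sum_bounded : exists B, forall N, \sum_(1 <= j < N) psi j%:R / j%:R <= B.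
Proof.
pose I := (\int[mu]_(t in `[1%R, +oo[) (psi t / t)%:E)%E.
have I0 : (0 <= I)%E.
  apply: integral_ge0 => t /=; rewrite in_itv/= andbT => t1.
  rewrite lee_fin divr_ge0//; last exact: le_trans t1.
  exact/ltW/(psi_gt0 Mpsi).
pose F k : set R := `[k.+1%:R, k.+2%:R[%classic.
have H N : \sum_(0 <= k < N) psi k.+2%:R / k.+2%:R * 1 <= fine I.
  rewrite -lee_fin fineK; last by rewrite ge0_fin_numE.
  apply: (@integral_ge_blocks R _ (fun t => psi t / t) F _ _ _ _ _ (fun=> 1)
    (fun k => psi k.+2%:R / k.+2%:R)) => //.
  - apply: antitone_measurable; first exact: interval_is_interval.
    move=> x y /=; rewrite !in_itv/= !andbT => x1 y1 xy.
    have x0 : 0 < x by apply: lt_le_trans x1.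
    apply: ler_pM; [exact/ltW/(psi_gt0 Mpsi)|by rewrite invr_ge0; apply: le_trans y1|exact: (psi_le Mpsi)|].
    by rewrite lef_pV2 ?posrE//; exact: lt_le_trans xy.
  - move=> t /=; rewrite in_itv/= andbT => t1.
    rewrite divr_ge0//; last exact: le_trans t1.
    exact/ltW/(psi_gt0 Mpsi).
  - by move=> k; exact: measurable_itv.
  - apply/trivIsetP => i j _ _ ij; apply/seteqP; split => // t [].
    rewrite /F /= !in_itv/= => /truncn_def e1 /truncn_def e2.
    by move: ij; rewrite -(eqn_add2r 1) !addn1 -e1 -e2 eqxx.
  - move=> k; rewrite lebesgue_measure_itv/= lte_fin ltr_nat ltnSn.
    by rewrite -EFinD; congr (_%:E); rewrite -(natr1 k.+1); ring.
  - move=> k t; rewrite /F /= !in_itv/= andbT => /andP[h _].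
    by apply: le_trans h; rewrite ler1n.
  - move=> k t; rewrite /F /= in_itv/= => /andP[h1 h2].
    have t1 : 1 <= t by apply: le_trans h1; rewrite ler1n.
    have t0 : 0 < t by apply: lt_le_trans t1.
    have pk : 0 < psi k.+2%:R by apply: (psi_gt0 Mpsi); rewrite ler1n.
    apply/andP; split; first by rewrite divr_ge0// ltW.
    apply: ler_pM => //; [exact: ltW|by apply: (psi_le Mpsi) => //; exact: ltW|].
    by rewrite lef_pV2 ?posrE// ltW.
exists (psi 1 + fine I) => N.
have p1 : 0 <= psi 1 by apply/ltW/(psi_gt0 Mpsi).
have hI : 0 <= fine I by apply: fine_ge0.
case: N => [|[|N]]; [by rewrite big_geq ?addr_ge0..|].
rewrite big_nat_recl//= divr1 lerD2l; apply: le_trans (H N).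
rewrite big_add1 /=; apply: ler_sum => k _; by rewrite mulr1.
Qed.

Lemma lead_sum_bounded n : (0 < n)%N -> exists B, forall N, lead_sum n N <= B.
Proof.
move=> n0; have [B HB] := psi_sum_bounded.
exists (om 1 * B) => N; have o1 : 0 <= om 1 by apply: (om_ge0 homega).
case: (leqP N n) => [Nn|nN].
  rewrite /lead_sum big_geq// mulr_ge0//.
  by have := HB 0%N; rewrite big_geq.
apply: le_trans (ler_wpM2l o1 (HB N)); rewrite mulr_sumr /lead_sum.
rewrite [leRHS](@big_cat_nat _ _ _ n)//=; last exact: ltnW.
have h j : (0 < j)%N -> 0 <= psi j%:R / j%:R.
  by move=> j0; rewrite divr_ge0//; apply/ltW/(psi_gt0 Mpsi); rewrite ler1n.
rewrite -[leLHS]add0r; apply: lerD.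
  rewrite big_nat sumr_ge0// => j /andP[j0 _]; rewrite mulr_ge0//; exact: h.
apply: ler_sum_nat => j /andP[nj _]; have j0 : (0 < j)%N := leq_trans n0 nj.
rewrite mulrAC mulrC ler_wpM2r ?h//; apply: (om_le homega); rewrite ?invr_ge0//.
by rewrite invf_le1 ?ltr0n// ler1n.
Qed.

Lemma lead_fin_num n : (0 < n)%N ->
  (\int[mu]_(t in `]0%R, n%:R^-1%R]) (g t)%:E)%E \is a fin_num.
Proof.
move=> n0; have [B HB] := lead_sum_bounded n0.
rewrite ge0_fin_numE.
  exact: le_lt_trans (lead_integral_le n0 HB) (ltry _).
by apply: integral_ge0 => t /lead_ge0 => /(_ n0); rewrite lee_fin.
Qed.

Lemma lead_integral_upper n B : (0 < n)%N -> (forall N, lead_sum n N <= B) ->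
  lead_integral n <= B.
Proof.
move=> n0 hB; rewrite /lead_integral /Rintegral -lee_fin fineK ?lead_fin_num//.
exact: lead_integral_le.
Qed.

Lemma lead_integral_lower n N : (0 < n)%N -> lead_sum n.+1 N <= lead_integral n.
Proof.
move=> n0.
apply: (@le_trans _ _ (lead_sum n.+1 (N + n).+1)).
  rewrite /lead_sum; case: (leqP N n.+1) => [Nn|nN].
    rewrite big_geq// big_nat sumr_ge0// => j /andP[nj _].
    by apply: lead_term_ge0; exact: leq_trans nj.
  rewrite [leRHS](@big_cat_nat _ _ _ N)//=; [|exact: ltnW|lia].
  rewrite lerDl big_nat sumr_ge0// => j /andP[nj _].
  by apply: lead_term_ge0; lia.
rewrite /lead_integral /Rintegral -lee_fin fineK ?lead_fin_num//.
rewrite -lead_block_sum_lower//.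
apply: (@integral_ge_blocks R _ g (block n) _ (@lead_measurable n n0) _ _ (block_trivI n0)
  (fun k => (k + n)%:R^-1 - (k + n).+1%:R^-1)
  (fun k => psi (k + n).+1%:R * (om (k + n).+1%:R^-1 * (k + n)%:R))) => //.
- by move=> x /lead_ge0; exact.
- by move=> k; exact: measurable_itv.
- by move=> k; rewrite block_measure.
- by move=> k; rewrite block_cover//; exact: bigcup_sup.
- by move=> k x /block_bounds => /(_ n0) [].
Qed.

End LeadingSeries.

(** * The upper bound *)

Section UpperBound.
Variables (R : realType) (psi om : R -> R).
Hypotheses (homega : modulus_of_continuity om) (hconv : convex_upwards om).
Hypotheses (Mpsi : Mset psi).
Implicit Types (n N j k l m : nat) (t x : R) (f phi : R -> R).

Let p k : R := psi k%:R.

Let p_gt0 k : (0 < k)%N -> 0 < p k.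
Proof. by move=> k0; apply: (psi_gt0 Mpsi); rewrite ler1n. Qed.

Lemma psi_seq_ge0 k : (0 < k)%N -> 0 <= p k.
Proof. by move=> k0; exact/ltW/p_gt0. Qed.

Lemma psi_seq_noninc k : (0 < k)%N -> p k.+1 <= p k.
Proof. by move=> k0; apply: (psi_le Mpsi); rewrite ?ler1n ?ler_nat. Qed.

Lemma psi_seq_convex d k : (0 < d)%N -> (0 < k)%N ->
  0 <= diff2 (fun i => psi (d * i)%:R) k.
Proof.
move=> d0 k0; have dR : 0 < d%:R :> R by rewrite ltr0n.
have k1 : 1 <= (d * k)%:R :> R by rewrite ler1n muln_gt0 d0.
have h1 : (d * k)%:R < (d * k.+1)%:R :> R by rewrite ltr_nat ltn_pmul2l.
have h2 : (d * k.+1)%:R < (d * k.+2)%:R :> R by rewrite ltr_nat ltn_pmul2l.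
have := psi_convex3 Mpsi k1 h1 h2; rewrite /diff2.
have e1 : (d * k.+1)%:R = (d * k)%:R + d%:R :> R by rewrite mulnSr natrD.
have e2 : (d * k.+2)%:R = (d * k)%:R + d%:R + d%:R :> R by rewrite !mulnSr !natrD.
rewrite -[X in X <= _]mulrC.
have -> : (d * k.+2)%:R - (d * k)%:R = 2 * d%:R :> R by rewrite e2; ring.
have -> : (d * k.+2)%:R - (d * k.+1)%:R = d%:R :> R by rewrite e2 e1; ring.
have -> : (d * k.+1)%:R - (d * k)%:R = d%:R :> R by rewrite e1; ring.
move: (psi (d * k)%:R) (psi (d * k.+1)%:R) (psi (d * k.+2)%:R) => a b c.
by move=> h; rewrite -(pmulr_rge0 _ dR) mulrDr mulrBr; lra.
Qed.

Lemma psi_seq_convex1 k : (0 < k)%N -> 0 <= diff2 p k.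
Proof.
by move=> k0; have := @psi_seq_convex 1 k isT k0; rewrite /diff2 !mul1n.
Qed.

(** Comparison of the series with omega(2/j) and the one with omega(1/j): the
terms 2i and 2i + 1 of the former are together at most the term i of the
latter. *)
Lemma double_sum_le n N : (0 < n <= N)%N ->
  \sum_(n <= j < N) om (2 * j%:R^-1) / j%:R * p j <=
  lead_sum psi om n N + 2 * (p n * om n%:R^-1).
Proof.
move=> /andP[n0 nN]; pose G j := om (2 * j%:R^-1) / j%:R * p j.
have nR : 0 < n%:R :> R by rewrite ltr0n.
have G0 j : (0 < j)%N -> 0 <= G j.
  move=> j0; rewrite mulr_ge0 ?psi_seq_ge0// divr_ge0//.
  by apply: (om_ge0 homega); rewrite mulr_ge0// invr_ge0.
apply: (@le_trans _ _ (\sum_(n <= j < 2 * N) G j)).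
  rewrite [leRHS](@big_cat_nat _ _ _ N)//=; last by rewrite leq_pmull.
  by rewrite lerDl big_nat sumr_ge0// => j /andP[Nj _]; apply: G0; lia.
rewrite (@big_cat_nat _ _ _ (2 * n))//=; [|by rewrite leq_pmull|by rewrite leq_pmul2l].
rewrite addrC; apply: lerD; last first.
  apply: (@le_trans _ _ (\sum_(n <= j < 2 * n) 2 * om n%:R^-1 / n%:R * p n)).
    apply: ler_sum_nat => j /andP[nj _]; have j0 : (0 < j)%N := leq_trans n0 nj.
    have jn : j%:R^-1 <= n%:R^-1 :> R by apply: inv_nat_le; rewrite n0.
    apply: ler_pM; rewrite ?psi_seq_ge0//.
    - rewrite divr_ge0//; apply: (om_ge0 homega); by rewrite mulr_ge0// invr_ge0.
    - apply: ler_pM; rewrite ?invr_ge0//.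
        by apply: (om_ge0 homega); rewrite mulr_ge0// invr_ge0.
      apply: le_trans (om_muln homega 2 _); last by rewrite invr_ge0.
      by apply: (om_le homega); rewrite ?ler_wpM2l// mulr_ge0// invr_ge0.
    - by apply: (psi_le Mpsi); rewrite ?ler1n ?ler_nat.
  rewrite sumr_const_nat (_ : (2 * n - n = n)%N); last lia.
  by rewrite -mulr_natr le_eqVlt; apply/orP; left; apply/eqP; field; rewrite gt_eqF.
rewrite /lead_sum; elim: N nN => [|N IH].
  by move=> _; rewrite !big_geq// muln0.
rewrite leq_eqVlt => /predU1P[<-|nN]; first by rewrite !big_geq.
have N0 : (0 < N)%N by rewrite (leq_trans n0).
have NR : 0 < N%:R :> R by rewrite ltr0n.
rewrite (_ : (2 * N.+1 = (2 * N).+2)%N); last lia.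
rewrite big_nat_recr; last by rewrite /= (leq_trans _ (leqnSn _))// leq_pmul2l.
rewrite big_nat_recr /=; last by rewrite leq_pmul2l.
rewrite big_nat_recr//= -addrA; apply: lerD; first exact: IH.
have o0 : 0 <= om N%:R^-1 by apply: (om_ge0 homega); rewrite invr_ge0.
have h j : (2 * N <= j)%N -> G j <= om N%:R^-1 * (p N / (2 * N%:R)).
  move=> Nj; have j0 : (0 < j)%N by lia.
  have jR : 0 < j%:R :> R by rewrite ltr0n.
  have NjR : 2 * N%:R <= j%:R :> R by rewrite -(natrM R 2 N) ler_nat.
  rewrite /G -mulrA; apply: ler_pM.
  - by apply: (om_ge0 homega); rewrite mulr_ge0// invr_ge0.
  - by rewrite mulr_ge0 ?psi_seq_ge0// invr_ge0.
  - apply: (om_le homega); first by rewrite mulr_ge0// invr_ge0.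
    by rewrite ler_pdivrMr// mulrC ler_pdivlMr.
  - rewrite mulrC; apply: ler_pM; rewrite ?psi_seq_ge0 ?invr_ge0//.
      by apply: (psi_le Mpsi); rewrite ?ler1n ?ler_nat//; lia.
    by rewrite lef_pV2 ?posrE// mulr_gt0.
apply: le_trans (lerD (h _ (leqnn _)) (h _ (leqnSn _))) _.
by rewrite /p le_eqVlt; apply/orP; left; apply/eqP; field; rewrite gt_eqF.
Qed.

(** The definition of the derivative, read at x - g / k. *)
Lemma psi_beta_harmonic beta f phi k x : psi_beta_derivative psi beta f phi ->
  (0 < k)%N -> shifted_harmonic 0 f k x = p k * shifted_harmonic (beta * pi / 2) phi k x.
Proof.
move=> [_ _ _ hk] k0; set g := beta * pi / 2.
have kR : k%:R != 0 :> R by rewrite pnatr_eq0 -lt0n.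
have := hk k (x - g / k%:R) k0; case: k k0 kR => // k _ kR /=.
have -> : k.+1%:R * (x - g / k.+1%:R) = k.+1%:R * x - g.
  by rewrite mulrBr mulrCA mulfV// mulr1.
rewrite /shifted_harmonic => ->; rewrite -/g subrK subr0 mulrA mulfV ?mul1r//.
by rewrite gt_eqF// p_gt0.
Qed.

Lemma harmonic_trig g phi k x : shifted_harmonic g phi k x =
  (fourier_cos phi k * cos g - fourier_sin phi k * sin g) * cos (k%:R * x) +
  (fourier_cos phi k * sin g + fourier_sin phi k * cos g) * sin (k%:R * x).
Proof. by rewrite /shifted_harmonic cosB sinB; ring. Qed.

Hypothesis psi_int :
  (\int[@lebesgue_measure R]_(t in `[1%R, +oo[) (psi t / t)%:E < +oo)%E.
Hypothesis homega_lim : right_derivative om n%:R^-1 / (om n%:R^-1 * n%:R)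
  @[n --> \oo] --> (0 : R).
Hypothesis hpsi_lim :
  `|right_derivative psi n%:R| * n%:R / psi n%:R @[n --> \oo] --> (0 : R).

(** The N-th Fejer mean of f has coefficients th k = (1 - k/(N+1)) psi(k) on the
harmonics of its derivative phi. Summing by parts twice from n on and
subtracting throughout the Cesaro mean of order n - 1 gives a polynomial of
order n - 1 plus a combination, with nonnegative weights, of the differences
estimated in [mean_difference]. Exchanging the sums turns their main parts
into the leading series. No constant depends on N. *)
Lemma fejer_mean_approx : exists2 K : R, 0 <= K &
  forall beta f n N, Cclass psi beta om f -> (0 < n <= N)%N ->
  exists2 T, trig_poly n.-1 T & forall x,
    `|fejer_mean f N x - T x| <=
      pi^-1 * `|sin (beta * pi / 2)| * lead_integral psi om n +
      K * (psi n%:R * om n%:R^-1).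
Proof.
have [C C0 hC] := om_sum_le homega hconv homega_lim.
have [C' C'0 hmean] := mean_difference homega C0 hC.
have [D D0 hD] := psi_diff_le Mpsi hpsi_lim.
exists (5 + C' * (2 + D)).
  by rewrite addr_ge0// mulr_ge0// addr_ge0// ltW.
move=> beta f [//|l] N [[pf cf] [phi dphi Hphi]] /andP[_ lN] /=.
set g := beta * pi / 2.
have pi0 := pi_gt0 R; have pi2 := pi_ge2 R.
pose th := damped p N.
have th0 k : (N < k)%N -> th k = 0 by exact: damped_eq0.
have th_ge0 k : (0 < k)%N -> 0 <= th k.
  by move=> k0; apply: damped_ge0 => //; exact: psi_seq_ge0.
have th_ni k : (0 < k)%N -> th k.+1 <= th k.
  move=> k0; apply: damped_noninc => //; [exact: psi_seq_ge0|exact: psi_seq_noninc].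
have th_le k : (0 < k)%N -> th k <= p k.
  by move=> k0; apply: damped_le => //; exact: psi_seq_ge0.
have th_cv k : (0 < k)%N -> 0 <= diff2 th k.
  move=> k0; apply: damped_convex => //;
    [exact: psi_seq_ge0|exact: psi_seq_noninc|exact: psi_seq_convex1].
pose B x k := shifted_harmonic g phi k x.
pose W := \sum_(l.+1 <= m < N.+1) m.+1%:R * diff2 th m.
pose d k := W * fejer_weight R l k +
  (th k - \sum_(l.+1 <= m < N.+1) diff2 th m * (m.+1%:R - k%:R)).
(* The first part of d restores the multiple of the mean of order l that is subtracted
   from all the others; the rest is what [abel_twice] leaves below n. *)
pose T x := fourier_cos f 0 / 2 + \sum_(1 <= k < l.+1) d k * B x k.
have meanE x : fejer_mean f N x =
    fourier_cos f 0 / 2 + \sum_(1 <= k < N.+1) th k * B x k.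
  rewrite /fejer_mean /fejer_sum; congr (_ + _); rewrite big_nat [RHS]big_nat.
  apply: eq_bigr => k /andP[k0 kN]; rewrite (psi_beta_harmonic _ dphi)//.
  by rewrite mulrA /th dampedE.
exists T.
  exists (fun k => if k is 0 then fourier_cos f 0
     else d k * (fourier_cos phi k * cos g - fourier_sin phi k * sin g)).
  exists (fun k => d k * (fourier_cos phi k * sin g + fourier_sin phi k * cos g)).
  move=> x; rewrite /T; congr (_ + _); rewrite big_nat [RHS]big_nat.
  by apply: eq_bigr => -[//|k] _; rewrite /B harmonic_trig; ring.
move=> x.
have diffE : fejer_mean f N x - T x =
    \sum_(l.+1 <= m < N.+1) m.+1%:R * diff2 th m *
      (fejer_sum g phi m x - fejer_sum g phi l x).
  have lN' : (0 < l.+1 <= N.+1)%N by rewrite /= ltnS ltnW.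
  rewrite meanE (abel_twice th0 (B x) lN') /T.
  have -> : \sum_(1 <= k < l.+1) d k * B x k = W * fejer_sum g phi l x +
      \sum_(1 <= k < l.+1)
        (th k - \sum_(l.+1 <= m < N.+1) diff2 th m * (m.+1%:R - k%:R)) * B x k.
    rewrite /fejer_sum mulr_sumr -big_split /=; apply: eq_bigr => k _.
    by rewrite /d mulrDl mulrA.
  under [in RHS]eq_bigr do rewrite mulrBr.
  by rewrite sumrB -[in RHS]mulr_suml -/W /cesaro_mean /fejer_sum /B; ring.
rewrite diffE; apply: le_trans (ler_norm_sum _ _ _) _.
set q := pi^-1 * `|sin g|; set w := om l.+1%:R^-1.
have q0 : 0 <= q by rewrite mulr_ge0// invr_ge0 ltW.
have q1 : q <= 1.
  rewrite /q mulr_ile1 ?invr_ge0 ?(ltW pi0) ?sin_max// invf_le1//; lra.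
have w0 : 0 <= w by apply: (om_ge0 homega).
have pl0 : 0 <= p l.+1 by exact: psi_seq_ge0.
pose G j := om (2 * j%:R^-1) / j%:R.
have G0 j : 0 <= G j.
  by rewrite divr_ge0//; apply: (om_ge0 homega); rewrite mulr_ge0// invr_ge0.
apply: (@le_trans _ _ (\sum_(l.+1 <= m < N.+1) m.+1%:R * diff2 th m *
    (q * (\sum_(l.+1 <= j < m.+1) G j) + C' * w))).
  apply: ler_sum_nat => m /andP[lm mN].
  have m0 : (0 < m)%N by apply: leq_trans lm.
  have wm : 0 <= m.+1%:R * diff2 th m by rewrite mulr_ge0// th_cv.
  rewrite normrM (ger0_norm wm) ler_wpM2l//.
  by apply: hmean => //; exact: ltnW.
under eq_bigr do rewrite mulrDr mulrCA.
rewrite big_split /= -mulr_sumr -mulr_suml -/W sum_triangle.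
have lN1 : (l.+1 <= N.+1)%N by exact: ltnW.
have WE : W = th l.+1 + l.+1%:R * (th l.+1 - th l.+2).
  exact: (finite_sum_diff2_mulS th0 lN1).
have W_le : W <= (2 + D) * p l.+1.
  rewrite WE.
  have h1 := th_le l.+1 isT.
  have h2 : l.+1%:R * (th l.+1 - th l.+2) <=
      l.+1%:R * (p l.+1 - p l.+2) + p l.+1.
    by apply: damped_diff_le; [exact: psi_seq_ge0|exact: psi_seq_noninc|].
  have h3 := hD l.+1 isT.
  by rewrite /p in h1 h2 *; lra.
have S_le : \sum_(l.+1 <= j < N.+1) G j * (\sum_(j <= m < N.+1) m.+1%:R * diff2 th m)
    <= lead_integral psi om l.+1 + 5 * (p l.+1 * w).
  apply: (@le_trans _ _ (\sum_(l.+1 <= j < N.+1)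
      (G j * p j + om (2 * l.+1%:R^-1) * (th j - th j.+1)))).
    apply: ler_sum_nat => j /andP[lj jN].
    have j0 : (0 < j)%N by apply: leq_trans lj.
    rewrite (finite_sum_diff2_mulS th0 (ltnW jN)) mulrDr; apply: lerD.
      by rewrite ler_wpM2l ?G0// th_le.
    rewrite mulrA ler_wpM2r ?subr_ge0 ?th_ni// /G divfK; last first.
      by rewrite pnatr_eq0 -lt0n.
    apply: (om_le homega); first by rewrite mulr_ge0// invr_ge0.
    by rewrite ler_wpM2l// inv_nat_le.
  rewrite big_split /= -mulr_sumr.
  have lN' : (0 < l.+1 <= N.+1)%N by rewrite /= ltnS ltnW.
  have h1 := double_sum_le lN'.
  have -> : \sum_(l.+1 <= j < N.+1) (th j - th j.+1) = th l.+1.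
    rewrite (telescope_sumr_eq (fun j => - th j))//; last by move=> j _; ring.
    by rewrite (th0 N.+1)//; ring.
  have h2 : om (2 * l.+1%:R^-1) * th l.+1 <= 2 * w * p l.+1.
    apply: ler_pM; rewrite ?th_ge0 ?th_le//.
      by apply: (om_ge0 homega); rewrite mulr_ge0// invr_ge0.
    by apply: (om_muln homega 2); rewrite invr_ge0.
  have h3 : lead_sum psi om l.+1 N.+1 <= p l.+1 * w + lead_integral psi om l.+1.
    rewrite /lead_sum big_ltn; last by rewrite ltnS.
    apply: lerD; last exact: (lead_integral_lower homega Mpsi psi_int).
    rewrite -/(p _) -/w ler_piMr ?mulr_ge0// invf_le1 ?ler1n ?ltr0n//.
  by rewrite /G; rewrite -/w in h1; lra.
rewrite -/(p l.+1) -/w.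
have pw0 : 0 <= p l.+1 * w by rewrite mulr_ge0.
have h4 := ler_wpM2l q0 S_le.
have h5 : q * (5 * (p l.+1 * w)) <= 1 * (5 * (p l.+1 * w)).
  by rewrite ler_wpM2r// mulr_ge0.
have h6 : W * (C' * w) <= (2 + D) * p l.+1 * (C' * w).
  by rewrite ler_wpM2r// mulr_ge0.
lra.
Qed.

(** By Fejer's theorem the Fejer means of f can replace f. *)
Lemma class_approx_upper : exists2 K : R, 0 <= K & forall beta n, (0 < n)%N ->
  (class_approx n (Cclass psi beta om) <=
    (pi^-1 * `|sin (beta * pi / 2)| * lead_integral psi om n +
      K * (psi n%:R * om n%:R^-1))%:E)%E.
Proof.
have [K K0 hK] := fejer_mean_approx; exists K => // beta n n0.
set M := _ + _.
apply: ge_ereal_sup => _ [f Cf <-].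
apply/lee_addgt0Pr => e e0; rewrite -EFinD.
have [[pf cf] _] := Cf.
have [N0 HN0] := fejer_theorem cf pf e0.
have nN : (0 < n <= maxn n N0)%N by rewrite n0 leq_maxl.
have [T Tp hT] := hK beta f n (maxn n N0) Cf nN.
apply: (@le_trans _ _ (uniform_norm (fun x => f x - T x))).
  by apply: ereal_inf_lbound; exists T.
apply: ge_ereal_sup => _ [x _ <-]; rewrite lee_fin.
have := HN0 (maxn n N0) (leq_maxr _ _) x; have := hT x; rewrite -/M.
set F := fejer_mean _ _ _ => h1 h2.
have -> : f x - T x = (F - T x) - (F - f x) by ring.
by apply: le_trans (ler_normB _ _) _; lra.
Qed.

End UpperBound.

(** * Alternating sums of trigonometric polynomials *)

Section TrigonometricPolynomials.
Variable R : realType.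
Implicit Types (j k l m n N M : nat) (x y c d : R).

Lemma intg_sin_mul k : intg (- pi) pi (fun t : R => sin (k%:R * t)) = 0.
Proof.
rewrite intg_sym; last by cts.
rewrite -[RHS](mul0r (pi - 0)) -intg_cst ?pi_ge0//.
by apply: eq_intg => t _; rewrite mulrN sinN subrr.
Qed.

Lemma intg_cos_shift k c : (0 < k)%N ->
  intg (- pi) pi (fun t : R => cos (k%:R * t + c)) = 0.
Proof.
move=> k0.
have -> : intg (- pi) pi (fun t : R => cos (k%:R * t + c)) =
    intg (- pi) pi (fun t => cos c * cos (k%:R * t) - sin c * sin (k%:R * t)).
  by apply: eq_intg => t _; rewrite cosD; ring.
rewrite intgB; [|by cts..].
by rewrite !intgZ; [rewrite intg_cos_mul// intg_sin_mul !mulr0 subrr|cts..].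
Qed.

(** Orthogonality, for harmonics of arbitrary phases. *)
Lemma intg_cos_cos j k y d : (0 < j)%N ->
  intg (- pi) pi (fun t : R => cos (j%:R * t - d) * cos (k%:R * t - y)) =
  if k == j then pi * cos (y - d) else 0.
Proof.
move=> j0; have pi0 := pi_gt0 R.
have prod (a b : R) : cos a * cos b = 1 / 2 * cos (a + b) + 1 / 2 * cos (b - a).
  by rewrite cosD cosB; field.
have -> : intg (- pi) pi (fun t : R => cos (j%:R * t - d) * cos (k%:R * t - y)) =
    intg (- pi) pi (fun t => 1 / 2 * cos ((j + k)%N%:R * t + (- d - y)) +
       1 / 2 * cos (k%:R * t - y - (j%:R * t - d))).
  apply: eq_intg => t _; rewrite prod natrD; congr (_ * cos _ + _); ring.
rewrite intgD; [|by cts..].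
rewrite !intgZ; [|by cts..].
rewrite intg_cos_shift ?addn_gt0 ?j0// mulr0 add0r.
have [->|kj] := eqVneq k j.
  rewrite (@eq_intg _ _ _ _ (fun=> cos (y - d))); last first.
    move=> t _; rewrite -[in RHS]cosN; congr cos; ring.
  by rewrite intg_cst; [field|lra].
case: (ltngtP k j) kj => // kj _.
  rewrite (@eq_intg _ _ _ _ (fun t => cos ((j - k)%N%:R * t + (y - d)))); last first.
    by move=> t _; rewrite -cosN natrB 1?ltnW//; congr cos; ring.
  by rewrite intg_cos_shift ?mulr0// subn_gt0.
rewrite (@eq_intg _ _ _ _ (fun t => cos ((k - j)%N%:R * t + (d - y)))); last first.
  by move=> t _; rewrite natrB 1?ltnW//; congr cos; ring.
by rewrite intg_cos_shift ?mulr0// subn_gt0.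
Qed.

(** The common phase d of the harmonics and the free angle y let it serve both a
function and its (psi, beta)-derivative. *)
Lemma fourier_term_polynomial M (a : nat -> R) (fr : nat -> nat) d k y :
  (forall i, (0 < i)%N -> (0 < fr i)%N) ->
  let P x := \sum_(1 <= i < M) a i * cos ((fr i)%:R * x - d) in
  fourier_cos P k * cos y + fourier_sin P k * sin y =
  \sum_(1 <= i < M) a i * (if k == fr i then cos (y - d) else 0).
Proof.
move=> fr0 P; have cP : continuous P by rewrite /P; cts.
rewrite /fourier_cos /fourier_sin -/(intg _ _ _) -/(intg _ _ _) -!mulrA -mulrDr.
rewrite ![intg _ _ _ * _]mulrC -!intgZ -?intgD; [|by cts..].
rewrite (@eq_intg _ _ _ _ (fun t =>
   \sum_(1 <= i < M) a i * (cos ((fr i)%:R * t - d) * cos (k%:R * t - y)))); last first.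
  move=> t _.
  have -> : cos y * (P t * cos (k%:R * t)) + sin y * (P t * sin (k%:R * t)) =
      P t * cos (k%:R * t - y) by rewrite (cosB (k%:R * t)); ring.
  by rewrite /P mulr_suml; apply: eq_bigr => i _; rewrite mulrA.
rewrite intg_sum; last by move=> i; cts.
rewrite mulr_sumr big_nat [RHS]big_nat; apply: eq_bigr => i /andP[i0 _].
rewrite intgZ; last by cts.
rewrite intg_cos_cos ?fr0//; case: ifP => _; last by rewrite !mulr0.
by rewrite mulrCA mulKf// gt_eqF// pi_gt0.
Qed.

Lemma sum_cos_arith M (th c : R) : sin (th / 2) != 0 ->
  (forall x, sin (x + M%:R * th) = sin x) ->
  \sum_(0 <= l < M) cos (l%:R * th + c) = 0.
Proof.
move=> s0 hper; apply: (@mulfI _ (2 * sin (th / 2))).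
  by rewrite mulf_neq0.
rewrite mulr0 mulr_sumr.
rewrite (telescope_sumr_eq (fun l => sin (l%:R * th - th / 2 + c)))//; last first.
  move=> l _; rewrite -(natr1 l).
  have -> : (l%:R + 1) * th - th / 2 + c = (l%:R * th + c) + th / 2 by field.
  have -> : l%:R * th - th / 2 + c = (l%:R * th + c) - th / 2 by ring.
  by rewrite sinB sinD; ring.
rewrite mul0r; have -> : M%:R * th - th / 2 + c = 0 - th / 2 + c + M%:R * th by ring.
by rewrite hper subrr.
Qed.

(** The alternating mean over the points pi l / n annihilates the harmonics of
order less than n: alternating signs shift the frequency k to k + n, which is
not a multiple of 2 n. *)
Lemma alternating_sum_cos n k c : (k < n)%N ->
  \sum_(0 <= l < 2 * n) (-1) ^+ l * cos (k%:R * (l%:R * (pi / n%:R)) + c) = 0 :> R.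
Proof.
move=> kn; have n0 : (0 < n)%N by apply: leq_ltn_trans kn.
have nR : 0 < n%:R :> R by rewrite ltr0n.
have pi0 := pi_gt0 R.
pose th : R := pi + k%:R * (pi / n%:R).
rewrite (eq_bigr (fun l => cos (l%:R * th + c))); last first.
  move=> l _; have -> : l%:R * th + c = k%:R * (l%:R * (pi / n%:R)) + c + pi *+ l.
    by rewrite /th -mulr_natl; ring.
  by rewrite (alternatingn (@cosDpi R)).
apply: sum_cos_arith.
  have k0 : 0 <= k%:R * (pi / n%:R) :> R by rewrite mulr_ge0// divr_ge0// ltW.
  have k1 : k%:R * (pi / n%:R) < pi :> R.
    by rewrite mulrA ltr_pdivrMr// mulrC ltr_pM2l// ltr_nat.
  by rewrite gt_eqF//; apply: sin_gt0_pi; rewrite /th; apply/andP; split; lra.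
move=> x; have -> : (2 * n)%:R * th = pi *+ 2 *+ (n + k).
  have e : k%:R * (pi / n%:R) * n%:R = k%:R * pi :> R by rewrite -mulrA divfK// gt_eqF.
  rewrite natrM mulrDr /th -[pi *+ 2 *+ _]mulr_natl -[pi *+ 2]mulr_natl natrD.
  have -> : 2 * n%:R * (k%:R * (pi / n%:R)) = 2 * (k%:R * pi) :> R.
    by rewrite -e; ring.
  by ring.
exact: (periodicn (@sinD2pi R)).
Qed.

Lemma alternating_sum_trig_poly n T : (0 < n)%N -> trig_poly n.-1 T ->
  \sum_(0 <= l < 2 * n) (-1) ^+ l * T (l%:R * (pi / n%:R)) = 0 :> R.
Proof.
move=> n0 [a [b hT]]; rewrite prednK// in hT.
pose xl (l : nat) : R := l%:R * (pi / n%:R).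
under eq_bigr do rewrite hT mulrDr.
rewrite big_split /= -[RHS]addr0; congr (_ + _).
  rewrite -mulr_suml -[RHS](mul0r (a 0%N / 2)); congr (_ * _).
  rewrite -[RHS](@alternating_sum_cos n 0 0 n0); apply: eq_bigr => l _.
  by rewrite mul0r addr0 cos0 mulr1.
under eq_bigr do rewrite mulr_sumr.
rewrite exchange_big /= big_nat big1// => k /andP[k0 kn].
have -> : \sum_(0 <= l < 2 * n) (-1) ^+ l *
    (a k * cos (k%:R * xl l) + b k * sin (k%:R * xl l)) =
  a k * (\sum_(0 <= l < 2 * n) (-1) ^+ l * cos (k%:R * xl l + 0)) +
  b k * (\sum_(0 <= l < 2 * n) (-1) ^+ l * cos (k%:R * xl l + (- (pi / 2)))).
  rewrite !mulr_sumr -big_split /=; apply: eq_bigr => l _.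
  by rewrite addr0 cosBpihalf; ring.
by rewrite !alternating_sum_cos// !mulr0 addr0.
Qed.

(** The alternating mean of f - T over the 2n points pi l / n is f 0, as that of T
vanishes; so the error at one of these points is at least |f 0|. *)
Lemma best_approx_alternating n f : (0 < n)%N ->
  (forall x, f (x + pi / n%:R) = - f x) -> (`|f 0|%:E <= best_approx n f)%E.
Proof.
move=> n0 hf; apply: le_ereal_inf_tmp => _ [T Tp <-].
have nR : 0 < n%:R :> R by rewrite ltr0n.
pose xl (l : nat) : R := l%:R * (pi / n%:R).
have fxl l : f (xl l) = (-1) ^+ l * f 0.
  elim: l => [|l IH]; first by rewrite /xl mul0r mul1r.
  by rewrite /xl -natr1 mulrDl mul1r hf -/(xl l) IH exprS; ring.
have [l hl] : exists l, `|f 0| <= `|f (xl l) - T (xl l)|.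
  apply: contrapT => /forallNP H.
  have Hl l : `|f (xl l) - T (xl l)| < `|f 0| by rewrite ltNge; exact/negP/H.
  have S : \sum_(0 <= l < 2 * n) (-1) ^+ l * (f (xl l) - T (xl l)) = (2 * n)%:R * f 0.
    under eq_bigr do rewrite mulrBr fxl mulrA -expr2 sqrr_sign mul1r.
    by rewrite sumrB alternating_sum_trig_poly// subr0 sumr_const_nat subn0 mulr_natl.
  have : `|(2 * n)%:R * f 0| < (2 * n)%:R * `|f 0|.
    rewrite -S; apply: le_lt_trans (ler_norm_sum _ _ _) _.
    have -> : (2 * n)%:R * `|f 0| = \sum_(0 <= l < 2 * n) `|f 0|.
      by rewrite sumr_const_nat subn0 mulr_natl.
    apply: ltr_sum_nat; first by rewrite muln_gt0.
    by move=> l _; rewrite normrM normr_sign mul1r.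
  by rewrite normrM normr_nat ltxx.
apply: (@le_trans _ _ `|f (xl l) - T (xl l)|%:E); first by rewrite lee_fin.
by apply: ereal_sup_ubound; exists (xl l).
Qed.

End TrigonometricPolynomials.

(** * The extremal functions *)

Section ExtremalFunction.
Variables (R : realType) (om : R -> R).
Hypotheses (homega : modulus_of_continuity om) (hconv : convex_upwards om).
Implicit Types (j k l m n N M : nat) (s t u v x y : R).

Lemma within_continuous_max (f : R -> R) a :
  {within `[a, +oo[, continuous f} -> continuous (fun x => f (Num.max x a)).
Proof.
move=> /continuous_within_itvcyP[cf ca] x.
have [ax|xa|ax] := ltgtP a x.
- have fE : \forall y \near x, f y = f (Num.max y a).
    near=> y; rewrite max_l//; apply: ltW; near: y; exact: lt_nbhsr.
  rewrite /continuous_at max_l ?(ltW ax)//.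
  apply: cvg_trans (cf x _); last by rewrite in_itv/= ax.
  exact: near_eq_cvg.
- have fE : \forall y \near x, f a = f (Num.max y a).
    near=> y; rewrite max_r//; apply: ltW; near: y; exact: lt_nbhsl.
  rewrite /continuous_at max_r ?(ltW xa)//.
  have : (fun=> f a) y @[y --> x] --> f a by exact: cvg_cst.
  by apply: cvg_trans; exact: near_eq_cvg.
- rewrite /continuous_at -ax maxxx; apply/cvgrPdist_le => e e0.
  have /cvgrPdist_le/(_ _ e0) := ca.
  rewrite near_withinE => -[d /= d0 hd]; exists d => //= y ay.
  have [ya|ya] := leP y a; first by rewrite subrr normr0 ltW.
  exact: hd.
Unshelve. all: by end_near. Qed.

(** Odd extension of omega(2u)/2, in a visibly continuous form: one of the two
terms is always omega 0 = 0. *)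
Definition half_omega u : R :=
  (om (Num.max (2 * u) 0) - om (Num.max (- (2 * u)) 0)) / 2.

Lemma half_omega_ct : continuous half_omega.
Proof.
have com : continuous (fun x => om (Num.max x 0)).
  by apply: within_continuous_max; case: homega.
rewrite /half_omega; apply: ctM; last exact: ct_cst.
have c1 : continuous (fun u : R => 2 * u) by cts.
have c2 : continuous (fun u : R => - (2 * u)) by cts.
by apply: ctD; [exact: (ct_comp com c1)|apply: ctN; exact: (ct_comp com c2)].
Qed.

Lemma half_omegaN u : half_omega (- u) = - half_omega u.
Proof. by rewrite /half_omega mulrN opprK -[RHS]mulNr opprB. Qed.

Lemma half_omega_pos u : 0 <= u -> half_omega u = om (2 * u) / 2.
Proof.
move=> u0; rewrite /half_omega max_l ?mulr_ge0// max_r ?oppr_le0 ?mulr_ge0//.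
by rewrite (om0 homega) subr0.
Qed.

(** Concavity makes the jump across 0 no larger than omega of the distance. *)
Lemma half_omega_modulus u v : `|half_omega u - half_omega v| <= om `|u - v|.
Proof.
wlog uv : u v / v <= u.
  by move=> H; case: (leP v u) => [/H//|/ltW/H]; rewrite distrC (distrC u).
wlog u0 : u v uv / 0 <= u.
  move=> H; case: (leP 0 u) => [u0|u0]; first exact: H.
  have := H (- v) (- u); rewrite !half_omegaN lerN2 => /(_ uv).
  have e (c d : R) : - c - - d = d - c by ring.
  by rewrite !e; apply; rewrite oppr_ge0; exact: le_trans uv (ltW u0).
rewrite [`|u - v|]ger0_norm ?subr_ge0// (half_omega_pos u0).
have [v0|v0] := leP 0 v.
  rewrite half_omega_pos// -mulrBl normrM (ger0_norm (_ : 0 <= 2^-1))//.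
  rewrite ler_pdivrMr//.
  have v20 : 0 <= 2 * v by rewrite mulr_ge0.
  have uv0 : 0 <= u - v by rewrite subr_ge0.
  rewrite ger0_norm ?subr_ge0 ?(om_le homega) ?ler_wpM2l//.
  have h1 : om (2 * u) <= om (2 * v) + om (2 * (u - v)).
    have -> : 2 * u = 2 * v + 2 * (u - v) by ring.
    by apply: (om_subadd homega) => //; rewrite mulr_ge0.
  by have := om_muln homega 2 uv0; lra.
have nv0 : 0 <= - v by rewrite oppr_ge0 ltW.
have -> : half_omega v = - (om (2 * - v) / 2).
  by rewrite -[v in LHS]opprK half_omegaN half_omega_pos.
have := om_midpoint hconv u0 nv0.
have o1 : 0 <= om (2 * u) by apply: (om_ge0 homega); rewrite mulr_ge0.
have o2 : 0 <= om (2 * - v) by apply: (om_ge0 homega); rewrite mulr_ge0.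
by rewrite opprK ger0_norm; lra.
Qed.

Variable n : nat.
(** The sine in place of a triangular wave: it is 1-Lipschitz, and on [0, 1] it
is at least half its argument, which the factor 2 in omega(2u) absorbs. *)
Definition extremal s : R := half_omega (sin s / n%:R).

Lemma extremal_ct : continuous extremal.
Proof.
apply: (@ct_comp R half_omega); first exact: half_omega_ct.
by cts.
Qed.
Hint Resolve extremal_ct : core.

Lemma extremal_periodic : periodic extremal (2 * pi).
Proof. by move=> s; rewrite /extremal mulr_natl sinD2pi. Qed.

Lemma extremalN s : extremal (- s) = - extremal s.
Proof. by rewrite /extremal sinN mulNr half_omegaN. Qed.

Lemma extremalDpi s : extremal (s + pi) = - extremal s.
Proof. by rewrite /extremal sinDpi mulNr half_omegaN. Qed.

Lemma extremal_modulus s t : `|extremal s - extremal t| <= om (`|s - t| / n%:R).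
Proof.
apply: le_trans (half_omega_modulus _ _) _; apply: (om_le homega) => //.
rewrite -mulrBl normrM (ger0_norm (_ : 0 <= n%:R^-1)) ?invr_ge0//.
by rewrite ler_wpM2r ?invr_ge0// sin_lipschitz.
Qed.

Lemma extremal_bound s : `|extremal s| <= om n%:R^-1.
Proof.
have h : extremal s = extremal s - half_omega 0.
  by rewrite half_omega_pos// mulr0 (om0 homega) mul0r subr0.
rewrite h; apply: le_trans (half_omega_modulus _ _) _.
apply: (om_le homega) => //; rewrite subr0 normrM (ger0_norm (_ : 0 <= n%:R^-1)) ?invr_ge0//.
by rewrite ler_piMl ?invr_ge0// sin_max.
Qed.

Lemma extremal_lower s : 0 <= s <= 1 -> om (s / n%:R) / 2 <= extremal s.
Proof.
move=> s01; have /andP[s0 s1] := s01; have hs := sin_ge_half s01.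
have sp : 0 <= sin s by apply: le_trans hs; rewrite divr_ge0.
rewrite /extremal half_omega_pos; last by rewrite divr_ge0.
rewrite ler_wpM2r ?invr_ge0//; apply: (om_le homega); first by rewrite divr_ge0.
by rewrite mulrA ler_wpM2r ?invr_ge0//; lra.
Qed.

Lemma extremal_cos_coef k : fourier_cos extremal k = 0.
Proof.
rewrite /fourier_cos -/(intg _ _ _) intg_sym; last by cts.
rewrite (@eq_intg _ _ _ _ (fun=> 0)); last first.
  by move=> t _; rewrite extremalN mulrN cosN mulNr subrr.
by rewrite intg_cst ?pi_ge0// mul0r mulr0.
Qed.

Lemma extremal_sin_coef_even k : ~~ odd k -> fourier_sin extremal k = 0.
Proof.
move=> ek; rewrite /fourier_sin -/(intg _ _ _).
set I := intg _ _ _; suff : I = - I by move=> h; rewrite (_ : I = 0) ?mulr0//; lra.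
rewrite {1}/I -(@intg_period_shift R pi); last 2 first.
- by cts.
- move=> t; rewrite extremal_periodic; congr (_ * _).
  have -> : k%:R * (t + 2 * pi) = k%:R * t + pi *+ 2 *+ k.
    by rewrite -mulr_natl -[pi *+ 2]mulr_natl; ring.
  by rewrite (periodicn (@sinD2pi R)).
rewrite /I -intgN; last by cts.
apply: eq_intg => t _; rewrite extremalDpi mulNr; congr (- (_ * _)).
have -> : k%:R * (t + pi) = k%:R * t + pi *+ k by rewrite -mulr_natl; ring.
by rewrite (alternatingn (@sinDpi R)) -signr_odd (negbTE ek) mul1r.
Qed.

Lemma cesaro_sin_coef m : cesaro_mean (fourier_sin extremal) m =
  pi^-1 * (2 * intg 0 pi (fun t => extremal t * conj_fejer m t)).
Proof.
have E k : fejer_weight R m k * fourier_sin extremal k = pi^-1 *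
    intg (- pi) pi (fun t => fejer_weight R m k * (extremal t * sin (k%:R * t))).
  by rewrite /fourier_sin -/(intg _ _ _) mulrCA intgZ//; cts.
rewrite /cesaro_mean; under eq_bigr do rewrite E.
rewrite -mulr_sumr -intg_sum; last by move=> k; cts.
congr (_ * _).
have -> : intg (- pi) pi (fun t => \sum_(1 <= i < m.+1)
      fejer_weight R m i * (extremal t * sin (i%:R * t))) =
    intg (- pi) pi (fun t => extremal t * conj_fejer m t).
  apply: eq_intg => t _; rewrite /conj_fejer mulr_sumr.
  by apply: eq_bigr => k _; ring.
rewrite intg_sym; last by cts.
rewrite -intgZ; last by cts.
by apply: eq_intg => t _; rewrite extremalN conj_fejerN; ring.
Qed.

(** Lower counterpart of [mean_difference]. On [1/(j+1), 1/j] the conjugate kernel is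
at least j up to admissible errors and [extremal] at least
omega(1/(n (j+1))) / 2; this half is made up by the folding of [- pi, pi]. *)
Lemma cesaro_sin_coef_lower m : (0 < m)%N ->
  pi^-1 * (\sum_(1 <= j < m.+1) om (n%:R * j.+1%:R)^-1 / j.+1%:R -
    102 * om n%:R^-1) <= cesaro_mean (fourier_sin extremal) m.
Proof.
move=> m0; have pi0 := pi_gt0 R; have pi2 := pi_ge2 R; have pi4 := pihalf_lt2 R.
rewrite cesaro_sin_coef ler_wpM2l ?invr_ge0 ?(ltW pi0)//.
(* 102 = 2 (1 + 20 + 30): the errors on [0, 1/(m+1)], [1/(m+1), 1] and [1, pi]. *)
set w := om n%:R^-1.
have w0 : 0 <= w by apply: (om_ge0 homega); rewrite invr_ge0.
have mR : 0 < m.+1%:R :> R by [].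
have mv1 : m.+1%:R^-1 <= 1 :> R by rewrite invf_le1 ?ler1n.
have mv0 : 0 < m.+1%:R^-1 :> R by rewrite invr_gt0.
pose h t := extremal t * conj_fejer m t.
have ch : continuous h by rewrite /h; cts.
have pi1 : 1 <= pi :> R by lra.
rewrite -/h (@intg_split _ 0 m.+1%:R^-1 pi h (ltW mv0) (le_trans mv1 pi1) ch).
rewrite (@intg_split _ m.+1%:R^-1 1 pi h mv1 pi1 ch).
have h1 : `|intg 0 m.+1%:R^-1 h| <= w.
  have -> : w = w * m.+1%:R * (m.+1%:R^-1 - 0) by rewrite subr0 mulfK// gt_eqF.
  apply: norm_intg_le_cst => [||t _]; [exact: ltW|by []|].
  by rewrite normrM; apply: ler_pM => //; [exact: extremal_bound|exact: conj_fejer_le].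
have h3 : `|intg 1 pi h| <= 30 * w.
  apply: (@le_trans _ _ (w * 10 * (pi - 1))); last first.
    have : w * (pi - 1) <= w * 3 by rewrite ler_wpM2l//; lra.
    by lra.
  apply: norm_intg_le_cst => // t /andP[t1 tpi].
  have t0 : 0 < t by apply: lt_le_trans t1.
  have tp : 0 < t <= pi by rewrite t0.
  rewrite normrM; apply: ler_pM => //; first exact: extremal_bound.
  have := conj_fejer_hcot m tp; have /andP[c1 c2] := hcot_le tp.
  have := ler_normD (conj_fejer m t - hcot t) (hcot t).
  rewrite subrK (ger0_norm c1).
  have d1 : 9 / (m.+1%:R * t ^+ 2) <= 9.
    rewrite ler_pdivrMr ?mulr_gt0 ?exprn_gt0// ler_peMr//.
    have t2 : 1 <= t ^+ 2 by exact: exprn_ege1.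
    by apply: le_trans t2 _; rewrite ler_peMl ?ler1n// exprn_ge0// ltW.
  have d2 : t^-1 <= 1 by rewrite invf_le1.
  by move: d1 (t^-1) d2 c2 => + b; move: (9 / _) => a; lra.
pose b j := om (n%:R * j.+1%:R)^-1 / 2 * j%:R -
    w * (2 + 9 * (j.+1%:R ^+ 2 / m.+1%:R)).
have h2 : \sum_(1 <= j < m.+1) b j * (j%:R * j.+1%:R)^-1 <= intg m.+1%:R^-1 1 h.
  have := @intg_blocks R h 1 m.+1 ch isT; rewrite invr1 => ->.
  apply: ler_sum_nat => j /andP[j0 jm]; rewrite -block_length//.
  apply: intg_ge_cst => //; first exact: block_le.
  move=> t /andP[jt tj].
  have jv0 : 0 < j.+1%:R^-1 :> R by rewrite invr_gt0.
  have t0 : 0 < t := lt_le_trans jv0 jt.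
  have jR : 0 < j%:R :> R by rewrite ltr0n.
  have t1 : t <= 1 by apply: le_trans tj _; rewrite invf_le1 ?ler1n.
  have tp : 0 < t <= pi by rewrite t0 (le_trans t1).
  have t01 : 0 <= t <= 1 by rewrite (ltW t0).
  have t01' : 0 < t <= 1 by rewrite t0.
  have e0 : om (n%:R * j.+1%:R)^-1 / 2 <= extremal t.
    apply: le_trans (extremal_lower t01); rewrite ler_wpM2r ?invr_ge0//.
    apply: (om_le homega); first by rewrite invr_ge0 mulr_ge0.
    by rewrite invfM mulrC ler_wpM2r ?invr_ge0.
  have o0 : 0 <= om (n%:R * j.+1%:R)^-1 / 2.
    by rewrite divr_ge0//; apply: (om_ge0 homega); rewrite invr_ge0 mulr_ge0.
  have ew : extremal t <= w := le_trans (ler_norm _) (extremal_bound t).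
  have tVj : j%:R <= t^-1 by rewrite -[leLHS]invrK lef_pV2 ?posrE ?invr_gt0.
  have tVj1 : t^-1 <= j.+1%:R by rewrite -[leRHS]invrK lef_pV2 ?posrE ?invr_gt0.
  have kl : t^-1 - (2 + 9 * (j.+1%:R ^+ 2 / m.+1%:R)) <= conj_fejer m t.
    have c1 := hcot_ge t01'.
    have c2 := conj_fejer_hcot m tp.
    have c3 : 9 / (m.+1%:R * t ^+ 2) <= 9 * (j.+1%:R ^+ 2 / m.+1%:R).
      rewrite ler_wpM2l// invfM mulrC ler_wpM2r ?invr_ge0//.
      by rewrite -exprVn lerXn2r ?nnegrE ?invr_ge0// ltW.
    move: c2; rewrite ler_norml => /andP[c2 _].
    rewrite -lerN2 in c3; have := lerD c1 (le_trans c3 c2).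
    by rewrite (addrC (hcot t)) subrK -[in X in X -> _]addrA -opprD.
  have e00 : 0 <= extremal t := le_trans o0 e0.
  rewrite /b /h; apply: le_trans (ler_wpM2l e00 kl); rewrite mulrBr.
  apply: lerB; first exact: ler_pM.
  by rewrite ler_wpM2r// addr_ge0// mulr_ge0// divr_ge0// exprn_ge0.
have h4 : (\sum_(1 <= j < m.+1) om (n%:R * j.+1%:R)^-1 / j.+1%:R) / 2 - 20 * w <=
    \sum_(1 <= j < m.+1) b j * (j%:R * j.+1%:R)^-1.
  apply: (@le_trans _ _ (\sum_(1 <= j < m.+1) (om (n%:R * j.+1%:R)^-1 / j.+1%:R / 2 -
      w * (2 * (j%:R * j.+1%:R)^-1 + 18 / m.+1%:R)))).
    rewrite sumrB -mulr_suml; apply: lerB => //.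
    rewrite -mulr_sumr big_split /= -mulr_sumr sumr_const_nat subn1 /=.
    have -> : 20 * w = w * (2 * 1 + 18) by ring.
    rewrite ler_wpM2l//; apply: lerD.
      rewrite ler_wpM2l//; have := @sum_block_length R 1 m.+1 isT; by rewrite invr1.
    have -> : 18 / m.+1%:R *+ m = 18 * (m%:R / m.+1%:R) :> R.
      by rewrite -mulr_natr; ring.
    by rewrite ler_piMr// ler_pdivrMr// mul1r ler_nat.
  apply: ler_sum_nat => j /andP[j0 jm].
  have jR : 0 < j%:R :> R by rewrite ltr0n.
  have -> : b j * (j%:R * j.+1%:R)^-1 = om (n%:R * j.+1%:R)^-1 / j.+1%:R / 2 -
      w * (2 * (j%:R * j.+1%:R)^-1 + 9 * (j.+1%:R / j%:R) / m.+1%:R).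
    rewrite /b; move: (om _) => a; field.
    by rewrite !nat1r !pnatr_eq0 /= -lt0n j0.
  apply: lerB => //; rewrite ler_wpM2l// lerD2l ler_wpM2r ?invr_ge0//.
  have : j.+1%:R / j%:R <= 2 :> R by rewrite ler_pdivrMr// natS_le_double.
  by lra.
move: h1 h3; rewrite !ler_norml => /andP[h1 _] /andP[h3 _].
have h24 := le_trans h4 h2.
move: h1 h3 h24; move: (intg _ _ _) (intg _ _ _) (intg _ _ _) (\sum_(_ <= _ < _) _).
by clear => i1 i2 i3 s; lra.
Qed.

End ExtremalFunction.

Section LowerBound.
Variables (R : realType) (psi om : R -> R).
Hypotheses (homega : modulus_of_continuity om) (hconv : convex_upwards om).
Hypotheses (Mpsi : Mset psi).
Implicit Types (j k l m n N M J : nat) (s t x y : R).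

Let b n k : R := fourier_sin (extremal om n) k.

(** Its (psi, beta)-derivative is the N-th Fejer mean of [extremal], at n x. *)
Definition extremal_poly n g N x : R :=
  \sum_(1 <= k < N.+1) fejer_weight R N k * b n k * psi (n * k)%:R *
    cos ((n * k)%:R * x - (g + pi / 2)).

Definition extremal_deriv n N x : R :=
  \sum_(1 <= k < N.+1) fejer_weight R N k * b n k *
    cos ((n * k)%:R * x - pi / 2).

Lemma extremal_derivE n N x : (0 < n)%N ->
  extremal_deriv n N x = fejer_mean (extremal om n) N (n%:R * x).
Proof.
move=> n0; rewrite /extremal_deriv /fejer_mean /fejer_sum.
rewrite (extremal_cos_coef homega) mul0r add0r; apply: eq_bigr => k _.
rewrite /shifted_harmonic (extremal_cos_coef homega) mul0r add0r subr0 cosBpihalf natrM.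
by rewrite mulrA [k%:R * _]mulrA [k%:R * n%:R]mulrC.
Qed.

Lemma cos_poly_periodic (a : nat -> R) (fr : nat -> nat) M d :
  periodic (fun x => \sum_(1 <= i < M) a i * cos ((fr i)%:R * x - d)) (2 * pi).
Proof.
move=> x; apply: eq_bigr => i _; congr (_ * _).
have -> : (fr i)%:R * (x + 2 * pi) - d = (fr i)%:R * x - d + (fr i)%:R * (2 * pi) by ring.
by rewrite cos_period_nat.
Qed.

(** Its derivative is a Fejer mean of the function x |-> extremal (n x), whose modulus
of continuity is at most omega, and Fejer means do not increase moduli. *)
Lemma extremal_poly_class beta n N : (0 < n)%N ->
  Cclass psi beta om (extremal_poly n (beta * pi / 2) N).
Proof.
move=> n0; set g := beta * pi / 2.
have nR : 0 < n%:R :> R by rewrite ltr0n.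
have fr0 i : (0 < i)%N -> (0 < n * i)%N by rewrite muln_gt0 n0.
have cf : continuous (extremal_poly n g N) by rewrite /extremal_poly; cts.
have cp : continuous (extremal_deriv n N) by rewrite /extremal_deriv; cts.
have pf : periodic (extremal_poly n g N) (2 * pi).
  exact: (@cos_poly_periodic (fun k => fejer_weight R N k * b n k * psi (n * k)%:R)).
have pp : periodic (extremal_deriv n N) (2 * pi).
  exact: (@cos_poly_periodic (fun k => fejer_weight R N k * b n k)).
have Ff k y : fourier_cos (extremal_poly n g N) k * cos y +
    fourier_sin (extremal_poly n g N) k * sin y =
    \sum_(1 <= i < N.+1) fejer_weight R N i * b n i * psi (n * i)%:R *
      (if k == (n * i)%N then cos (y - (g + pi / 2)) else 0).
  exact: (@fourier_term_polynomial R N.+1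
    (fun k => fejer_weight R N k * b n k * psi (n * k)%:R)).
have Fp k y : fourier_cos (extremal_deriv n N) k * cos y +
    fourier_sin (extremal_deriv n N) k * sin y =
    \sum_(1 <= i < N.+1) fejer_weight R N i * b n i *
      (if k == (n * i)%N then cos (y - pi / 2) else 0).
  exact: (@fourier_term_polynomial R N.+1 (fun k => fejer_weight R N k * b n k)).
split; first by split.
exists (extremal_deriv n N).
  split.
  - by split => //; exact: ct_integrable.
  - by split => //; exact: ct_integrable.
  - move=> x; rewrite /fourier_term.
    have := Fp 0%N 0; rewrite cos0 sin0 mulr1 mulr0 addr0 => ->.
    rewrite big_nat big1 ?mul0r// => i /andP[i0 _].
    by rewrite ltn_eqF ?mulr0// fr0.
  - move=> k x k0; rewrite Ff mulr_sumr.
    have -> : fourier_term (extremal_deriv n N) k x =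
      fourier_cos (extremal_deriv n N) k * cos (k%:R * x) +
      fourier_sin (extremal_deriv n N) k * sin (k%:R * x) by case: k k0.
    rewrite Fp big_nat [RHS]big_nat; apply: eq_bigr => i /andP[i0 _].
    case: eqP => [->|_]; last by rewrite !mulr0.
    have p0 : psi (n * i)%:R != 0.
      by rewrite gt_eqF// (psi_gt0 Mpsi)// ler1n muln_gt0 n0.
    have -> : (n * i)%:R * x + beta * pi / 2 - (g + pi / 2) = (n * i)%:R * x - pi / 2.
      by rewrite /g; ring.
    by rewrite [X in _ = _ * X]mulrAC [RHS]mulrC mulfK.
split; first by split.
move=> x y; rewrite !extremal_derivE//; apply: fejer_mean_contract.
- exact: extremal_ct.
- exact: extremal_periodic.
- move=> t; apply: le_trans (extremal_modulus homega hconv n _ _) _.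
  have -> : n%:R * x + t - (n%:R * y + t) = n%:R * (x - y) by ring.
  by rewrite normrM normr_nat mulrC mulKf// gt_eqF.
Qed.

(** Only odd multiples of the frequency n occur. *)
Lemma extremal_poly_alternates n g N x : (0 < n)%N ->
  extremal_poly n g N (x + pi / n%:R) = - extremal_poly n g N x.
Proof.
move=> n0; have nR : n%:R != 0 :> R by rewrite pnatr_eq0 -lt0n.
rewrite /extremal_poly -sumrN; apply: eq_bigr => k _.
have -> : (n * k)%:R * (x + pi / n%:R) - (g + pi / 2) =
    (n * k)%:R * x - (g + pi / 2) + pi *+ k.
  have e : n%:R * (pi / n%:R) = pi :> R by rewrite mulrC divfK.
  have -> : (n * k)%:R * (x + pi / n%:R) =
      (n * k)%:R * x + k%:R * (n%:R * (pi / n%:R)) by rewrite natrM; ring.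
  by rewrite e -mulr_natl; ring.
rewrite (alternatingn (@cosDpi R)) -signr_odd; case: (boolP (odd k)) => ok.
  by rewrite expr1; ring.
by rewrite /b (extremal_sin_coef_even homega)// !(mulr0, mul0r) oppr0.
Qed.

Let p n k : R := psi (n * k)%:R.

Let p_gt0 n k : (0 < n)%N -> (0 < k)%N -> 0 < p n k.
Proof. by move=> n0 k0; apply: (psi_gt0 Mpsi); rewrite ler1n muln_gt0 n0. Qed.

(** The derivative is a sine series, so at 0 the phase shift contributes sin g to
every harmonic of the function. *)
Lemma extremal_poly0 n g N :
  `|extremal_poly n g N 0| =
  `|sin g| * `|\sum_(1 <= k < N.+1) damped (p n) N k * b n k|.
Proof.
rewrite -normrM; rewrite -[RHS]normrN; congr `|_|.
rewrite /extremal_poly -mulNr mulr_sumr big_nat [RHS]big_nat.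
apply: eq_bigr => k /andP[k0 kN].
have kN' : (k <= N)%N by [].
rewrite dampedE// mulr0 add0r cosN.
by rewrite cosDpihalf /p; ring.
Qed.

(** The terms of the series decrease, so each of the n terms with index in
[n i, n (i + 1)) is at most the first. *)
Lemma lead_sum_blocks n J : (0 < n)%N -> (0 < J)%N ->
  lead_sum psi om n (n * J) <=
  \sum_(1 <= i < J) p n i * om (n%:R * i%:R)^-1 / i%:R.
Proof.
move=> n0; elim: J => [//|J IH] _.
have nR : 0 < n%:R :> R by rewrite ltr0n.
case: J IH => [|J IH].
  by move=> _; rewrite /lead_sum muln1 !big_geq.
rewrite /lead_sum (@big_cat_nat _ _ _ (n * J.+1))//=; last 2 first.
- by rewrite leq_pmulr.
- by rewrite leq_pmul2l.
rewrite [leRHS]big_nat_recr//=; apply: lerD; first exact: IH.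
have JR : 0 < J.+1%:R :> R by [].
apply: (@le_trans _ _ (\sum_(n * J.+1 <= j < n * J.+2)
    p n J.+1 * om (n%:R * J.+1%:R)^-1 / (n%:R * J.+1%:R))).
  apply: ler_sum_nat => j /andP[nj _].
  have nJ0 : (0 < n * J.+1)%N by rewrite muln_gt0 n0.
  have j0 : (0 < j)%N := leq_trans nJ0 nj.
  have jv : j%:R^-1 <= (n%:R * J.+1%:R)^-1 :> R.
    by rewrite -natrM; apply: inv_nat_le; rewrite nJ0.
  have o0 : 0 <= om j%:R^-1 by apply: (om_ge0 homega); rewrite invr_ge0.
  have pj : 0 <= psi j%:R by apply/ltW/(psi_gt0 Mpsi); rewrite ler1n.
  apply: ler_pM; [exact: mulr_ge0|by rewrite invr_ge0| |exact: jv].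
  apply: ler_pM => //.
    by apply: (psi_le Mpsi); rewrite ?ler1n ?ler_nat.
  by apply: (om_le homega) => //; rewrite invr_ge0.
rewrite sumr_const_nat (_ : (n * J.+2 - n * J.+1 = n)%N); last by rewrite -mulnBr subSnn muln1.
rewrite -mulr_natr le_eqVlt; apply/orP; left; apply/eqP.
by move: (om _) (p _ _) => a c; field; rewrite nat1r !gt_eqF.
Qed.

(** Double summation by parts from the first term on, as the weights are
nonnegative. *)
Lemma extremal_sum_lower n N : (0 < n)%N -> (0 < N)%N ->
  pi^-1 * (\sum_(2 <= i < N.+1) damped (p n) N i * om (n%:R * i%:R)^-1 / i%:R -
     204 * (p n 1 * om n%:R^-1)) <=
  \sum_(1 <= k < N.+1) damped (p n) N k * b n k.
Proof.
move=> n0 N0; have nR : 0 < n%:R :> R by rewrite ltr0n.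
have pi0 := pi_gt0 R.
set th := damped (p n) N; set w := om n%:R^-1.
have w0 : 0 <= w by apply: (om_ge0 homega); rewrite invr_ge0.
have p_ge0 k : (0 < k)%N -> 0 <= p n k by move=> k0; apply/ltW/p_gt0.
have p_ni k : (0 < k)%N -> p n k.+1 <= p n k.
  by move=> k0; apply: (psi_le Mpsi); rewrite ?ler1n ?ler_nat ?muln_gt0 ?n0// leq_mul.
have p_cv k : (0 < k)%N -> 0 <= diff2 (p n) k.
  by move=> k0; exact: (psi_seq_convex Mpsi n0 k0).
have th0 k : (N < k)%N -> th k = 0 by exact: damped_eq0.
have th_ge0 k : (0 < k)%N -> 0 <= th k by exact: damped_ge0.
have th_ni k : (0 < k)%N -> th k.+1 <= th k by exact: damped_noninc.
have N1 : (0 < 1 <= N.+1)%N by [].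
rewrite (abel_twice th0 (b n) N1) [X in _ <= _ + X]big_geq// addr0.
pose G j := om (n%:R * j.+1%:R)^-1 / j.+1%:R.
have G0 j : 0 <= G j.
  by rewrite divr_ge0//; apply: (om_ge0 homega); rewrite invr_ge0 mulr_ge0// ltW.
apply: (@le_trans _ _ (\sum_(1 <= m < N.+1) m.+1%:R * diff2 th m *
    (pi^-1 * (\sum_(1 <= j < m.+1) G j - 102 * w)))); last first.
  apply: ler_sum_nat => m /andP[m0 mN].
  have th_cv : 0 <= diff2 th m by exact: damped_convex.
  rewrite ler_wpM2l ?mulr_ge0//.
  exact: (cesaro_sin_coef_lower homega hconv n m0).
under [leRHS]eq_bigr do rewrite mulrCA mulrBr.
rewrite -mulr_sumr ler_wpM2l ?invr_ge0 ?(ltW pi0)//.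
rewrite sumrB -mulr_suml sum_triangle.
rewrite (finite_sum_diff2_mulS th0 (isT : (1 <= N.+1)%N)) mul1r.
apply: lerB; last first.
  have h1 : th 1%N <= p n 1 by exact: damped_le.
  have h2 := th_ge0 2%N isT.
  have h3 : th 1%N * w <= p n 1 * w by rewrite ler_wpM2r.
  have h4 : 0 <= th 2%N * w by rewrite mulr_ge0.
  by lra.
rewrite big_add1 /=.
apply: (@le_trans _ _ (\sum_(1 <= j < N.+1) th j.+1 * om (n%:R * j.+1%:R)^-1 / j.+1%:R)).
  by rewrite [leRHS]big_nat_recr//= (th0 N.+1)// !mul0r addr0.
apply: ler_sum_nat => j /andP[j0 jN].
rewrite (finite_sum_diff2_mulS th0 (ltnW jN)) -mulrA mulrC /G ler_wpM2l ?G0//.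
by apply: le_trans (th_ni j j0) _; rewrite lerDl mulr_ge0// subr_ge0 th_ni.
Qed.

Hypothesis psi_int :
  (\int[@lebesgue_measure R]_(t in `[1%R, +oo[) (psi t / t)%:E < +oo)%E.

(** The error of the extremal polynomial of order nN is at least its value at 0,
a sum of terms with the weights 1 - i/(N+1). For fixed J the weights of the
first J terms tend to 1 as N grows; then J is arbitrary. *)
Lemma class_approx_lower beta n E : (0 < n)%N ->
  (class_approx n (Cclass psi beta om) <= E%:E)%E ->
  pi^-1 * `|sin (beta * pi / 2)| * lead_integral psi om n <=
    E + 205 * (psi n%:R * om n%:R^-1).
Proof.
move=> n0 hE; set g := beta * pi / 2; set w := om n%:R^-1.
have nR : 0 < n%:R :> R by rewrite ltr0n.
have pi0 := pi_gt0 R; have pi2 := pi_ge2 R.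
have w0 : 0 <= w by apply: (om_ge0 homega); rewrite invr_ge0.
have p1 : 0 <= psi n%:R by apply/ltW/(psi_gt0 Mpsi); rewrite ler1n.
have pw0 : 0 <= psi n%:R * w by rewrite mulr_ge0.
have fE N : `|extremal_poly n g N 0| <= E.
  rewrite -lee_fin; apply: le_trans hE.
  apply: le_trans (best_approx_alternating n0 _) _.
    by move=> x; apply: extremal_poly_alternates.
  apply: ereal_sup_ubound; exists (extremal_poly n g N) => //.
  exact: extremal_poly_class.
set q := pi^-1 * `|sin g|.
have q0 : 0 <= q by rewrite mulr_ge0// invr_ge0 ltW.
have q1 : q <= 1.
  rewrite /q mulr_ile1 ?invr_ge0 ?(ltW pi0) ?sin_max// invf_le1//; lra.
pose A J := \sum_(2 <= i < J) p n i * om (n%:R * i%:R)^-1 / i%:R.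
have a0 i : (0 < i)%N -> 0 <= p n i * om (n%:R * i%:R)^-1 / i%:R.
  move=> i0; rewrite divr_ge0// mulr_ge0 ?(ltW (p_gt0 _ _))//.
  by apply: (om_ge0 homega); rewrite invr_ge0 mulr_ge0// ltW.
have A0 J : 0 <= A J.
  by rewrite /A big_nat sumr_ge0// => i /andP[i2 _]; apply: a0; exact: ltnW.
have finN J N : (0 < J <= N)%N -> q * (A J * (1 - J%:R / N.+1%:R)) <=
    E + 204 * (psi n%:R * w).
  move=> /andP[J0 JN]; have N0 : (0 < N)%N := leq_trans J0 JN.
  have h1 := extremal_sum_lower n0 N0.
  have h2 := fE N; rewrite extremal_poly0 in h2.
  set S := \sum_(1 <= k < N.+1) _ in h1 h2.
  have h3 : A J * (1 - J%:R / N.+1%:R) <=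
      \sum_(2 <= i < N.+1) damped (p n) N i * om (n%:R * i%:R)^-1 / i%:R.
    have d0 i : (0 < i)%N -> 0 <= damped (p n) N i.
      by move=> i0; apply: damped_ge0 => // k k0; exact/ltW/p_gt0.
    apply: (@le_trans _ _ (\sum_(2 <= i < J)
        damped (p n) N i * om (n%:R * i%:R)^-1 / i%:R)).
      rewrite /A mulr_suml; apply: ler_sum_nat => i /andP[i2 iJ].
      have i0 : (0 < i)%N := ltnW i2.
      have iN : (i <= N)%N by exact: leq_trans (ltnW iJ) JN.
      have -> : damped (p n) N i * om (n%:R * i%:R)^-1 / i%:R =
          fejer_weight R N i * (p n i * om (n%:R * i%:R)^-1 / i%:R).
        by rewrite dampedE// !mulrA.
      have hw : 1 - J%:R / N.+1%:R <= fejer_weight R N i.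
        by rewrite /fejer_weight lerD2l lerN2 ler_wpM2r ?invr_ge0// ler_nat ltnW.
      by rewrite [leLHS]mulrC; apply: ler_wpM2r => //; exact: a0.
    case: (leqP J 2) => [J2|J2].
      rewrite big_geq// big_nat sumr_ge0// => i /andP[i2 _].
      rewrite divr_ge0// mulr_ge0 ?d0 ?(ltnW i2)//.
      by apply: (om_ge0 homega); rewrite invr_ge0 mulr_ge0// ltW.
    rewrite [leRHS](@big_cat_nat _ _ _ J)//=; [|exact: ltnW|by rewrite leqW].
    rewrite lerDl big_nat sumr_ge0// => i /andP[Ji _].
    have i0 : (0 < i)%N := leq_trans J0 Ji.
    rewrite divr_ge0// mulr_ge0 ?d0//.
    by apply: (om_ge0 homega); rewrite invr_ge0 mulr_ge0// ltW.
  set D := \sum_(2 <= i < N.+1) _ in h1 h3.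
  have h4 : `|sin g| * S <= E.
    by apply: le_trans h2; rewrite ler_wpM2l// ler_norm.
  have h5 := ler_wpM2l (normr_ge0 (sin g)) h1.
  have h6 := ler_wpM2l q0 h3.
  have h7 : q * (204 * (psi n%:R * w)) <= 1 * (204 * (psi n%:R * w)).
    by apply: ler_wpM2r q1; apply: mulr_ge0 pw0; exact: ler0n.
  have e : `|sin g| * (pi^-1 * (D - 204 * (p n 1 * w))) =
      q * D - q * (204 * (psi n%:R * w)) by rewrite /q /p muln1; ring.
  rewrite -/w e in h5; have := le_trans h5 h4; rewrite lerBlDr => h8.
  apply: le_trans h6 _; apply: le_trans h8 _.
  by rewrite lerD2l; apply: le_trans h7 _; rewrite mul1r.
have finJ J : (0 < J)%N -> q * A J <= E + 204 * (psi n%:R * w).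
  move=> J0; apply/ler_addgt0Pr => e e0.
  pose N := maxn J (Num.truncn (J%:R * A J / e)).
  have := finN J N; rewrite J0 leq_maxl => /(_ isT).
  have hN : A J * (J%:R / N.+1%:R) <= e.
    rewrite mulrA ler_pdivrMr// mulrC.
    rewrite [leRHS]mulrC -ler_pdivrMr//.
    apply: le_trans (ltW (truncnS_gt _)) _.
    by rewrite ler_nat ltnS leq_maxr.
  have -> : q * (A J * (1 - J%:R / N.+1%:R)) = q * A J - q * (A J * (J%:R / N.+1%:R)) by ring.
  have AJ0 : 0 <= A J * (J%:R / N.+1%:R) by rewrite mulr_ge0// divr_ge0.
  have h : q * (A J * (J%:R / N.+1%:R)) <= 1 * (A J * (J%:R / N.+1%:R)).
    by rewrite ler_wpM2r.
  rewrite lerBlDr => h9; apply: le_trans h9 _; rewrite lerD2l.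
  by apply: le_trans h _; rewrite mul1r.
case: (eqVneq q 0) => [q00|qn0].
  have := finJ 1%N isT; rewrite q00 !mul0r; lra.
have qp : 0 < q by rewrite lt_neqAle eq_sym qn0.
rewrite -ler_pdivlMl//; apply: (lead_integral_upper homega Mpsi psi_int n0) => N.
rewrite ler_pdivlMl//.
apply: (@le_trans _ _ (q * lead_sum psi om n (n * N.+2))).
  rewrite ler_wpM2l// /lead_sum; case: (leqP N n) => [Nn|nN].
    rewrite big_geq// big_nat sumr_ge0// => j /andP[nj _].
    by apply: (lead_term_ge0 homega Mpsi); exact: leq_trans nj.
  rewrite [leRHS](@big_cat_nat _ _ _ N)//=; [|exact: ltnW|].
    rewrite lerDl big_nat sumr_ge0// => j /andP[nj _].
    by apply: (lead_term_ge0 homega Mpsi); exact: leq_trans (ltn_trans n0 nN) nj.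
  by rewrite (leq_trans (leqW (leqnSn N)))// leq_pmull.
apply: le_trans (ler_wpM2l q0 (lead_sum_blocks n0 (isT : (0 < N.+2)%N))) _.
(* The first block, absent from A, accounts for the passage from 204 to 205. *)
rewrite big_ltn// mulrDr divr1 mulr1 /p muln1 -/(A N.+2).
have h1 := finJ N.+2 isT.
have h2 : q * (psi n%:R * w) <= 1 * (psi n%:R * w) by rewrite ler_wpM2r.
by rewrite -/w; rewrite /A /p in h1 *; lra.
Qed.

End LowerBound.

(** * Size of the leading term *)

Section LittleO.
Variables (R : realType) (psi om : R -> R).
Hypotheses (homega : modulus_of_continuity om) (hconv : convex_upwards om).
Hypothesis homega_lim :
  right_derivative om n%:R^-1 / (om n%:R^-1 * n%:R) @[n --> \oo] --> (0 : R).
Hypothesis Mpsi : Mset psi.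
Hypothesis hpsi_lim :
  `|right_derivative psi n%:R| * n%:R / psi n%:R @[n --> \oo] --> (0 : R).
Hypothesis psi_int :
  (\int[@lebesgue_measure R]_(t in `[1%R, +oo[) (psi t / t)%:E < +oo)%E.

Lemma harmonic_dyadic n p : (0 < n)%N ->
  p%:R / 2 <= \sum_(n.+1 <= j < (2 ^ p * n).+1) j%:R^-1 :> R.
Proof.
move=> n0; elim: p => [|p IH]; first by rewrite mul0r expn0 mul1n big_geq.
have pn0 : (0 < 2 ^ p * n)%N by rewrite muln_gt0 expn_gt0.
have pE : (2 ^ p.+1 * n = 2 ^ p * n + 2 ^ p * n)%N by rewrite expnS; lia.
rewrite (@big_cat_nat _ _ _ (2 ^ p * n).+1)//=; last 2 first.
- by rewrite ltnS leq_pmull// expn_gt0.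
- by rewrite ltnS pE leq_addr.
rewrite -natr1 mulrDl; apply: lerD => //.
apply: (@le_trans _ _ (\sum_((2 ^ p * n).+1 <= j < (2 ^ p.+1 * n).+1)
    (2 ^ p.+1 * n)%:R^-1)).
  rewrite sumr_const_nat pE subSS addKn -[leRHS]mulr_natr.
  have q0 : (2 ^ p * n)%:R != 0 :> R by rewrite pnatr_eq0 -lt0n.
  rewrite natrD; move: (_ %:R) q0 => q q0.
  by rewrite -mulr2n -[q *+ 2]mulr_natr invfM mulrAC mulVf.
by apply: ler_sum_nat => j /andP[j1 j2]; apply: inv_nat_le; rewrite (leq_trans _ j1).
Qed.

(** Slow variation of psi and omega makes psi(j) omega(1/j) comparable to
psi(n) omega(1/n) for j up to any fixed multiple of n, so the leading term
contains arbitrarily long pieces of the harmonic series. *)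
Lemma lead_integral_dominates A : exists n0, forall n, (n0 < n)%N ->
  A * (psi n%:R * om n%:R^-1) <= lead_integral psi om n.
Proof.
(* psi and omega lose a factor 2 each, and a dyadic block of the harmonic series
   weighs 1/2. *)
pose p := (Num.truncn (8 * A)).+1; pose Q : R := (2 ^ p)%:R.
have Q1 : 1 <= Q by rewrite /Q ler1n expn_gt0.
have Q0 : 0 < Q := lt_le_trans ltr01 Q1.
have e1 : 0 < Q^-1 by rewrite invr_gt0.
have e2 : 0 < (2 * Q)^-1 by rewrite invr_gt0 mulr_gt0.
have [n1 H1] := om_slow homega hconv homega_lim e1.
have [n2 H2] := psi_slow Mpsi hpsi_lim e2.
exists (maxn n1 n2) => n; rewrite gtn_max => /andP[nn1 nn2].
have n0 : (0 < n)%N by exact: leq_ltn_trans nn1.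
have nR : 0 < n%:R :> R by rewrite ltr0n.
set P := psi n%:R; set w := om n%:R^-1.
have P0 : 0 < P by apply: (psi_gt0 Mpsi); rewrite ler1n.
have w0 : 0 <= w by apply: (om_ge0 homega); rewrite invr_ge0.
apply: le_trans (lead_integral_lower homega Mpsi psi_int (2 ^ p * n).+1 n0).
apply: (@le_trans _ _ (\sum_(n.+1 <= j < (2 ^ p * n).+1) (P * w / 4) * j%:R^-1)).
  rewrite -mulr_sumr mulrC -!mulrA ler_pM2l//; apply: ler_wpM2l => //.
  have h := harmonic_dyadic p n0.
  have h8 : 8 * A <= p%:R by apply/ltW; exact: truncnS_gt.
  by rewrite mulrC ler_pdivlMr//; apply: le_trans h; rewrite ler_pdivlMr//; lra.
apply: ler_sum_nat => j /andP[nj jp].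
have j0 : (0 < j)%N by exact: leq_ltn_trans nj.
have jR : 0 < j%:R :> R by rewrite ltr0n.
have jn : n%:R <= j%:R :> R by rewrite ler_nat ltnW.
have jQ : j%:R <= Q * n%:R by rewrite -natrM ler_nat.
apply: ler_wpM2r; first by rewrite invr_ge0 ltW.
have hom : w <= om j%:R^-1 * 2.
  have oj : 0 <= om j%:R^-1 by apply: (om_ge0 homega); rewrite invr_ge0 ltW.
  apply: le_trans (H1 j _ n%:R^-1 _) _.
  - exact: ltn_trans nj.
  - by rewrite lef_pV2.
  apply: ler_wpM2l => //; rewrite (_ : 2 = 1 + 1)// lerD2l mulrC ler_pdivrMr// mul1r.
  rewrite mulrBr mulfV ?gt_eqF// lerBlDr; apply: (@le_trans _ _ Q); last by rewrite lerDl.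
  by rewrite ler_pdivrMr.
have hpsi : P <= psi j%:R * 2.
  have := H2 n nn2 j%:R jn; rewrite -/P => h.
  have h' : n%:R * (P - psi j%:R) <= n%:R * (P / 2).
    apply: le_trans h _; rewrite -mulrA mulrC ler_pdivrMr ?mulr_gt0//.
    have -> : n%:R * (P / 2) * (2 * Q) = P * (Q * n%:R) by field.
    by rewrite ler_pM2l// lerBlDr; apply: le_trans jQ _; rewrite lerDl ltW.
  move: h'; rewrite ler_pM2l//; lra.
have -> : P * w / 4 = (P / 2) * (w / 2) by field.
apply: ler_pM; rewrite ?divr_ge0 ?(ltW P0)// ler_pdivrMr//.
Qed.

End LittleO.

(** * The asymptotic formula *)

(** Reduction of beta / 2 modulo 1, since the sine is positive inside ]0, pi[. *)
Lemma sin_half_pi_eq0 (R : realType) (beta : R) :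
  sin (beta * pi / 2) = 0 -> exists l : int, beta = 2 * l%:~R.
Proof.
move=> s0; pose l := Num.floor (beta / 2); exists l.
pose c : R := beta / 2 - l%:~R.
have c0 : 0 <= c by rewrite subr_ge0 floor_le_tmp.
have c1 : c < 1 by rewrite ltrBlDl -intrD1 floorD1_gt.
have sc : sin (c * pi) = 0.
  have sD k x : sin x = 0 -> sin (x + pi *+ k) = 0 :> R.
    by move=> x0; rewrite (alternatingn (@sinDpi R)) x0 mulr0.
  have sZ (z : int) : sin ((beta / 2 - z%:~R) * pi) = 0; last exact: sZ.
  case: z => k.
    have -> : (beta / 2 - k%:~R) * pi = - (- (beta * pi / 2) + pi *+ k).
      by rewrite -mulr_natl -pmulrn; ring.
    by rewrite sinN sD ?oppr0// sinN s0 oppr0.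
  have -> : (beta / 2 - (Negz k)%:~R) * pi = beta * pi / 2 + pi *+ k.+1.
    by rewrite -mulr_natl NegzE mulrNz -pmulrn; ring.
  exact: sD.
suff : c = 0 by move=> /eqP; rewrite subr_eq0 => /eqP <-; rewrite mulrC divfK.
apply/eqP; rewrite eq_le c0 andbT leNgt; apply/negP => cp.
have cpi : 0 < c * pi < pi by rewrite mulr_gt0 ?pi_gt0//= gtr_pMl ?pi_gt0.
by have := sin_gt0_pi cpi; rewrite sc ltxx.
Qed.

Section Nonnegativity.
Variables (R : realType) (psi om : R -> R).
Hypotheses (homega : modulus_of_continuity om) (hconv : convex_upwards om).
Hypothesis Mpsi : Mset psi.

(** The supremum is over a nonempty class. *)
Lemma class_approx_ge0 beta n : (0 < n)%N ->
  (0 <= class_approx n (Cclass psi beta om))%E.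
Proof.
move=> n0; pose f := extremal_poly psi om n (beta * pi / 2) 0.
apply: (@le_trans _ _ `|f 0|%:E); first by rewrite lee_fin.
apply: le_trans (best_approx_alternating n0 _) _.
  by move=> x; apply: extremal_poly_alternates.
by apply: ereal_sup_ubound; exists f => //; exact: extremal_poly_class.
Qed.

End Nonnegativity.

Theorem corollary1 (R : realType) (psi omega : R -> R)
    (homega : modulus_of_continuity omega)
    (homega_conv : convex_upwards omega)
    (hpsi_lim :
      `|right_derivative psi n%:R| * n%:R / psi n%:R @[n --> \oo] --> (0 : R))
    (homega_lim :
      right_derivative omega n%:R^-1 / (omega n%:R^-1 * n%:R)
        @[n --> \oo] --> (0 : R)) :
  exists K : R, forall beta : R,
    (forall l : int, beta != 2 * l%:~R) ->
    Mset0' beta psi ->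
    exists r : nat -> R,
      [/\ forall n : nat, (0 < n)%N -> `|r n| <= K,
          forall n : nat, (0 < n)%N ->
            class_approx n (Cclass psi beta omega) =
              (leading_term psi omega beta n
               + r n * (psi n%:R * omega n%:R^-1))%:E
        & (fun n : nat => (r n * (psi n%:R * omega n%:R^-1))%R)
            =o_\oo leading_term psi omega beta].
Proof.
have sin_neq0 (beta : R) : (forall l : int, beta != 2 * l%:~R) ->
    sin (beta * pi / 2) != 0.
  by move=> hb; apply/eqP => /sin_half_pi_eq0[l /eqP]; rewrite (negbTE (hb l)).
(* The constant is chosen before beta; if no beta is admissible there is nothing
   to bound. *)
have [[Mpsi psi_int]|nM] := pselect (Mset psi /\
    (\int[@lebesgue_measure R]_(t in `[1%R, +oo[) (psi t / t)%:E < +oo)%E); last first.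
  exists 0 => beta hb [[Mpsi h] _]; exfalso; apply: nM; split => //.
  exact: h (sin_neq0 _ hb).
have [K1 K10 upper] :=
  class_approx_upper homega homega_conv Mpsi psi_int homega_lim hpsi_lim.
have lower := class_approx_lower homega homega_conv Mpsi psi_int.
pose d n : R := psi n%:R * omega n%:R^-1.
have d0 n : (0 < n)%N -> 0 <= d n.
  move=> n0; apply: mulr_ge0; last by apply: (om_ge0 homega); rewrite invr_ge0.
  by apply/ltW/(psi_gt0 Mpsi); rewrite ler1n.
exists (K1 + 205) => beta hb _; have sb := sin_neq0 _ hb.
pose L n := leading_term psi omega beta n.
pose E n := fine (class_approx n (Cclass psi beta omega)).
have EE n : (0 < n)%N -> class_approx n (Cclass psi beta omega) = (E n)%:E.
  move=> n0; rewrite fineK// ge0_fin_numE; last exact: class_approx_ge0.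
  exact: le_lt_trans (upper beta n n0) (ltry _).
have bound n : (0 < n)%N -> `|E n - L n| <= (K1 + 205) * d n.
  move=> n0; have dn := d0 n n0.
  have := upper beta n n0; rewrite EE// lee_fin => h1.
  have h2 : L n <= E n + 205 * d n by apply: lower => //; rewrite EE.
  have h3 : E n <= L n + K1 * d n := h1.
  have h4 := mulr_ge0 K10 dn.
  by rewrite ler_norml mulrDl; apply/andP; split; lra.
(* When d n = 0 the two bounds coincide, and the quotient is 0. *)
pose r n := (E n - L n) / d n.
have rd n : (0 < n)%N -> r n * d n = E n - L n.
  move=> n0; rewrite /r; have [dn0|dn0] := eqVneq (d n) 0; last by rewrite divfK.
  have := bound n n0; rewrite dn0 !mulr0 normr_le0 => /eqP->.
  by [].
exists r; split.
- move=> n n0; rewrite /r.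
  have [dn0|dn0] := eqVneq (d n) 0.
    by rewrite dn0 invr0 mulr0 normr0 addr_ge0.
  have dp : 0 < d n by rewrite lt_neqAle eq_sym dn0 d0.
  by rewrite normrM normfV (gtr0_norm dp) ler_pdivrMr// bound.
- by move=> n n0; rewrite EE// -/(d n) rd// addrC subrK.
apply/eqoP => e e0.
pose q := pi^-1 * `|sin (beta * pi / 2)|.
have q0 : 0 < q by apply: mulr_gt0; [rewrite invr_gt0 pi_gt0|rewrite normr_gt0].
have [N HN] := lead_integral_dominates homega homega_conv homega_lim Mpsi
  hpsi_lim psi_int ((K1 + 205) / (e * q)).
exists N.+1 => // n /= Nn.
have n0 : (0 < n)%N by exact: leq_ltn_trans Nn.
rewrite -/(d n) rd//; apply: le_trans (bound n n0) _.
have h := HN n Nn; rewrite -/(d n) in h.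
apply: (@le_trans _ _ (e * L n)); last by rewrite ler_pM2l// ler_norm.
have -> : L n = q * lead_integral psi omega n by [].
have := ler_wpM2l (ltW (mulr_gt0 e0 q0)) h.
rewrite mulrA [e * q * _]mulrC divfK ?(gt_eqF (mulr_gt0 e0 q0))//.
by rewrite -[X in _ <= X -> _]mulrA.
Qed.
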